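(* Let $-1/2\leq m\leq 1$, $m\neq 0$, $s>1/2$, and put $\mu:=\min\{2\sqrt{1+m},\ \tfrac32\sqrt{4+m}\}$, $\varepsilon_0:=0.08\sqrt\mu$, and $\mathfrak c:=1$ if $m\ge 0$, $\mathfrak c:=(1+m)^{-1/2}$ if $-1/2\le m<0$. Let $u_0\in H^{s+2}_*$, $v_0\in H^{s}_*$, and set $$\varepsilon:=\max\{|u_0|_1\,,\ |v_0|_{\tilde H^{-1}}\},\qquad \varepsilon_1:=\min\left\{\varepsilon_0,\ \sqrt[4]{\frac{|m|\mu}{3222\,\mathfrak c^2}}\right\},\qquad T_1:=\frac{|m|\mu}{6595\,\mathfrak c^3\Big(1+30\frac{\mathfrak c}{|m|\mu}\varepsilon^2+90\frac{\mathfrak c}{\mu}\varepsilon^2\Big)}\,.$$ Assume $\varepsilon\le\varepsilon_1$. Then there exists $N$ such that the weak solution $u(t,x)$ of the beam equation $$u_{tt}+u_{xxxx}-\Big(m+\frac1{2\pi}\int_0^\pi u_x^2\,dx\Big)u_{xx}=0$$ with hinged-hinged boundary conditions and initial data $u(0,x)=u_0(x)$, $u_t(0,x)=v_0(x)$ satisfies $$u(t,\cdot)\in H^{s+2}_*\,,\qquad |u(t,\cdot)|_{H^{s+2}_N}\leq 2\,\varepsilon\,,\qquad \sup_{x\in[0,\pi]}|u(t,x)|\leq 2.1\,\varepsilon\,,\qquad \forall\,|t|\leq T_1\,\varepsilon^{-6}\,.$$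
   Context: $\mathbb N=\{1,2,3,\dots\}$, $x\in[0,\pi]$, $t\in\mathbb R$, $\omega_j:=\sqrt{j^4+mj^2}$ and $\phi_j(x):=\sqrt{2/\pi}\,\sin(jx)$ for $j\in\mathbb N$. For $s\ge 0$, $H^s_*$ is the Hilbert space of functions $u(x)=\sum_{j\in\mathbb N}u_j\phi_j(x)$, $u_j\in\mathbb R$, with finite norm $|u|_s:=\big(\sum_{j\in\mathbb N}u_j^2j^{2s}\big)^{1/2}$. For an integer $N\ge1$ define the (equivalent) norm on $H^s_*$ by $$|u|_{H^{s}_N}^2:=\sum_{j\leq N}j^{2}u_{j}^2+\sum_{j> N}j^{2s}u_{j}^2\,,$$ so that $|u|_{H^{s+2}_N}^2=\sum_{j\leq N}j^{2}u_{j}^2+\sum_{j> N}j^{2s+4}u_{j}^2$. Moreover $$|v|_{\tilde H^{-1}}^2:=\sum_{j\geq 1}\frac{j^{2}}{\omega_j^2}v_{j}^2\,.$$ The hinged-hinged boundary conditions are $u(t,0)=u(t,\pi)=u_{xx}(t,0)=u_{xx}(t,\pi)=0$. Weak solution: given an open interval of times $\mathcal I\ni 0$, $s>1/2$, and initial data $u_0\in H^{s+2}_*$, $v_0\in H^s_*$, a $C^2$ function $t\mapsto u(t,\cdot)\in H^{s+2}_*$ is a weak solution of the equation with data $(u_0,v_0)$ if $u(0,x)=u_0(x)$, $u_t(0,x)=v_0(x)$ and, for every test function $\eta\in C^\infty_c((0,\pi))$ and every $t\in\mathcal I$, $$\int_0^{\pi}\Big[u_{tt}\eta+u_{xx}\eta_{xx}+\Big(m+\frac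 1{2\pi}\int_0^{\pi}u_x^2\,dx\Big) u_x \eta_x\Big]dx=0\,.$$
   Formalization: ''C^2 function t -> u(t,.) in H^{s+2}_*'' is read as u in C^0(H^{s+2}_* ), u_t in C^0(H^s_* ), u_tt in C^0(H^{s-2}_* ), with the integral of u_tt*eta as a duality pairing; taken literally, no weak solution exists when v_0 is in H^s_* but not in H^{s+2}_*. *)

(* Defs.v *)
From HB Require Import structures.
From mathcomp Require Import all_boot all_order all_algebra.
From mathcomp Require Import all_classical all_reals all_analysis.
Set Implicit Arguments.
Unset Strict Implicit.
Unset Printing Implicit Defensive.
Import Order.TTheory GRing.Theory Num.Theory.
Import numFieldNormedType.Exports.
Local Open Scope classical_set_scope.
Local Open Scope ring_scope.

(* Mode numbers are j = 1, 2, 3, ...: families of coefficients are functions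
   on nat whose value at 0 is never used. *)

Definition phi {R : realType} (j : nat) (x : R) : R :=
  Num.sqrt (2 / pi) * sin (j%:R * x).

Definition omega {R : realType} (m : R) (j : nat) : R :=
  Num.sqrt (j%:R ^+ 4 + m * j%:R ^+ 2).

Definition coef {R : realType} (f : R -> R) (j : nat) : R :=
  \int[lebesgue_measure]_(x in `[0, pi]) (f x * phi j x).

Definition wsq {R : realType} (w a : nat -> R) : \bar R :=
  (\sum_(1 <= j <oo) (w j * a j ^+ 2)%:E)%E.

(* [fine] sends +oo to 0, so this is the weighted l^2 norm of [a] only when
   [wsq w a] is finite. *)
Definition wnorm {R : realType} (w a : nat -> R) : R :=
  Num.sqrt (fine (wsq w a)).

(* The weight of H^s_*; a negative s is allowed, for spaces of coefficient
   sequences. *)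
Definition wH {R : realType} (s : R) (j : nat) : R := j%:R `^ (2 * s).

Definition wHN {R : realType} (s : R) (N j : nat) : R :=
  if (j <= N)%N then j%:R ^+ 2 else j%:R `^ (2 * s).

Definition wHm1 {R : realType} (m : R) (j : nat) : R :=
  j%:R ^+ 2 / omega m j ^+ 2.

(* f belongs to H^s_*, for s > 1/2: by Cauchy-Schwarz the series then converges
   uniformly, so every element has a unique representative that is the pointwise
   sum of its sine series on [0, pi]. Values of f outside [0, pi] play no
   role. *)
Definition Hstar {R : realType} (s : R) (f : R -> R) : Prop :=
  (wsq (wH s) (coef f) < +oo)%E /\
  forall x : R, x \in `[0, pi] ->
    (fun n => \sum_(1 <= j < n) coef f j * phi j x) @ \oo --> f x.

Definition Hnorm {R : realType} (s : R) (f : R -> R) : R :=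
  wnorm (wH s) (coef f).

Definition HNnorm {R : realType} (s : R) (N : nat) (f : R -> R) : R :=
  wnorm (wHN s N) (coef f).

Definition Hm1norm {R : realType} (m : R) (f : R -> R) : R :=
  wnorm (wHm1 m) (coef f).

Definition supnorm {R : realType} (f : R -> R) : \bar R :=
  ereal_sup [set (`|f x|)%:E | x in [set x : R | x \in `[0, pi]]].

Definition path_continuous {R : realType} (r : R) (I : set R)
    (A : R -> nat -> R) : Prop :=
  forall t, I t ->
    (wsq (wH r) (A t) < +oo)%E /\
    wsq (wH r) (fun j => A t' j - A t j) @[t' --> t] --> 0%E.

Definition path_derivative {R : realType} (r : R) (I : set R)
    (A B : R -> nat -> R) : Prop :=
  forall t, I t ->
    wsq (wH r) (fun j => (A (t + h) j - A t j) / h - B t j)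
      @[h --> (0 : R)^'] --> 0%E.

Definition coef_path {R : realType} (u : R -> R -> R) (t : R) (j : nat) : R :=
  coef (u t) j.

Definition dpath {R : realType} (A : R -> nat -> R) (t : R) (j : nat) : R :=
  derive1 (fun t' => A t' j) t.

(* The C^2 dependence on time is that of the natural scale of the equation
   (all spaces being of sine series),
     u in C^0(I; H^{s+2}), u_t in C^0(I; H^s), u_tt in C^0(I; H^{s-2}).
   Differentiability twice in the topology of H^{s+2} would force u_t(0)
   into H^{s+2}, hence exclude general initial velocities in H^s. *)
Definition C2_path {R : realType} (s : R) (I : set R) (u : R -> R -> R)
    : Prop :=
  let a := coef_path u in
  [/\ forall t, I t -> Hstar (s + 2) (u t),
      path_continuous (s + 2) I a,
      path_derivative s I a (dpath a) /\ path_continuous s I (dpath a)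
    & path_derivative (s - 2) I (dpath a) (dpath (dpath a)) /\
      path_continuous (s - 2) I (dpath (dpath a))].

Definition test_function {R : realType} (eta : R -> R) : Prop :=
  (forall (n : nat) (x : R), derivable (derive1n n eta) x 1) /\
  exists K : set R, [/\ compact K, K `<=` `]0, pi[
    & forall x, ~ K x -> eta x = 0].

(* The duality pairing of H^{s-2}_* with test functions; it is the integral of
   u_tt(t, x) eta(x) when u_tt(t, .) is square integrable. *)
Definition utt_pairing {R : realType} (u : R -> R -> R) (t : R)
    (eta : R -> R) : R :=
  limn (fun n =>
    \sum_(1 <= j < n) dpath (dpath (coef_path u)) t j * coef eta j).

(* u(t, .) is classically twice differentiable in the open interval, since
   H^{s+2}_* is contained in C^2([0, pi]) for s > 1/2. *)
Definition weak_form {R : realType} (m : R) (u : R -> R -> R) (t : R)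
    (eta : R -> R) : R :=
  let k := m + 1 / (2 * pi) *
    \int[lebesgue_measure]_(x in `]0, pi[) (derive1 (u t) x ^+ 2) in
  utt_pairing u t eta +
  \int[lebesgue_measure]_(x in `]0, pi[)
    (derive1n 2 (u t) x * derive1n 2 eta x + k * derive1 (u t) x * derive1 eta x).

(* The hinged boundary conditions are part of u(t, .) being in H^{s+2}_*: the
   sine series of u and u_xx converge uniformly and vanish at 0 and pi. *)
Definition weak_solution {R : realType} (m s : R) (u0 v0 : R -> R)
    (I : set R) (u : R -> R -> R) : Prop :=
  [/\ [/\ open I, is_interval I & I 0],
      C2_path s I u,
      forall x : R, x \in `[0, pi] -> u 0 x = u0 x,
      forall x : R, x \in `[0, pi] -> is_derive (0 : R) 1 (fun t => u t x) (v0 x)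
    & forall eta, test_function eta ->
        forall t, I t -> weak_form m u t eta = 0].

(* Main.v *)
Require Import Defs.
From HB Require Import structures.
From mathcomp Require Import all_boot all_order all_algebra.
From mathcomp Require Import all_classical all_reals all_analysis.
From mathcomp Require Import complex.
From mathcomp Require Import ring lra.
Set Implicit Arguments.
Unset Strict Implicit.
Unset Printing Implicit Defensive.
Import Order.TTheory GRing.Theory Num.Theory.
Import numFieldNormedType.Exports.
Local Open Scope classical_set_scope.
Local Open Scope ring_scope.

(** The sine coefficients of a solution form a system of oscillators that are
    coupled only through one number, the Kirchhoff term
    [K = (2 pi)^-1 * sum_j (j u_j) ^ 2].  In the variables [a_j = j u_j] and
    [b_j = j u_j' / omega_j] the system reads
    [a_j' = omega_j b_j],
    [b_j' = - omega_j a_j - K lambda_j a_j] with [lambda_j = j ^ 2 / omega_j],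
    and the norms of the statement at time [0] make the energy
    [S = sum_j (a_j ^ 2 + b_j ^ 2)] at most [2 eps ^ 2].  The theorem follows from
    two bounds.

    The first one is uniform in the frequency: as [lambda_j] is bounded, each
    amplitude [a_j ^ 2 + b_j ^ 2] grows at most exponentially at a rate
    proportional to [K] ([mode_growth]).  Over a fixed length of time the high
    modes are therefore controlled, with any weight, by the corresponding tail
    of the initial data.  This determines [N].

    The second one is the long time bound [S <= (11 / 5) eps ^ 2] for times of
    order [eps ^- 6] ([stability]).  With [psi = a + i b], the derivative of [S]
    is [- K] times a sum of imaginary parts of [lambda_j psi_j ^ 2].  The numbers
    [`|psi_j| ^ 2], [psi_j ^ 2] and their conjugates are taken as letters; [S] and
    [K] are linear in the letters, and each letter rotates with frequency
    [0] or [2 omega_j] up to sign while [K] feeds it linearly from the letters of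
    the same mode.  An oscillating monomial is a derivative up to higher order
    terms, so adding two correctors, obtained by dividing by the frequencies,
    replaces the derivative of [S] by one of fourth order in the letters
    ([is_derive_normal_form], [corrected_energy_derive]), of size [eps ^ 8].
    The divisors are sums of two or three [omega_j] with signs.  They vanish
    only on real monomials, which do not contribute; otherwise they are bounded
    below, by [mu] in the quadratic case ([quadratic_gap]) and by [`|m| / 2] in
    the cubic one ([cubic_gap]), because [omega_j] is close to [j ^ 2 + m / 2] and
    the triples with [i ^ 2 = j ^ 2 + k ^ 2] are detuned by [m].  A continuity
    argument closes the estimate ([finite_stability]); it is run on finitely many
    modes, the other modes entering through a small remainder of [K].

    The weak equation is equivalent to the mode equations because a sine series
    which vanishes on test functions, and whose twofold primitive converges
    absolutely, is zero ([distribution_zero], [weak_form_modes]).  Existence is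
    obtained for the mode equations with [K] truncated at [eps ^ 2], by Picard
    iteration mode by mode in the rotating frame ([picard], [modes_exist]).  On the
    time interval of the statement the energy bound keeps [K] below the
    truncation, so that the solution is a true one ([solution_exists]).  The two
    bounds then give the weighted norm by splitting the sum at [N]
    ([HNnorm_le]), and the supremum by Young's inequality ([supnorm_le]). *)

(** * Absolutely convergent series and term-by-term limits *)

Section Reals.
Context {R : realType}.

Lemma le_of_eq (x y : R) : x = y -> x <= y.
Proof. by move=> ->. Qed.

Lemma ler_sqr_norm (x y : R) : `|x| <= y -> x ^+ 2 <= y ^+ 2.
Proof.
move=> h; rewrite -(real_normK (num_real x)) ler_pXn2r// ?nnegrE//.
exact: le_trans h.
Qed.

Lemma norm_le_shift (t t' : R) : `|t' - t| <= 1 -> `|t'| <= `|t| + 1.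
Proof.
by move=> h; have := ler_normD (t' - t) t; rewrite subrK; lra.
Qed.

Lemma near_dist_lt1 (t : R) : \forall t' \near t, `|t' - t| < 1.
Proof.
by have := @nbhsx_ballx _ _ t 1 ltr01; apply: filterS => z; rewrite /ball/= distrC.
Qed.

Lemma near_norm_le (t : R) : \forall t' \near t, `|t'| <= `|t| + 1.
Proof.
by apply: filterS (near_dist_lt1 t) => t' /ltW; exact: norm_le_shift.
Qed.

End Reals.

Section Series.
Context {R : realType}.
Implicit Types (f g m : nat -> R).

(** Sums start at [1] to match the mode numbers; index [0] never contributes. *)
Definition psum f (n : nat) : R := \sum_(1 <= j < n) f j.

Definition tsum f : R := limn (psum f).

(** Absolute convergence as boundedness of partial sums, the form in which it
    is always produced and consumed below. *)
Definition abs_summable f : Prop :=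
  exists M : R, forall n, psum (fun j => `|f j|) n <= M.

Lemma psum_tail f N n : (0 < N)%N -> (N <= n)%N ->
  psum f n = psum f N + \sum_(N <= j < n) f j.
Proof. by move=> N0 Nn; rewrite /psum (big_cat_nat (n := N)). Qed.

Lemma abs_summable_cvg f : abs_summable f -> psum f @ \oo --> tsum f.
Proof.
move=> [M hM]; rewrite /tsum.
suff: cvgn (psum f) by [].
have E : cvgn (psum (fun j => `|f j|)).
  apply: nondecreasing_is_cvgn; last by exists M => _ [n _ <-].
  move=> n k nk; rewrite /psum; case: n nk => [|n] nk.
    by rewrite big_geq// sumr_ge0.
  by rewrite [leRHS](big_cat_nat (n := n.+1))//= lerDl sumr_ge0.
move: E; rewrite /psum.
have := @is_cvg_series_restrict 1 R R f.
have := @is_cvg_series_restrict 1 R R (fun j => `|f j|).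
by move=> -> -> /normed_cvg.
Qed.

Lemma abs_summable_tail f : abs_summable f ->
  forall e : R, 0 < e -> exists N, (0 < N)%N /\
    forall n, \sum_(N <= j < n) `|f j| <= e.
Proof.
move=> fs e e0.
have nd : {homo psum (fun j => `|f j|) : n m / (n <= m)%N >-> n <= m}.
  move=> n k nk; rewrite /psum; case: n nk => [|n] nk.
    by rewrite big_geq// sumr_ge0.
  by rewrite [leRHS](big_cat_nat (n := n.+1))//= lerDl sumr_ge0.
have [M hM] := fs.
have hs : has_sup (range (psum (fun j => `|f j|))).
  split; first by exists (psum (fun j => `|f j|) 0), 0%N.
  by exists M => _ [n _ <-].
have [_ [N _ <-] hN] := sup_adherent e0 hs.
exists N.+1; split => // n.
have [nN|Nn] := leqP n N; first by rewrite big_geq ?(leq_trans nN)// ltW.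
have : psum (fun j => `|f j|) n <= sup (range (psum (fun j => `|f j|))).
  by apply: ub_le_sup; [exact: hs.2|exists n].
rewrite (@psum_tail _ N.+1)//.
have := nd _ _ (leqnSn N); lra.
Qed.

Lemma abs_summable_le f g : (forall j, (0 < j)%N -> `|f j| <= `|g j|) ->
  abs_summable g -> abs_summable f.
Proof.
move=> fg [M hM]; exists M => n; apply: le_trans (hM n).
by rewrite /psum !big_nat; apply: ler_sum => j /andP[j0 _]; exact: fg.
Qed.

Lemma abs_summableD f g : abs_summable f -> abs_summable g ->
  abs_summable (fun j => f j + g j).
Proof.
move=> [M hM] [N hN]; exists (M + N) => n; apply: le_trans (lerD (hM n) (hN n)).
by rewrite /psum -big_split; apply: ler_sum => j _; exact: ler_normD.
Qed.

Lemma abs_summableZ c f : abs_summable f -> abs_summable (fun j => c * f j).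
Proof.
move=> [M hM]; exists (`|c| * M) => n.
apply: le_trans (ler_wpM2l (normr_ge0 c) (hM n)).
by rewrite /psum mulr_sumr; apply: ler_sum => j _; rewrite normrM.
Qed.

Lemma abs_summable0 : abs_summable (fun=> 0).
Proof. by exists 0 => n; rewrite /psum big1// => j _; rewrite normr0. Qed.

Lemma tsum_cvg_eq f l : psum f @ \oo --> l -> tsum f = l.
Proof. by move=> h; exact: (cvg_lim (@Rhausdorff R) h). Qed.

Lemma eq_tsum f g : (forall j, (0 < j)%N -> f j = g j) -> tsum f = tsum g.
Proof.
move=> fg; rewrite /tsum; congr (limn _); apply: funext => n.
by rewrite /psum !big_nat; apply: eq_bigr => j /andP[j0 _]; exact: fg.
Qed.

Lemma tsumD f g : abs_summable f -> abs_summable g ->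
  tsum (fun j => f j + g j) = tsum f + tsum g.
Proof.
move=> fs gs; apply: tsum_cvg_eq.
rewrite (_ : psum _ = fun n => psum f n + psum g n); last first.
  by apply: funext => n; rewrite /psum big_split.
by apply: cvgD; exact: abs_summable_cvg.
Qed.

Lemma tsumZ c f : abs_summable f -> tsum (fun j => c * f j) = c * tsum f.
Proof.
move=> fs; apply: tsum_cvg_eq.
rewrite (_ : psum _ = fun n => c * psum f n); last first.
  by apply: funext => n; rewrite /psum mulr_sumr.
by apply: cvgMr; exact: abs_summable_cvg.
Qed.

Lemma tsum0 : tsum (fun=> 0) = 0.
Proof.
apply: tsum_cvg_eq; rewrite (_ : psum _ = fun=> 0); first exact: cvg_cst.
by apply: funext => n; rewrite /psum big1.
Qed.

Lemma tsum_tail f m N e : (0 < N)%N -> abs_summable f ->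
  (forall j, (0 < j)%N -> `|f j| <= m j) ->
  (forall n, \sum_(N <= j < n) m j <= e) ->
  `|tsum f - psum f N| <= e.
Proof.
move=> N0 fs fm me.
have c : (fun n => `|psum f n - psum f N|) @ \oo --> `|tsum f - psum f N|.
  by apply: cvg_norm; apply: cvgB; [exact: abs_summable_cvg|exact: cvg_cst].
apply: (cvgr_to_le c); near=> n.
have Nn : (N <= n)%N by near: n; exact: nbhs_infty_ge.
rewrite (psum_tail _ N0 Nn) addrAC subrr add0r.
apply: le_trans (me n); apply: (le_trans (ler_norm_sum _ _ _)).
rewrite !big_nat; apply: ler_sum => j /andP[Nj _].
by apply: fm; exact: leq_trans Nj.
Unshelve. all: by end_near. Qed.

Lemma tsum_le f g : abs_summable f -> abs_summable g ->
  (forall j, (0 < j)%N -> f j <= g j) -> tsum f <= tsum g.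
Proof.
move=> fs gs fg.
apply: (ler_cvg_to (abs_summable_cvg fs) (abs_summable_cvg gs)).
near=> n; rewrite /psum !big_nat.
by apply: ler_sum => j /andP[j0 _]; exact: fg.
Unshelve. all: by end_near. Qed.

Lemma tsum_ge0 f : abs_summable f -> (forall j, (0 < j)%N -> 0 <= f j) ->
  0 <= tsum f.
Proof.
by move=> fs f0; rewrite -tsum0; apply: tsum_le => //; exact: abs_summable0.
Qed.

Lemma psum_le_tsum f n : abs_summable f -> (forall j, (0 < j)%N -> 0 <= f j) ->
  psum f n <= tsum f.
Proof.
move=> fs f0; apply: (cvgr_to_ge (abs_summable_cvg fs)).
case: n => [|n]; near=> k.
  by rewrite {1}/psum big_geq// /psum big_nat sumr_ge0// => j /andP[/f0].
have nk : (n < k)%N by near: k; exact: nbhs_infty_ge.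
rewrite (psum_tail _ (ltn0Sn n) nk) lerDl big_nat sumr_ge0// => j /andP[nj _].
by apply: f0; exact: leq_trans nj.
Unshelve. all: by end_near. Qed.

Lemma tsum_le_bound f M : abs_summable f -> (forall n, psum f n <= M) ->
  tsum f <= M.
Proof.
by move=> fs h; apply: (cvgr_to_le (abs_summable_cvg fs)); near=> n.
Unshelve. all: by end_near. Qed.

Lemma ler_norm_tsum f m : abs_summable m ->
  (forall j, (0 < j)%N -> `|f j| <= m j) -> `|tsum f| <= tsum m.
Proof.
move=> ms fm.
have fs : abs_summable f.
  by apply: abs_summable_le ms => j /fm h; apply: (le_trans h); exact: ler_norm.
apply: (@ler_cvg_to _ _ _ _ _ _ _ _ (cvg_norm (abs_summable_cvg fs)) (abs_summable_cvg ms)).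
near=> n; rewrite /psum; apply: (le_trans (ler_norm_sum _ _ _)).
by rewrite !big_nat; apply: ler_sum => j /andP[j0 _]; exact: fm.
Unshelve. all: by end_near. Qed.

Lemma cvg_psum (T : Type) (F : set_system T) {FF : ProperFilter F}
    (f : T -> nat -> R) g n :
  (forall j, (0 < j)%N -> (fun t => f t j) @ F --> g j) ->
  (fun t => psum (f t) n) @ F --> psum g n.
Proof.
move=> h; case: n => [|n].
  rewrite (_ : (fun t => _) = fun=> psum g 0); first exact: cvg_cst.
  by apply: funext => t; rewrite /psum !big_geq.
elim: n => [|n IH].
  rewrite (_ : (fun t => _) = fun=> psum g 1); first exact: cvg_cst.
  by apply: funext => t; rewrite /psum !big_geq.
rewrite (_ : (fun t => _) = fun t => psum (f t) n.+1 + f t n.+1); last first.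
  by apply: funext => t; rewrite /psum big_nat_recr.
by rewrite /psum big_nat_recr//=; apply: cvgD => //; exact: h.
Qed.

(** Dominated convergence for series along an arbitrary filter: the tails are
    uniformly small under the majorant [m], and finitely many terms remain. *)
Lemma tannery (T : Type) (F : set_system T) {FF : ProperFilter F}
    (f : T -> nat -> R) g m :
  abs_summable m ->
  (\forall t \near F, forall j, (0 < j)%N -> `|f t j| <= m j) ->
  (forall j, (0 < j)%N -> (fun t => f t j) @ F --> g j) ->
  (fun t => tsum (f t)) @ F --> tsum g.
Proof.
move=> ms fm fg.
have gm j : (0 < j)%N -> `|g j| <= m j.
  move=> j0; apply: (cvgr_to_le (cvg_norm (fg _ j0))).
  by near=> t; apply: (near fm t).
have dom h : (forall j, (0 < j)%N -> `|h j| <= m j) -> abs_summable h.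
  by move=> hm; apply: abs_summable_le ms => j /hm k; exact: le_trans (ler_norm _).
apply/cvgrPdist_le => e e0.
have e4 : 0 < e / 4 by rewrite divr_gt0.
have [N [N0 hN]] := abs_summable_tail ms e4.
have hN' n : \sum_(N <= j < n) m j <= e / 4.
  by apply: le_trans (hN n); apply: ler_sum => j _; exact: ler_norm.
have /cvgrPdist_le /(_ _ e4) fin : (fun t => psum (f t) N) @ F --> psum g N.
  exact: cvg_psum.
near=> t.
have ft : forall j, (0 < j)%N -> `|f t j| <= m j by near: t.
have h1 : `|psum g N - psum (f t) N| <= e / 4 by near: t.
have h2 := tsum_tail N0 (dom _ gm) gm hN'.
have h3 := tsum_tail N0 (dom _ ft) ft hN'.
move: h1 h2 h3; rewrite !ler_norml; lra.
Unshelve. all: by end_near. Qed.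

End Series.

Section Deriv.
Context {R : realType}.

Lemma is_deriveP (f : R -> R) (x d : R) :
  is_derive x 1 f d <-> (fun h => (f (x + h) - f x) / h) @ (0 : R)^' --> d.
Proof.
have E : (fun h : R => h^-1 *: ((f \o shift x) (h *: (1 : R)) - f x)) =
         (fun h => (f (x + h) - f x) / h).
  by apply: funext => h /=; rewrite [h *: 1]mulr1 [h + x]addrC [_ *: _]mulrC.
split.
  by move=> [df <-]; rewrite -E; exact: df.
rewrite -E => h; split; first by apply/cvg_ex; exists d.
exact: (cvg_lim (@Rhausdorff R) h).
Qed.

Lemma drv_eq (f : R -> R) (x a b : R) : is_derive x 1 f a -> a = b ->
  is_derive x 1 f b.
Proof. by move=> h <-. Qed.

Lemma drvC (c x : R) : is_derive x 1 (fun=> c) (0 : R).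
Proof. exact: is_derive_cst. Qed.

Lemma drv_id (x : R) : is_derive x 1 (fun y => y) (1 : R).
Proof. exact: is_derive_id. Qed.

Lemma drvD (f g : R -> R) (x a b : R) : is_derive x 1 f a ->
  is_derive x 1 g b -> is_derive x 1 (fun y => f y + g y) (a + b).
Proof. exact: is_deriveD. Qed.

Lemma drvN (f : R -> R) (x a : R) : is_derive x 1 f a ->
  is_derive x 1 (fun y => - f y) (- a).
Proof. exact: is_deriveN. Qed.

Lemma drvB (f g : R -> R) (x a b : R) : is_derive x 1 f a ->
  is_derive x 1 g b -> is_derive x 1 (fun y => f y - g y) (a - b).
Proof. exact: is_deriveB. Qed.

Lemma drvM (f g : R -> R) (x a b : R) : is_derive x 1 f a ->
  is_derive x 1 g b -> is_derive x 1 (fun y => f y * g y) (a * g x + f x * b).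
Proof.
move=> df dg; apply: (drv_eq (is_deriveM df dg)).
by rewrite addrC; congr (_ + _); rewrite [LHS]mulrC.
Qed.

Lemma drvZ (c : R) (f : R -> R) (x a : R) : is_derive x 1 f a ->
  is_derive x 1 (fun y => c * f y) (c * a).
Proof. exact: is_deriveZ. Qed.

Lemma drv_comp (f g : R -> R) (x a b : R) : is_derive (g x) 1 f a ->
  is_derive x 1 g b -> is_derive x 1 (fun y => f (g y)) (a * b).
Proof. exact: is_derive1_comp. Qed.

Lemma drv_sum (I : Type) (r : seq I) (f : I -> R -> R) (d : I -> R) (x : R) :
  (forall i, is_derive x 1 (f i) (d i)) ->
  is_derive x 1 (fun y => \sum_(i <- r) f i y) (\sum_(i <- r) d i).
Proof.
move=> h; elim: r => [|i r IH].
  rewrite big_nil (_ : (fun y => _) = fun=> 0); first exact: drvC.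
  by apply: funext => y; rewrite big_nil.
rewrite big_cons (_ : (fun y => _) = fun y => f i y + \sum_(j <- r) f j y).
  exact: drvD.
by apply: funext => y; rewrite big_cons.
Qed.

Lemma is_derive_continuous (f : R -> R) (x d : R) :
  is_derive x 1 f d -> {for x, continuous f}.
Proof.
by move=> [df _]; apply: differentiable_continuous; exact/derivable1_diffP.
Qed.

Lemma mvt_seg (f df : R -> R) (a b : R) : a <= b ->
  (forall x, a <= x <= b -> is_derive x 1 f (df x)) ->
  exists c, a <= c <= b /\ f b - f a = df c * (b - a).
Proof.
move=> ab h; have [||c] := @MVT_segment R f df a b ab.
- by move=> x /[!in_itv]/= /andP[ax xb]; apply: h; rewrite !ltW.
- apply: derivable_within_continuous => x /[!in_itv]/= xab.
  by have [] := h x xab.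
by rewrite in_itv/= => cab e; exists c.
Qed.

(** The mean value theorem for increments of either sign. *)
Lemma mvt_ball (f df : R -> R) (a b : R) :
  (forall x, `|x - a| <= `|b - a| -> is_derive x 1 f (df x)) ->
  exists c, `|c - a| <= `|b - a| /\ f b - f a = df c * (b - a).
Proof.
move=> h; have [ab|ba] := leP a b.
- have [|c [/andP[ac cb] e]] := @mvt_seg f df a b ab.
    by move=> x /andP[ax xb]; apply: h; rewrite !ger0_norm; lra.
  by exists c; split => //; rewrite !ger0_norm; lra.
- have [|c [/andP[ac cb] e]] := @mvt_seg f df b a (ltW ba).
    by move=> x /andP[ax xb]; apply: h; rewrite !ler0_norm; lra.
  exists c; split => //.
    by rewrite !ler0_norm; lra.
  by rewrite -[f b - _]opprB e; ring.
Qed.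

(** The difference quotients are derivatives at intermediate points, hence
    dominated by [m], and [tannery] applies to them. *)
Lemma is_derive_tsum (f df : R -> nat -> R) (m : nat -> R) (x0 d : R) :
  0 < d -> abs_summable m ->
  (forall x j, `|x - x0| < d -> (0 < j)%N ->
    is_derive x 1 (fun y => f y j) (df x j) /\ `|df x j| <= m j) ->
  (forall x, `|x - x0| < d -> abs_summable (f x)) ->
  is_derive x0 1 (fun x => tsum (f x)) (tsum (df x0)).
Proof.
move=> d0 ms hf fs; apply/is_deriveP.
have x0d : `|x0 - x0| < d by rewrite subrr normr0.
have near_d : \forall h \near (0 : R)^', `|h| < d.
  near=> h; rewrite -[h]subr0 distrC.
  near: h; apply: nbhs_dnbhs; exact: (@nbhsx_ballx _ _ (0 : R) d d0).
have E : \forall h \near (0 : R)^',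
    tsum (fun j => (f (x0 + h) j - f x0 j) / h) =
    (tsum (f (x0 + h)) - tsum (f x0)) / h.
  near=> h.
  have hd : `|h| < d by near: h.
  have hd' : `|x0 + h - x0| < d by rewrite addrAC subrr add0r.
  rewrite (@eq_tsum _ _ (fun j => h^-1 * (f (x0 + h) j + (-1) * f x0 j))); last first.
    by move=> j _; rewrite mulrC mulN1r.
  have s1 := fs _ hd'; have s2 := abs_summableZ (-1) (fs _ x0d).
  by rewrite tsumZ ?tsumD//; [rewrite tsumZ; [rewrite mulN1r mulrC|exact: fs]|exact: abs_summableD].
apply: cvg_trans (near_eq_cvg E) _.
apply: (tannery ms); last first.
  by move=> j j0; have [/is_deriveP] := hf _ _ x0d j0.
near=> h => j j0.
have hd : `|h| < d by near: h.
have h0 : h != 0 by near: h; exact: nbhs_dnbhs_neq.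
have [] := @mvt_ball (fun y => f y j) (df^~ j) x0 (x0 + h).
  move=> x; rewrite addrAC subrr add0r => xh.
  by have [] := hf x j (le_lt_trans xh hd) j0.
move=> c; rewrite addrAC subrr add0r => -[ch ->].
rewrite mulfK//.
by have [] := hf c j (le_lt_trans ch hd) j0.
Unshelve. all: by end_near. Qed.

End Deriv.

Section Weights.
Context {R : realType}.
Implicit Types (w a : nat -> R).

Lemma wsqE w a : (forall j, (0 < j)%N -> 0 <= w j) ->
  abs_summable (fun j => w j * a j ^+ 2) ->
  wsq w a = (tsum (fun j => w j * a j ^+ 2))%:E.
Proof.
move=> w0 /abs_summable_cvg s; rewrite /wsq /tsum -EFin_lim; last by apply/cvg_ex; exists (tsum (fun j => w j * a j ^+ 2)).
by congr (limn _); apply: funext => n /=; rewrite /psum sumEFin.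
Qed.

Lemma wsq_lty w a : (forall j, (0 < j)%N -> 0 <= w j) ->
  (wsq w a < +oo)%E -> abs_summable (fun j => w j * a j ^+ 2).
Proof.
move=> w0 fin.
have g0 j : (1 <= j)%N -> true -> (0 <= (w j * a j ^+ 2)%:E)%E.
  by move=> j0 _; rewrite lee_fin mulr_ge0 ?sqr_ge0// w0.
have fn : wsq w a \is a fin_num.
  by rewrite ge0_fin_numE//; exact: nneseries_ge0.
exists (fine (wsq w a)) => n.
rewrite -lee_fin (fineK fn) /wsq /psum -sumEFin.
apply: le_trans (nneseries_lim_ge n g0).
rewrite !big_nat; apply: lee_sum => j /andP[j0 _].
by rewrite lee_fin ger0_norm// mulr_ge0 ?sqr_ge0// w0.
Qed.

Lemma wsq_fin w a : (forall j, (0 < j)%N -> 0 <= w j) ->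
  abs_summable (fun j => w j * a j ^+ 2) -> (wsq w a < +oo)%E.
Proof. by move=> w0 s; rewrite wsqE// ltry. Qed.

Lemma wnormE w a : (forall j, (0 < j)%N -> 0 <= w j) ->
  abs_summable (fun j => w j * a j ^+ 2) ->
  wnorm w a = Num.sqrt (tsum (fun j => w j * a j ^+ 2)).
Proof. by move=> w0 s; rewrite /wnorm wsqE. Qed.

Lemma wnorm_sqr w a : (forall j, (0 < j)%N -> 0 <= w j) ->
  abs_summable (fun j => w j * a j ^+ 2) ->
  wnorm w a ^+ 2 = tsum (fun j => w j * a j ^+ 2).
Proof.
move=> w0 s; rewrite wnormE// sqr_sqrtr// tsum_ge0// => j j0.
by rewrite mulr_ge0 ?sqr_ge0// w0.
Qed.

(** Comparison with the telescoping differences of [j `^ (1 - p)]. *)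
Lemma abs_summable_powR (p : R) : 1 < p ->
  abs_summable (fun j => j%:R `^ (- p) : R).
Proof.
move=> p1; pose q := p - 1; have q0 : 0 < q by rewrite subr_gt0.
have step (j : nat) : (0 < j)%N ->
    q * j.+1%:R `^ (- p) <= j%:R `^ (- q) - j.+1%:R `^ (- q) :> R.
  move=> j0; have jp : 0 < j%:R :> R by rewrite ltr0n.
  have d (x : R) : 0 < x -> is_derive x 1 (fun y : R => y `^ (- q)) (- q * x `^ (- p)).
    move=> x0; have := is_derive1_powR (- q) x0.
    by rewrite /q (_ : - (p - 1) - 1 = - p)//; ring.
  have jj : j%:R <= j.+1%:R :> R by rewrite ler_nat.
  have [|c [/andP[jc cj] e]] := @mvt_seg R (fun y : R => y `^ (- q)) (fun x => - q * x `^ (- p)) j%:R j.+1%:R jj.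
    by move=> x /andP[ax xb]; apply: d; lra.
  have c0 : 0 < c by lra.
  have e1 : j.+1%:R - j%:R = 1 :> R by rewrite -natr1; ring.
  rewrite e1 mulr1 in e.
  have cp : j.+1%:R `^ (- p) <= c `^ (- p).
    rewrite !powRN lef_pV2 ?posrE ?powR_gt0// ?ltr0n//.
    by apply: ge0_ler_powR => //; rewrite ?nnegrE; lra.
  have : q * j.+1%:R `^ (- p) <= q * c `^ (- p) by rewrite ler_pM2l.
  lra.
exists (1 + q^-1) => n.
have key k : q * psum (fun j => j%:R `^ (- p) : R) k.+2 <= q + (1 - k.+1%:R `^ (- q)).
  elim: k => [|k IH].
    by rewrite /psum big_nat1 !powR1 mulr1 subrr addr0.
  rewrite /psum big_nat_recr//= mulrDr.
  by have := step k.+1 isT; rewrite /psum in IH; lra.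
have E k : psum (fun j => `|j%:R `^ (- p) : R|) k = psum (fun j => j%:R `^ (- p) : R) k.
  by apply: eq_bigr => j _; rewrite ger0_norm// powR_ge0.
rewrite E; case: n => [|[|n]].
- by rewrite /psum big_geq// addr_ge0 ?invr_ge0// ltW.
- by rewrite /psum big_geq// addr_ge0 ?invr_ge0// ltW.
have qV : q * (1 + q^-1) = q + 1 by rewrite mulrDr mulr1 mulfV ?gt_eqF.
rewrite -(ler_pM2l q0) qV; apply: (le_trans (key n)); rewrite lerD2l.
by have := powR_ge0 (n.+1%:R : R) (- q); lra.
Qed.

(** Telescoping from [j ^- 2 <= (j - 1)^-1 - j^-1]; the constant [2] is what
    the supremum bound of the theorem needs. *)
Lemma psum_inv_sqr (n : nat) : psum (fun j => j%:R ^- 2 : R) n <= 2.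
Proof.
case: n => [|[|n]]; [by rewrite /psum big_geq|by rewrite /psum big_geq|].
have : psum (fun j => j%:R ^- 2 : R) n.+2 <= 2 - n.+1%:R^-1.
  elim: n => [|n IH].
    by rewrite /psum big_nat1 mulr1n expr1n !invr1 lerBrDr.
  rewrite /psum big_nat_recr//=; rewrite /psum in IH.
  have x1 : 0 < n.+1%:R :> R by rewrite ltr0n.
  have e : n.+2%:R = n.+1%:R + 1 :> R by rewrite natr1.
  suff : n.+2%:R ^- 2 <= n.+1%:R^-1 - n.+2%:R^-1 :> R.
    by move=> h; apply: (le_trans (lerD IH h)); rewrite addrA subrK.
  rewrite e; set x : R := n.+1%:R in x1 *.
  have -> : x^-1 - (x + 1)^-1 = (x * (x + 1))^-1.
    by field; rewrite !gt_eqF//; lra.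
  rewrite lef_pV2 ?posrE; [|nra|nra]; nra.
by move=> h; apply: (le_trans h); rewrite gerBl invr_ge0 ler0n.
Qed.

(** Cauchy-Schwarz in the form of the arithmetic-geometric inequality: a
    weighted square-summable sequence is summable once the weight gains more
    than one half power. *)
Lemma abs_summable_sqr (r : R) (p : R) (a : nat -> R) : 1 / 2 < r - p ->
  abs_summable (fun j => j%:R `^ (2 * r) * a j ^+ 2) ->
  abs_summable (fun j => j%:R `^ p * a j).
Proof.
move=> rp s.
have s2 : abs_summable (fun j => j%:R `^ (- (2 * (r - p))) : R).
  by apply: abs_summable_powR; lra.
apply: abs_summable_le (abs_summableD s s2) => j j0.
have jp : 0 < j%:R :> R by rewrite ltr0n.
rewrite [leRHS]ger0_norm; last first.
  by rewrite addr_ge0 ?powR_ge0// mulr_ge0 ?sqr_ge0 ?powR_ge0.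
set x : R := j%:R `^ r * `|a j|.
set y : R := j%:R `^ (- (r - p)).
have -> : `|j%:R `^ p * a j| = x * y.
  rewrite normrM ger0_norm ?powR_ge0// /x /y mulrAC -powRD; last by rewrite (gt_eqF jp) implybT.
  by congr (_ `^ _ * _); ring.
have -> : j%:R `^ (2 * r) * a j ^+ 2 = x ^+ 2.
  rewrite /x exprMn real_normK ?num_real//; congr (_ * _).
  by rewrite -[RHS]powR_mulrn ?powR_ge0// -powRrM mulrC.
have -> : j%:R `^ (- (2 * (r - p))) = y ^+ 2.
  by rewrite /y -[RHS]powR_mulrn ?powR_ge0// -powRrM; congr (_ `^ _); ring.
nra.
Qed.

End Weights.

(** * Primitives and exponential comparison *)

Section Primitive.
Context {R : realType}.
Notation mu := (@lebesgue_measure R).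

Lemma continuous_Rintegrable (f : R -> R) (a b : R) : continuous f ->
  mu.-integrable `[a, b] (EFin \o f).
Proof.
move=> cf; apply: continuous_compact_integrable; first exact: segment_compact.
exact: continuous_subspaceT.
Qed.

Lemma Rintegral_ftc (F f : R -> R) (a b : R) : a < b ->
  (forall x : R, is_derive x 1 F (f x)) -> continuous f ->
  \int[mu]_(x in `[a, b]) f x = F b - F a.
Proof.
move=> ab dF cf; rewrite /Rintegral.
rewrite (@continuous_FTC2 R f F a b ab)//.
- exact: continuous_subspaceT.
- split.
  + by move=> x _; have [] := dF x.
  + by apply: cvg_at_right_filter; exact: is_derive_continuous (dF a).
  + by apply: cvg_at_left_filter; exact: is_derive_continuous (dF b).
- by move=> x _; rewrite derive1E; exact: derive_val.
Qed.

Lemma Rintegral_oo_ftc (F f g : R -> R) (a b : R) : a < b ->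
  (forall x : R, is_derive x 1 F (f x)) -> continuous f ->
  {in `]a, b[, g =1 f} ->
  \int[mu]_(x in `]a, b[) g x = F b - F a.
Proof.
move=> ab dF cf gf.
rewrite (@eq_Rintegral _ _ _ mu `]a, b[ f); last first.
  by move=> x; rewrite inE => /= xab; exact: gf.
rewrite -(Rintegral_ftc ab dF cf).
have fi (D : set R) : measurable D -> D `<=` `[a, b] -> mu.-integrable D (EFin \o f).
  move=> mD Dab; apply: (@integrableS _ _ _ mu `[a, b]) => //.
  exact: continuous_Rintegrable.
have i1 : mu.-integrable `]a, b[ (EFin \o f).
  by apply: fi; [exact: measurable_itv|exact: subset_itv_oo_cc].
have i2 : mu.-integrable `]a, b] (EFin \o f).
  by apply: fi; [exact: measurable_itv|exact: subset_itv_oc_cc].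
by rewrite Rintegral_itv_bndo_bndc// Rintegral_itv_obnd_cbnd.
Qed.

(** The integrals over [[- n, x]] glue to a primitive on the whole line. *)
Lemma primitive_exists (f : R -> R) : continuous f ->
  exists F : R -> R, F 0 = 0 /\ forall x : R, is_derive x 1 F (f x).
Proof.
move=> cf.
pose G (n : nat) (x : R) := \int[mu]_(t in `[(- n%:R), x]) f t.
have dG n (x : R) : `|x| < n%:R -> is_derive x 1 (G n) (f x).
  rewrite ltr_norml => /andP[nx xn].
  have [dd e] := @continuous_FTC1_closed R f (- n%:R) x n%:R xn (continuous_Rintegrable _ _ cf) nx (cf x).
  by split; [exact: dd|rewrite -derive1E e].
have GG n k (x : R) : `|x| < n%:R -> `|x| < k%:R ->
    G n x - G n 0 = G k x - G k 0.
  move=> xn xk.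
  have [] := @mvt_ball R (fun x => G n x - G k x) (fun=> 0) 0 x.
    move=> y; rewrite !subr0 => yx.
    rewrite -(subrr (f y)); apply: drvB; apply: dG; exact: le_lt_trans yx _.
  move=> c [_]; rewrite mul0r => e.
  apply/eqP; rewrite -subr_eq0; apply/eqP; rewrite -[RHS]e; ring.
pose nb (x : R) := Num.bound `|x|.
have nbP x : `|x| < (nb x)%:R by exact: archi_boundP.
exists (fun x => G (nb x) x - G (nb x) 0); split; first by rewrite subrr.
move=> x; pose N := Num.bound (`|x| + 1).
have xN : `|x| + 1 < N%:R.
  by have := @archi_boundP R (`|x| + 1); rewrite -/N; apply; rewrite addr_ge0.
have d : is_derive x 1 (fun y => G N y - G N 0) (f x).
  apply: drv_eq (drvB (dG _ _ _) (drvC _ _)) (subr0 _); lra.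
move: d; apply: near_eq_is_derive.
near=> y; apply: GG => //.
by apply: le_lt_trans xN; near: y; exact: near_norm_le.
Unshelve. all: by end_near. Qed.

(** A fixed primitive vanishing at [0].  Differential equations are integrated
    with it, so that negative times need no separate treatment. *)
Definition prim (f : R -> R) : R -> R :=
  get (fun F : R -> R => F 0 = 0 /\ forall x : R, is_derive x 1 F (f x)).

Lemma primP f : continuous f ->
  prim f 0 = 0 /\ forall x : R, is_derive x 1 (prim f) (f x).
Proof. by move=> /primitive_exists; exact: getPex. Qed.

End Primitive.

Section Compare.
Context {R : realType}.

(** A Gronwall comparison by the mean value theorem: it replaces the integration
    of exponential bounds. *)
Lemma le_expR_compare (f g : R -> R) (D K T : R) : 0 <= D -> 0 < K ->
  f 0 = 0 -> (forall t : R, `|t| <= T -> is_derive t 1 f (g t)) ->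
  (forall t, `|t| <= T -> `|g t| <= D * K * expR (K * `|t|)) ->
  forall t, `|t| <= T -> `|f t| <= D * (expR (K * `|t|) - 1).
Proof.
move=> D0 K0 f0.
have pos (h k : R -> R) : h 0 = 0 ->
    (forall t : R, 0 <= t <= T -> is_derive t 1 h (k t)) ->
    (forall t, 0 <= t <= T -> `|k t| <= D * K * expR (K * t)) ->
    forall t, 0 <= t <= T -> h t <= D * (expR (K * t) - 1).
  move=> h0 dh kb t /andP[t0 tT].
  pose z s := D * (expR (K * s) - 1) - h s.
  have dz s : 0 <= s <= T -> is_derive s 1 z (D * (K * expR (K * s)) - k s).
    move=> sT; apply: drvB; last exact: dh.
    have d1 : is_derive s 1 (fun s => K * s) K.
      exact: drv_eq (drvZ K (drv_id s)) (mulr1 _).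
    have d2 : is_derive s 1 (fun s => expR (K * s)) (K * expR (K * s)).
      by rewrite mulrC; exact: (@drv_comp R expR (fun s => K * s)).
    have d3 := drvB d2 (drvC 1 s).
    by rewrite subr0 in d3; exact: drvZ.
  have [|c [/andP[c0 ct]]] := @mvt_seg R z (fun s => D * (K * expR (K * s)) - k s) 0 t t0.
    by move=> s /andP[s0 st]; apply: dz; lra.
  have -> : z 0 = 0 by rewrite /z h0 mulr0 expR0 subrr mulr0 subrr.
  rewrite !subr0 => e.
  suff : 0 <= z t by rewrite /z subr_ge0.
  rewrite e mulr_ge0//.
  have cT : 0 <= c <= T by lra.
  have := kb c cT; rewrite ler_norml => /andP[_]; rewrite subr_ge0 mulrA; exact.
have abs (h k : R -> R) : h 0 = 0 ->
    (forall t : R, 0 <= t <= T -> is_derive t 1 h (k t)) ->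
    (forall t, 0 <= t <= T -> `|k t| <= D * K * expR (K * t)) ->
    forall t, 0 <= t <= T -> `|h t| <= D * (expR (K * t) - 1).
  move=> h0 dh kb t tT; rewrite ler_norml; apply/andP; split; last exact: pos kb _ tT.
  rewrite lerNl; apply: (pos (fun t => - h t) (fun t => - k t)) => //.
  - by rewrite h0 oppr0.
  - by move=> s sT; apply: drvN; exact: dh.
  - by move=> s sT; rewrite normrN; exact: kb.
move=> dh kb t tT; have [t0|t0] := leP 0 t.
  rewrite (ger0_norm t0); apply: (abs f g) => //.
  - by move=> s /andP[s0 sT]; apply: dh; rewrite ger0_norm.
  - by move=> s /andP[s0 sT]; have := kb s; rewrite ger0_norm//; exact.
  - by rewrite t0/=; rewrite ger0_norm in tT.
rewrite (ltr0_norm t0).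
have -> : f t = (fun s => f (- s)) (- t) by rewrite opprK.
apply: (abs (fun s => f (- s)) (fun s => - g (- s))).
- by rewrite oppr0.
- move=> s /andP[s0 sT]; rewrite -mulrN1.
  have d1 : is_derive (- s) 1 f (g (- s)) by apply: dh; rewrite normrN ger0_norm.
  exact: (@drv_comp R f (fun s => - s) s _ _ d1 (drvN (drv_id s))).
- by move=> s /andP[s0 sT]; rewrite normrN; have := kb (- s); rewrite normrN ger0_norm//; exact.
- by rewrite ltr0_norm in tT => //; lra.
Qed.

(** The sequences [u n - 2 D / 2 ^ n] and [u n + 2 D / 2 ^ n] are monotone in
    opposite directions and squeeze the limit. *)
Lemma geometric_limit (u : nat -> R) (D : R) :
  (forall n, `|u n.+1 - u n| <= D / 2 ^+ n) ->
  exists l, forall n, `|u n - l| <= 2 * D / 2 ^+ n.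
Proof.
move=> hu.
have D0 : 0 <= D.
  by have := le_trans (normr_ge0 _) (hu 0); rewrite expr0 divr1.
have st n : D / 2 ^+ n = 2 * D / 2 ^+ n - 2 * D / 2 ^+ n.+1.
  rewrite exprS; field; rewrite expf_neq0//.
pose lo n := u n - 2 * D / 2 ^+ n.
pose hi n := u n + 2 * D / 2 ^+ n.
have lohi n : lo n <= hi n.
  rewrite /lo /hi; have : 0 <= 2 * D / 2 ^+ n by rewrite divr_ge0// ?mulr_ge0// exprn_ge0.
  lra.
have los n : lo n <= lo n.+1.
  rewrite /lo; have := hu n; rewrite st ler_norml; lra.
have his n : hi n.+1 <= hi n.
  rewrite /hi; have := hu n; rewrite st ler_norml; lra.
have lom n k : lo n <= lo (n + k)%N.
  by elim: k => [|k IH]; rewrite ?addn0// addnS; exact: le_trans IH (los _).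
have him n k : hi (n + k)%N <= hi n.
  by elim: k => [|k IH]; rewrite ?addn0// addnS; exact: le_trans (his _) IH.
have lohi2 n k : lo n <= hi k.
  apply: le_trans (lom n k) _; apply: le_trans (lohi _) _.
  by rewrite addnC; exact: him.
exists (sup (range lo)) => n.
have ub : has_ubound (range lo) by exists (hi 0) => _ [k _ <-].
have h1 : lo n <= sup (range lo) by apply: ub_le_sup => //; exists n.
have h2 : sup (range lo) <= hi n.
  by apply: ge_sup; [exists (lo 0), 0%N|move=> _ [k _ <-]].
move: h1 h2; rewrite /lo /hi ler_norml; lra.
Qed.

Lemma cvg_geometric_bound (C : R) : (fun n => C / 2 ^+ n) @ \oo --> (0 : R).
Proof.
rewrite -(mulr0 C); apply: cvgMr.
have := @cvg_geometric R 1 2^-1; rewrite /geometric /= => h.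
rewrite (_ : (fun n => _) = fun n => 1 * 2^-1 ^+ n); last first.
  by apply: funext => n; rewrite mul1r exprVn.
by apply: h; rewrite ger0_norm ?invr_ge0//; lra.
Qed.

End Compare.

(** * Picard iteration for dominated families *)

Section Picard.
Context {R : realType} (J : Type).
(* The weight w plays the part of a norm: all bounds are index by index. *)
Variables (w x0 : J -> R) (Phi : R -> (J -> R) -> J -> R) (M : R).

Hypothesis x0w : forall j, `|x0 j| <= w j.
Hypothesis M0 : 0 < M.
Hypothesis growth : forall t x C, (forall j, `|x j| <= C * w j) ->
  forall j, `|Phi t x j| <= M * (C * w j).
Hypothesis lipschitz : forall C : R, 0 <= C -> exists L : R, 0 < L /\
  forall t x y d, 0 <= d -> (forall j, `|x j| <= C * w j) ->
    (forall j, `|y j| <= C * w j) ->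
    (forall j, `|x j - y j| <= d * w j) ->
    forall j, `|Phi t x j - Phi t y j| <= L * (d * w j).
Hypothesis Phi_continuous : forall x : R -> J -> R,
  (forall j, continuous (x^~ j)) ->
  (forall T : R, exists C : R, 0 <= C /\ forall t j, `|t| <= T -> `|x t j| <= C * w j) ->
  forall j, continuous (fun t => Phi t (x t) j).

Let w0 j : 0 <= w j. Proof. exact: le_trans (normr_ge0 _) (x0w j). Qed.

Fixpoint picard_iter (n : nat) : R -> J -> R :=
  if n is n'.+1 then
    fun t j => x0 j + prim (fun s => Phi s (picard_iter n' s) j) t
  else fun=> x0.

Let X := picard_iter.

Let expb (T : R) (x : R -> J -> R) :
  (forall t j, `|x t j| <= expR (M * `|t|) * w j) ->
  exists C : R, 0 <= C /\ forall t j, `|t| <= T -> `|x t j| <= C * w j.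
Proof.
move=> h; exists (expR (M * T)); split; first exact: expR_ge0.
move=> t j tT; apply: le_trans (h t j) _; apply: ler_wpM2r => //.
by rewrite ler_expR ler_pM2l.
Qed.

Let iter_inv n : (forall j, continuous ((X n)^~ j)) /\
  (forall t j, `|X n t j| <= expR (M * `|t|) * w j).
Proof.
elim: n => [|n [ihc ihb]].
  split; first by move=> j; exact: cst_continuous.
  move=> t j; apply: le_trans (x0w j) _; apply: ler_peMl => //.
  by rewrite -expR0 ler_expR mulr_ge0// ltW.
have cPhi j := Phi_continuous ihc (fun T => expb T ihb) (j := j).
have dX j (t : R) : is_derive t 1 ((X n.+1)^~ j) (Phi t (X n t) j).
  have := drvD (drvC (x0 j) t) ((primP (cPhi j)).2 t).
  by rewrite add0r.
split; first by move=> j t; exact: is_derive_continuous (dX j t).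
move=> t j.
have := @le_expR_compare R (fun t => X n.+1 t j - x0 j)
  (fun t => Phi t (X n t) j) (w j) M `|t| (w0 j) M0.
have z : X n.+1 0 j - x0 j = 0 by rewrite /= (primP (cPhi j)).1 addr0 subrr.
move=> /(_ z) /(_ _) /(_ _) /(_ t (lexx _)) h.
have {h}h : `|X n.+1 t j - x0 j| <= w j * (expR (M * `|t|) - 1).
  apply: h => s _; first by have := drvB (dX j s) (drvC (x0 j) s); rewrite subr0.
  by apply: le_trans (growth _ (ihb s) j) _; rewrite mulrA [w j * _]mulrC -!mulrA [w j * _]mulrC.
have : `|X n.+1 t j| <= `|X n.+1 t j - x0 j| + `|x0 j|.
  by rewrite -{1}(subrK (x0 j) (X n.+1 t j)) ler_normD.
have := x0w j; lra.
Qed.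

Let X_continuous n j : continuous ((X n)^~ j). Proof. exact: (iter_inv n).1. Qed.
Let X_bound n t j : `|X n t j| <= expR (M * `|t|) * w j.
Proof. exact: (iter_inv n).2. Qed.

Let Phi_iter_continuous n j : continuous (fun t => Phi t (X n t) j).
Proof.
by apply: Phi_continuous => // T; apply: expb => t k; exact: X_bound.
Qed.

Let dX n j (t : R) : is_derive t 1 ((X n.+1)^~ j) (Phi t (X n t) j).
Proof.
have := drvD (drvC (x0 j) t) ((primP (@Phi_iter_continuous n j)).2 t).
by rewrite add0r.
Qed.

Let X_0 n j : X n 0 j = x0 j.
Proof. by case: n => //= n; rewrite (primP (@Phi_iter_continuous n j)).1 addr0. Qed.

Let X_local (T : R) t j n : `|t| <= T -> `|X n t j| <= expR (M * T) * w j.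
Proof.
move=> tT; apply: le_trans (X_bound n t j) _; apply: ler_wpM2r => //.
by rewrite ler_expR ler_pM2l.
Qed.

Let X_step (T : R) : 0 <= T -> exists L : R, 0 < L /\ forall n t j, `|t| <= T ->
  `|X n.+1 t j - X n t j| <=
    2 * expR (M * T) * expR (2 * L * `|t|) / 2 ^+ n * w j.
Proof.
move=> T0.
have [L [L0 hL]] := lipschitz (expR_ge0 (M * T)).
exists L; split => //; elim => [|n IH] t j tT.
  rewrite expr0 divr1.
  apply: (@le_trans _ _ (2 * expR (M * T) * w j)).
    apply: le_trans (ler_normB _ _) _.
    have := X_local j 1 tT; have := X_local j 0 tT; lra.
  apply: ler_wpM2r => //; apply: ler_peMr; first by rewrite mulr_ge0 ?expR_ge0.
  by rewrite -expR0 ler_expR !mulr_ge0// ltW.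
set E := 2 * expR (M * T) in IH *.
have E0 : 0 <= E by rewrite mulr_ge0 ?expR_ge0.
have := @le_expR_compare R (fun t => X n.+2 t j - X n.+1 t j)
  (fun t => Phi t (X n.+1 t) j - Phi t (X n t) j) (E / 2 ^+ n.+1 * w j) (2 * L) T.
have z : X n.+2 0 j - X n.+1 0 j = 0 by rewrite !X_0 subrr.
have D0 : 0 <= E / 2 ^+ n.+1 * w j by rewrite mulr_ge0// divr_ge0// exprn_ge0.
have L2 : 0 < 2 * L by rewrite mulr_gt0.
move=> /(_ D0 L2 z) h.
apply: (@le_trans _ _ (E / 2 ^+ n.+1 * w j * (expR (2 * L * `|t|) - 1))).
  apply: h => // s sT; first by apply: drvB; exact: dX.
  have d0 : 0 <= E * expR (2 * L * `|s|) / 2 ^+ n.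
    by rewrite divr_ge0 ?exprn_ge0// mulr_ge0 ?expR_ge0.
  have := hL s _ _ _ d0 (fun k => X_local k n.+1 sT) (fun k => X_local k n sT)
    (fun k => IH s k sT) j.
  move=> h; apply: le_trans h _; rewrite exprS.
  by apply: le_of_eq; field; rewrite expf_neq0.
rewrite -subr_ge0; rewrite [X in 0 <= X](_ : _ = E / 2 ^+ n.+1 * w j)//; ring.
Qed.

(** The linear growth of the field gives the bound [expR (M * `|t|) * w] for all
    iterates; on families with such a bound the field is Lipschitz, so that the
    iterates converge geometrically after weighting time by an exponential. *)
Lemma picard : exists x : R -> J -> R,
  [/\ forall j, x 0 j = x0 j,
      forall t j, `|x t j| <= expR (M * `|t|) * w j
    & forall (t : R) j, is_derive t 1 (x^~ j) (Phi t (x t) j)].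
Proof.
have lim_ex t j : exists l : R, (fun n => X n t j) @ \oo --> l.
  have [L [L0 hL]] := X_step (normr_ge0 t).
  have [|l hl] := @geometric_limit R (fun n => X n t j)
      (2 * expR (M * `|t|) * expR (2 * L * `|t|) * w j).
    by move=> n; apply: le_trans (hL n t j (lexx _)) _; rewrite mulrAC.
  exists l; apply/cvgrPdist_le => e e0.
  have /cvgrPdist_le/(_ _ e0) := @cvg_geometric_bound R (2 * (2 * expR (M * `|t|) * expR (2 * L * `|t|) * w j)).
  apply: filterS => n; rewrite sub0r normrN => h.
  by rewrite distrC; apply: le_trans (hl n) (le_trans (ler_norm _) h).
pose x t j := lim ((fun n => X n t j) @ \oo).
have xP t j : (fun n => X n t j) @ \oo --> x t j.
  have [l hl] := lim_ex t j.
  by rewrite /x (cvg_lim (@Rhausdorff R) hl).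
have xb t j : `|x t j| <= expR (M * `|t|) * w j.
  apply: (cvgr_to_le (cvg_norm (xP t j))); near=> n; exact: X_bound.
have rate T : 0 <= T -> exists C : R, 0 <= C /\ forall n t j, `|t| <= T ->
    `|X n t j - x t j| <= C / 2 ^+ n * w j.
  move=> T0; have [L [L0 hL]] := X_step T0.
  exists (2 * (2 * expR (M * T) * expR (2 * L * T))); split.
    by rewrite !mulr_ge0 ?expR_ge0.
  move=> n t j tT.
  have [|l hl] := @geometric_limit R (fun n => X n t j)
      (2 * expR (M * T) * expR (2 * L * T) * w j).
    move=> k; apply: le_trans (hL k t j tT) _; rewrite mulrAC.
    apply: ler_wpM2r; first by rewrite invr_ge0 exprn_ge0.
    apply: ler_wpM2r => //; apply: ler_wpM2l; first by rewrite mulr_ge0 ?expR_ge0.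
    by rewrite ler_expR ler_pM2l// mulr_gt0.
  have -> : x t j = l.
    apply: (cvg_unique (@Rhausdorff R) (xP t j)); apply/cvgrPdist_le => e e0.
    have /cvgrPdist_le/(_ _ e0) := @cvg_geometric_bound R (2 * (2 * expR (M * T) * expR (2 * L * T) * w j)).
    apply: filterS => k; rewrite sub0r normrN => h.
    by rewrite distrC; apply: le_trans (hl k) (le_trans (ler_norm _) h).
  by apply: le_trans (hl n) _; apply: le_of_eq; ring.
have xc j : continuous (x^~ j).
  move=> t; apply/cvgrPdist_le => e e0.
  have [C [C0 hC]] := rate (`|t| + 1) (addr_ge0 (normr_ge0 _) ler01).
  have e4 : 0 < e / 4 by lra.
  have /cvgrPdist_le/(_ _ e4) [n _ /(_ n (leqnn n))] := @cvg_geometric_bound R (C * w j).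
  rewrite sub0r normrN => hn.
  have {}hn : C / 2 ^+ n * w j <= e / 4.
    by rewrite mulrAC; exact: le_trans (ler_norm _) hn.
  have /cvgrPdist_le/(_ _ e4) cX := @X_continuous n j t.
  near=> s.
  have h1 : `|X n t j - X n s j| <= e / 4 by near: s; exact: cX.
  have sT : `|s| <= `|t| + 1 by near: s; exact: near_norm_le.
  have h2 := le_trans (hC n s j sT) hn.
  have tT : `|t| <= `|t| + 1 by lra.
  have h3 := le_trans (hC n t j tT) hn.
  move: h1 h2 h3; rewrite !ler_norml; lra.
have cPhi j : continuous (fun t => Phi t (x t) j).
  by apply: Phi_continuous => // T; exact: expb.
have xE t j : x t j = x0 j + prim (fun s => Phi s (x s) j) t.
  have [C [C0 hC]] := rate `|t| (normr_ge0 t).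
  have [L [L0 hL]] := lipschitz (expR_ge0 (M * `|t|)).
  have xl s k : `|s| <= `|t| -> `|x s k| <= expR (M * `|t|) * w k.
    by move=> st; apply: le_trans (xb s k) _; apply: ler_wpM2r => //; rewrite ler_expR ler_pM2l.
  have c1 : (fun n => X n.+1 t j) @ \oo --> x t j.
    by rewrite (cvg_shiftS (fun n => X n t j)).
  apply: (cvg_unique (@Rhausdorff R) c1).
  apply/cvgrPdist_le => e e0.
  have /cvgrPdist_le/(_ _ e0) :=
    @cvg_geometric_bound R (L * (C * w j) * (expR (1 * `|t|) - 1)).
  apply: filterS => n; rewrite sub0r normrN => h.
  have := @le_expR_compare R
    (fun t => X n.+1 t j - (x0 j + prim (fun s => Phi s (x s) j) t))
    (fun t => Phi t (X n t) j - Phi t (x t) j) (L * (C / 2 ^+ n * w j)) 1 `|t|.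
  have Cn : 0 <= C / 2 ^+ n by rewrite divr_ge0// exprn_ge0.
  have D0 : 0 <= L * (C / 2 ^+ n * w j) by rewrite !mulr_ge0// ltW.
  have z : X n.+1 0 j - (x0 j + prim (fun s => Phi s (x s) j) 0) = 0.
    by rewrite X_0 (primP (cPhi j)).1 addr0 subrr.
  move=> /(_ D0 ltr01 z) k.
  rewrite distrC; apply: le_trans (k _ _ t (lexx _)) _.
  - move=> s _; apply: drvB; first exact: dX.
    by have := drvD (drvC (x0 j) s) ((primP (cPhi j)).2 s); rewrite add0r.
  - move=> s st.
    have := hL s _ _ _ Cn (fun k => X_local k n st) (fun k => xl s k st) (fun k => hC n s k st) j.
    move=> {}h; apply: le_trans h _; rewrite mulr1 mul1r.
    by apply: ler_peMr => //; rewrite -expR0 ler_expR.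
  - apply: le_trans h; apply: le_trans (ler_norm _).
    by apply: le_of_eq; ring.
exists x; split => //.
  by move=> j; rewrite xE (primP (cPhi j)).1 addr0.
move=> t j; have := drvD (drvC (x0 j) t) ((primP (cPhi j)).2 t).
by rewrite add0r; apply: near_eq_is_derive; near=> s; rewrite xE.
Unshelve. all: by end_near. Qed.

End Picard.

(** * Normal forms for oscillating polynomials *)

Section ComplexDerivative.
Context {R : realType}.
Local Notation C := (complex R).
Local Notation toC := (real_complex R).
Notation iC := (Complex (0 : R) 1).
Notation nrm := (@ComplexField.Normc.normc R).

Definition is_cderive (f : R -> C) (t : R) (d : C) : Prop :=
  is_derive t 1 (fun s => complex.Re (f s)) (complex.Re d) /\
  is_derive t 1 (fun s => complex.Im (f s)) (complex.Im d).

Lemma cdrv_eq f t a b : is_cderive f t a -> a = b -> is_cderive f t b.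
Proof. by move=> h <-. Qed.

Lemma cdrvC (c : C) t : is_cderive (fun=> c) t 0.
Proof. by split; exact: drvC. Qed.

Lemma ReD (x y : C) : complex.Re (x + y) = complex.Re x + complex.Re y.
Proof. by case: x => a b; case: y. Qed.

Lemma ImD (x y : C) : complex.Im (x + y) = complex.Im x + complex.Im y.
Proof. by case: x => a b; case: y. Qed.

Lemma ImB (x y : C) : complex.Im (x - y) = complex.Im x - complex.Im y.
Proof. by case: x => a b; case: y. Qed.

Lemma Im_sum (I : Type) (s : seq I) (F : I -> C) :
  complex.Im (\sum_(i <- s) F i) = \sum_(i <- s) complex.Im (F i).
Proof. exact: (big_morph _ ImD erefl). Qed.

Lemma Re_sum (I : Type) (s : seq I) (F : I -> C) :
  complex.Re (\sum_(i <- s) F i) = \sum_(i <- s) complex.Re (F i).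
Proof. exact: (big_morph _ ReD erefl). Qed.

Lemma cdrvD f g t a b : is_cderive f t a -> is_cderive g t b ->
  is_cderive (fun s => f s + g s) t (a + b).
Proof.
move=> [fr fi] [gr gi]; split.
  rewrite (_ : (fun s => _) = fun s => complex.Re (f s) + complex.Re (g s)).
    by rewrite ReD; exact: drvD.
  by apply: funext => s; rewrite ReD.
rewrite (_ : (fun s => _) = fun s => complex.Im (f s) + complex.Im (g s)).
  by rewrite ImD; exact: drvD.
by apply: funext => s; rewrite ImD.
Qed.

Lemma ReM (x y : C) : complex.Re (x * y) =
  complex.Re x * complex.Re y - complex.Im x * complex.Im y.
Proof. by case: x => a b; case: y. Qed.

Lemma ImM (x y : C) : complex.Im (x * y) =
  complex.Re x * complex.Im y + complex.Im x * complex.Re y.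
Proof. by case: x => a b; case: y. Qed.

Lemma cdrvM f g t a b : is_cderive f t a -> is_cderive g t b ->
  is_cderive (fun s => f s * g s) t (a * g t + f t * b).
Proof.
move=> [fr fi] [gr gi]; split.
  rewrite (_ : (fun s => _) = fun s => complex.Re (f s) * complex.Re (g s) - complex.Im (f s) * complex.Im (g s)).
    by apply: drv_eq (drvB (drvM fr gr) (drvM fi gi)) _; rewrite ReD !ReM; ring.
  by apply: funext => s; rewrite ReM.
rewrite (_ : (fun s => _) = fun s => complex.Re (f s) * complex.Im (g s) + complex.Im (f s) * complex.Re (g s)).
  by apply: drv_eq (drvD (drvM fr gi) (drvM fi gr)) _; rewrite ImD !ImM; ring.
by apply: funext => s; rewrite ImM.
Qed.

Lemma ReZ (c : R) (x : C) : complex.Re (toC c * x) = c * complex.Re x.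
Proof. by rewrite ReM /= mul0r subr0. Qed.

Lemma ImZ (c : R) (x : C) : complex.Im (toC c * x) = c * complex.Im x.
Proof. by rewrite ImM /= mul0r addr0. Qed.

Lemma Re_iM (x : C) : complex.Re (iC * x) = - complex.Im x.
Proof. by rewrite ReM /= mul0r mul1r sub0r. Qed.

Lemma normc_ge_absRe (x : C) : `|complex.Re x| <= nrm x.
Proof.
case: x => a b /=; rewrite -sqrtr_sqr ler_wsqrtr// lerDl; exact: sqr_ge0.
Qed.

Lemma normc_ge_absIm (x : C) : `|complex.Im x| <= nrm x.
Proof.
case: x => a b /=; rewrite -sqrtr_sqr ler_wsqrtr// lerDr; exact: sqr_ge0.
Qed.

Lemma nrm_ge0 (x : C) : 0 <= nrm x.
Proof. by case: x => a b; exact: sqrtr_ge0. Qed.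

Lemma normcR (c : R) : nrm (toC c) = `|c|.
Proof. by rewrite /= expr0n/= addr0 sqrtr_sqr. Qed.

End ComplexDerivative.

Section NormalForm.
Context {R : realType} {A : eqType}.
Local Notation C := (complex R).
Local Notation toC := (real_complex R).
Notation iC := (Complex (0 : R) 1).
Notation nrm := (@ComplexField.Normc.normc R).

(** Polynomials with real coefficients in commuting letters, as lists of
    monomials.  No simplification is performed: only evaluations and
    coefficientwise majorants of such a list matter. *)
Definition npoly := seq (R * seq A).

Definition mon (x : A -> C) (l : seq A) : C := \prod_(a <- l) x a.

Definition ev (x : A -> C) (B : npoly) : C :=
  \sum_(t <- B) toC t.1 * mon x t.2.

(** The value of the polynomial of absolute values; unlike [ev] it is monotone
    in the coefficients. *)
Definition maj (p : A -> R) (B : npoly) : R :=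
  \sum_(t <- B) `|t.1| * \prod_(a <- t.2) p a.

Definition mulp (W B : npoly) : npoly :=
  [seq (w.1 * t.1, w.2 ++ t.2) | w <- W, t <- B].

Lemma mon_cons x a l : mon x (a :: l) = x a * mon x l.
Proof. by rewrite /mon big_cons. Qed.

Lemma ev_cat x B B' : ev x (B ++ B') = ev x B + ev x B'.
Proof. by rewrite /ev big_cat. Qed.

Lemma maj_cat p B B' : maj p (B ++ B') = maj p B + maj p B'.
Proof. by rewrite /maj big_cat. Qed.

Lemma maj_ge0 p B : (forall a, 0 <= p a) -> 0 <= maj p B.
Proof.
by move=> p0; rewrite sumr_ge0// => t _; rewrite mulr_ge0// prodr_ge0.
Qed.

Lemma ev_mulp x W B : ev x (mulp W B) = ev x W * ev x B.
Proof.
rewrite /ev /mulp big_allpairs_dep /= mulr_suml; apply: eq_bigr => w _.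
rewrite mulr_sumr; apply: eq_bigr => t _ /=.
by rewrite /mon big_cat/= rmorphM/=; ring.
Qed.

Lemma maj_mulp p W B : maj p (mulp W B) = maj p W * maj p B.
Proof.
rewrite /maj /mulp big_allpairs_dep /= mulr_suml; apply: eq_bigr => w _.
rewrite mulr_sumr; apply: eq_bigr => t _ /=.
by rewrite big_cat/= normrM; ring.
Qed.

Lemma normc_ev x p B : (forall a, nrm (x a) <= p a) -> nrm (ev x B) <= maj p B.
Proof.
move=> xp.
have mp l : nrm (mon x l) <= \prod_(a <- l) p a.
  elim: l => [|a l IH].
    by rewrite /mon !big_nil (_ : 1 = toC 1)// normcR normr1.
  rewrite mon_cons big_cons ComplexField.Normc.normcM.
  by apply: ler_pM => //; exact: nrm_ge0.
rewrite /ev /maj; elim: B => [|t B IH].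
  by rewrite !big_nil (_ : 0 = toC 0)// normcR normr0.
rewrite !big_cons; apply: (le_trans (le_normcD _ _)).
by apply: lerD => //; rewrite ComplexField.Normc.normcM normcR ler_wpM2l.
Qed.

(* A letter a rotates with frequency nu a and is fed linearly by the letters of sub a. *)
Variables (nu : A -> R) (sub : A -> seq (R * A)).

Definition freq (l : seq A) : R := \sum_(a <- l) nu a.

(** The linear feeding acts on monomials as a derivation. *)
Fixpoint nonlin_mon (l : seq A) : npoly :=
  if l is a :: l' then
    [seq (t.1, t.2 :: l') | t <- sub a] ++ [seq (t.1, a :: t.2) | t <- nonlin_mon l']
  else [::].

Definition nonlin_part (B : npoly) : npoly :=
  flatten [seq [seq (t.1 * d.1, d.2) | d <- nonlin_mon t.2] | t <- B].

Definition freq_part (B : npoly) : npoly := [seq (t.1 * freq t.2, t.2) | t <- B].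

(** A solution of the homological equation: each monomial is divided by its
    frequency.  Nonoscillating monomials are divided by [0], that is, dropped. *)
Definition homological_inv (B : npoly) : npoly := [seq (t.1 / freq t.2, t.2) | t <- B].

Lemma ev_nonlin_part x B : ev x (nonlin_part B) = \sum_(t <- B) toC t.1 * ev x (nonlin_mon t.2).
Proof.
rewrite /ev /nonlin_part big_flatten big_map; apply: eq_bigr => t _.
rewrite big_map mulr_sumr; apply: eq_bigr => d _ /=.
by rewrite rmorphM mulrA.
Qed.

(** The Leibniz rule costs one factor [k] per letter. *)
Lemma maj_nonlin_mon (p : A -> R) (k : R) l : (forall a, 0 <= p a) ->
  (forall a, \sum_(t <- sub a) `|t.1| * p t.2 <= k * p a) ->
  maj p (nonlin_mon l) <= k * (size l)%:R * \prod_(a <- l) p a.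
Proof.
move=> p0 hk; elim: l => [|a l IH].
  by rewrite /maj !big_nil mulr0 mul0r.
rewrite /= maj_cat /maj !big_map big_cons /=.
have -> : \sum_(t <- sub a) `|t.1| * \prod_(b <- t.2 :: l) p b =
    (\sum_(t <- sub a) `|t.1| * p t.2) * \prod_(b <- l) p b.
  by rewrite mulr_suml; apply: eq_bigr => t _; rewrite big_cons mulrA.
have -> : \sum_(t <- nonlin_mon l) `|t.1| * \prod_(b <- a :: t.2) p b = p a * maj p (nonlin_mon l).
  by rewrite /maj mulr_sumr; apply: eq_bigr => t _; rewrite big_cons; ring.
have q0 : 0 <= \prod_(b <- l) p b by exact: prodr_ge0.
have h1 := ler_wpM2r q0 (hk a).
have h2 := ler_wpM2l (p0 a) IH.
apply: (le_trans (lerD h1 h2)); rewrite -natr1.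
by apply: le_of_eq; ring.
Qed.

Lemma maj_nonlin_part p (k : R) d B : (forall a, 0 <= p a) ->
  (forall a, \sum_(t <- sub a) `|t.1| * p t.2 <= k * p a) ->
  all (fun t => size t.2 == d) B ->
  maj p (nonlin_part B) <= k * d%:R * maj p B.
Proof.
move=> p0 hk; elim: B => [|t B IH] /=.
  by move=> _; rewrite /maj /nonlin_part /= !big_nil mulr0.
move=> /andP[/eqP td /IH{}IH].
rewrite /nonlin_part /= maj_cat -/(nonlin_part B) [in leRHS]/maj big_cons -/(maj p B) mulrDr.
apply: lerD => //; rewrite /maj big_map /=.
have -> : \sum_(e <- nonlin_mon t.2) `|t.1 * e.1| * \prod_(a <- e.2) p a =
    `|t.1| * maj p (nonlin_mon t.2).
  by rewrite /maj mulr_sumr; apply: eq_bigr => e _; rewrite normrM mulrA.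
apply: le_trans (ler_wpM2l (normr_ge0 _) (maj_nonlin_mon t.2 p0 hk)) _.
by rewrite td; apply: le_of_eq; ring.
Qed.

Variable good : pred A.
Hypothesis good_sub : forall a, good a -> all (fun t => good t.2) (sub a).

(** Homogeneity counts the letters, the number of which enters the bound for
    derivatives and selects the applicable gap. *)
Definition homog (d : nat) (B : npoly) : bool :=
  all (fun t => (size t.2 == d) && all good t.2) B.

Lemma homog_size d B : homog d B -> all (fun t => size t.2 == d) B.
Proof. by apply: sub_all => t /andP[]. Qed.

Lemma homog_nonlin_mon l : all good l -> homog (size l) (nonlin_mon l).
Proof.
elim: l => [//|a l IH] /= /andP[ga gl]; rewrite /homog all_cat !all_map.
apply/andP; split; apply/allP => t ht /=; rewrite eqSS.
  by rewrite eqxx gl andbT /=; move/allP: (good_sub ga); exact.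
by move/allP: (IH gl) => /(_ t ht) /andP[-> ->]; rewrite ga.
Qed.

Lemma homog_nonlin_part d B : homog d B -> homog d (nonlin_part B).
Proof.
rewrite /nonlin_part; elim: B => [//|t B IH] /= /andP[/andP[/eqP td gt] /IH{}IH].
rewrite /homog all_cat -!/(homog _ _) IH andbT /homog all_map.
by have := homog_nonlin_mon gt; rewrite td; apply: sub_all.
Qed.

Lemma homog_mulp d e W B : homog d W -> homog e B -> homog (d + e) (mulp W B).
Proof.
move=> hW hB; apply/allP => t /allpairsP[[u v] /= [hu hv ->]] /=.
move/allP: hW => /(_ _ hu) /andP[/eqP <- gu].
move/allP: hB => /(_ _ hv) /andP[/eqP <- gv].
by rewrite size_cat eqxx all_cat gu gv.
Qed.

Lemma homog_homological_inv d B : homog d B -> homog d (homological_inv B).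
Proof. by rewrite /homog /homological_inv all_map; apply: sub_all. Qed.

(** Nonresonance with gap [delta]: a monomial either oscillates with
    frequency at least [delta], or it does not oscillate and is real, in which
    case it does not contribute to the imaginary parts to be removed. *)
Definition gap (x : A -> C) (delta : R) (l : seq A) : Prop :=
  (freq l = 0 /\ complex.Im (mon x l) = 0) \/ delta <= `|freq l|.

Lemma maj_homological_inv x p delta B : 0 < delta -> (forall a, 0 <= p a) ->
  (forall t, t \in B -> gap x delta t.2) ->
  maj p (homological_inv B) <= maj p B / delta.
Proof.
move=> d0 p0; rewrite /maj /homological_inv big_map /= mulr_suml => hg.
rewrite !big_seq; apply: ler_sum => t /hg h.
have q0 : 0 <= \prod_(b <- t.2) p b by exact: prodr_ge0.
rewrite normrM mulrAC; apply: ler_wpM2l; first by rewrite mulr_ge0.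
case: h => [[-> _]|h]; first by rewrite invr0 normr0 invr_ge0 ltW.
by rewrite normfV lef_pV2 ?posrE//; exact: lt_le_trans h.
Qed.

(** The imaginary parts survive the division by frequencies: the dropped
    monomials are real. *)
Lemma Im_ev_homological_inv x delta B : 0 < delta ->
  (forall t, t \in B -> gap x delta t.2) ->
  complex.Im (ev x (freq_part (homological_inv B))) = complex.Im (ev x B).
Proof.
move=> d0 hg; rewrite /ev /freq_part /homological_inv !big_map !Im_sum !big_seq.
apply: eq_bigr => t /hg h; rewrite !ImZ /=.
case: h => [[e ->]|h]; first by rewrite !mulr0.
by rewrite divfK// -normr_gt0; exact: lt_le_trans h.
Qed.

Section Flow.
Variables (X : R -> A -> C) (kappa t : R).
(* The common factor kappa is the nonlinear coupling of all letters. *)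
Hypothesis flow : forall a, is_cderive (X^~ a) t
  (iC * (toC kappa * (\sum_(s <- sub a) toC s.1 * X t s.2) - toC (nu a) * X t a)).

Lemma cdrv_mon l : is_cderive (fun s => mon (X s) l) t
  (iC * (toC kappa * ev (X t) (nonlin_mon l) - toC (freq l) * mon (X t) l)).
Proof.
elim: l => [|a l IH].
  rewrite (_ : (fun s => _) = fun=> 1).
    apply: cdrv_eq (cdrvC _ _) _.
    by rewrite /ev /freq /= !big_nil mulr0 rmorph0 mul0r subr0 mulr0.
  by apply: funext => s; rewrite /mon big_nil.
rewrite (_ : (fun s => _) = fun s => X s a * mon (X s) l); last first.
  by apply: funext => s; rewrite mon_cons.
apply: cdrv_eq (cdrvM (flow a) IH) _.
rewrite /= ev_cat mon_cons /freq big_cons rmorphD /=.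
have -> : ev (X t) [seq (t0.1, t0.2 :: l) | t0 <- sub a] =
   (\sum_(s <- sub a) toC s.1 * X t s.2) * mon (X t) l.
  rewrite /ev big_map mulr_suml; apply: eq_bigr => s _ /=.
  by rewrite mon_cons mulrA.
have -> : ev (X t) [seq (t0.1, a :: t0.2) | t0 <- nonlin_mon l] = X t a * ev (X t) (nonlin_mon l).
  rewrite /ev big_map mulr_sumr; apply: eq_bigr => s _ /=.
  by rewrite mon_cons; ring.
ring.
Qed.

Lemma cdrv_ev B : is_cderive (fun s => ev (X s) B) t
  (iC * (toC kappa * ev (X t) (nonlin_part B) - ev (X t) (freq_part B))).
Proof.
rewrite ev_nonlin_part /freq_part; elim: B => [|u B IH].
  rewrite (_ : (fun s => _) = fun=> 0).
    by apply: cdrv_eq (cdrvC _ _) _; rewrite /ev /= !big_nil !(mulr0, subr0).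
  by apply: funext => s; rewrite /ev big_nil.
rewrite (_ : (fun s => _) = fun s => toC u.1 * mon (X s) u.2 + ev (X s) B); last first.
  by apply: funext => s; rewrite /ev big_cons.
apply: cdrv_eq (cdrvD (cdrvM (cdrvC (toC u.1) t) (cdrv_mon u.2)) IH) _.
by rewrite /ev /= !big_cons /= rmorphM /=; ring.
Qed.

Lemma is_derive_Re_ev B : is_derive t 1 (fun s => complex.Re (ev (X s) B))
  (complex.Im (ev (X t) (freq_part B)) - kappa * complex.Im (ev (X t) (nonlin_part B))).
Proof.
have [h _] := cdrv_ev B; apply: drv_eq h _.
by rewrite Re_iM ImB ImZ opprB.
Qed.

Variables (W B1 : npoly) (r delta2 delta3 : R).
(** The correctors of the second and third order in the letters: each removes
    the derivative left by its predecessor, with [kappa] replaced by its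
    polynomial part [W]. *)
Definition corrector2 := homological_inv (mulp W (nonlin_part B1)).
Definition corrector3 := homological_inv (mulp W (nonlin_part corrector2)).
Hypothesis kappaE : kappa = complex.Re (ev (X t) W) + r.
Hypothesis ImW : complex.Im (ev (X t) W) = 0.
Hypothesis d2 : 0 < delta2.
Hypothesis d3 : 0 < delta3.
Hypothesis gap2 : forall u, u \in mulp W (nonlin_part B1) -> gap (X t) delta2 u.2.
Hypothesis gap3 : forall u, u \in mulp W (nonlin_part corrector2) -> gap (X t) delta3 u.2.
Hypothesis B1_const : freq_part B1 = [seq (0, u.2) | u <- B1].

(** Two steps of the normal form.  The oscillation of each corrector cancels
    the nonlinear derivative of the previous term, because [W] is real up to
    the remainder [r]; what is left is of one order higher than the last
    corrector, plus terms proportional to [r]. *)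
Lemma is_derive_normal_form :
  is_derive t 1 (fun s => complex.Re (ev (X s) B1) +
      complex.Re (ev (X s) corrector2) + complex.Re (ev (X s) corrector3))
    (- r * (complex.Im (ev (X t) (nonlin_part B1)) + complex.Im (ev (X t) (nonlin_part corrector2)))
     - kappa * complex.Im (ev (X t) (nonlin_part corrector3))).
Proof.
apply: drv_eq (drvD (drvD (is_derive_Re_ev B1) (is_derive_Re_ev corrector2)) (is_derive_Re_ev corrector3)) _.
have key B : complex.Im (ev (X t) (mulp W B)) = (kappa - r) * complex.Im (ev (X t) B).
  by rewrite ev_mulp ImM ImW mul0r addr0 kappaE addrK.
rewrite (Im_ev_homological_inv d2 gap2) (Im_ev_homological_inv d3 gap3) !key.
have -> : complex.Im (ev (X t) (freq_part B1)) = 0.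
  rewrite B1_const /ev big_map Im_sum big1// => u _.
  by rewrite ImZ mul0r.
ring.
Qed.

End Flow.
End NormalForm.

(** * Small divisors *)

Section Divisors.
Context {R : realType}.
Variable (m : R).
Hypotheses (hm1 : - (1 / 2) <= m) (hm2 : m <= 1).
Local Notation om := (omega m).

Lemma omega_sqr j : (om j) ^+ 2 = j%:R ^+ 2 * (j%:R ^+ 2 + m).
Proof.
have m_ge := hm1; have m_le := hm2.
rewrite /omega sqr_sqrtr; first by ring.
case: j => [|j]; first by rewrite !expr0n/= mulr0 addr0.
have j1 : 1 <= j.+1%:R :> R by rewrite ler1n.
move: (j.+1%:R : R) j1 => x j1.
rewrite (_ : _ + _ = x ^+ 2 * (x ^+ 2 + m)); last by ring.
have x2 : 1 <= x ^+ 2 by rewrite expr_ge1//; lra.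
apply: mulr_ge0; [exact: sqr_ge0|]. lra.
Qed.

Lemma omega_ge0 j : 0 <= om j. Proof. exact: sqrtr_ge0. Qed.

(** The squares of [j ^ 2 + m / 2] and of the frequency differ by [m ^ 2 / 4]
    only, so that the defect is small compared with [m] itself. *)
Lemma omega_shift j : (0 < j)%N ->
  j%:R ^+ 2 + m / 2 - `|m| / 8 <= om j <= j%:R ^+ 2 + m / 2.
Proof.
have m_ge := hm1; have m_le := hm2.
move=> j0; have := omega_sqr j; have := omega_ge0 j.
have j1 : 1 <= j%:R :> R by rewrite ler1n.
move: (om j) (j%:R : R) j1 => y x j1 y0.
have x2 : 1 <= x ^+ 2 by nra.
move: (x ^+ 2) x2 => z z1 yE.
have hi0 : 0 <= z + m / 2 by lra.
have [m0|m0] := leP 0 m.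
  rewrite ger0_norm//; have lo0 : 0 <= z + m / 2 - m / 8 by lra.
  have h : 0 <= m * (z - m) by rewrite mulr_ge0//; lra.
  by apply/andP; split; rewrite -ler_sqr ?nnegrE// yE; nra.
rewrite ltr0_norm//; have lo0 : 0 <= z + m / 2 - - m / 8 by lra.
have h : 0 <= - m * (z + 25 / 16 * m) by rewrite mulr_ge0//; lra.
by apply/andP; split; rewrite -ler_sqr ?nnegrE// yE; nra.
Qed.

Lemma natr_sqr_ge1 (j : nat) : (0 < j)%N -> 1 <= j%:R ^+ 2 :> R.
Proof. by move=> j0; rewrite expr_ge1// ?ler0n// ler1n. Qed.

Lemma omega_gt0 j : (0 < j)%N -> 0 < om j.
Proof.
have m_ge := hm1; have m_le := hm2.
move=> j0; have /andP[h _] := omega_shift j0.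
have j1 := natr_sqr_ge1 j0; apply: lt_le_trans h.
have [m0|m0] := leP 0 m; [rewrite ger0_norm//|rewrite ltr0_norm//]; lra.
Qed.

Lemma omega_ge1 j : (0 < j)%N -> Num.sqrt (1 + m) <= om j.
Proof.
have m_ge := hm1; have m_le := hm2.
move=> j0; rewrite /omega ler_wsqrtr//.
have := natr_sqr_ge1 j0; rewrite (_ : j%:R ^+ 4 = (j%:R ^+ 2) ^+ 2 :> R); last by rewrite -exprM.
by move: (j%:R ^+ 2 : R) => z z1; nra.
Qed.

Lemma sqrt1m_bounds : 7 / 10 <= Num.sqrt (1 + m) <= 3 / 2.
Proof.
have m_ge := hm1; have m_le := hm2.
have h : 0 <= 1 + m by lra.
have := sqr_sqrtr h; have := sqrtr_ge0 (1 + m).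
move: (Num.sqrt _) => y y0 yE; apply/andP; split; nra.
Qed.

Lemma omega_gap2 i j : (0 < i)%N -> (i < j)%N -> 3 / 2 <= om j - om i.
Proof.
have m_ge := hm1; have m_le := hm2.
move=> i0 ij; have j0 : (0 < j)%N by exact: leq_trans ij.
have /andP[h1 _] := omega_shift j0; have /andP[_ h2] := omega_shift i0.
have i1 : 1 <= i%:R :> R by rewrite ler1n.
have ij' : i%:R + 1 <= j%:R :> R by rewrite natr1 ler_nat.
have ij2 : i%:R ^+ 2 + 3 <= j%:R ^+ 2 :> R.
  by move: (i%:R : R) (j%:R : R) i1 ij' => x y *; nra.
have [m0|m0] := leP 0 m; move: h1; [rewrite ger0_norm//|rewrite ltr0_norm//]; lra.
Qed.

(** At [m = 0] the exact resonances are the Pythagorean triples; they are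
    detuned by [m / 2].  All other triples miss a resonance by at least one. *)
Lemma omega_gap3 i j k : (0 < i)%N -> (0 < j)%N -> (0 < k)%N ->
  `|m| / 4 <= `|om i - om j - om k|.
Proof.
have m_ge := hm1; have m_le := hm2.
move=> i0 j0 k0.
have /andP[i1 i2] := omega_shift i0.
have /andP[j1 j2] := omega_shift j0.
have /andP[k1 k2] := omega_shift k0.
pose z : int := (i%:Z ^+ 2 - j%:Z ^+ 2 - k%:Z ^+ 2)%R.
have zE : i%:R ^+ 2 - j%:R ^+ 2 - k%:R ^+ 2 = z%:~R :> R.
  by rewrite /z !rmorphB /= !rmorphXn.
have [z1|z1|z0] := ltgtP z 0; last first.
- move: zE; rewrite z0 mulr0z => zE.
  rewrite ler_normr; have [m0|m0] := leP 0 m.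
    rewrite ger0_norm// in i1 j1 k1 *; apply/orP; right; lra.
  rewrite ltr0_norm// in i1 j1 k1 *; apply/orP; left; lra.
- have z1' : 1 <= z%:~R :> R by rewrite ler1z -gtz0_ge1.
  rewrite -zE in z1'; rewrite ler_normr; apply/orP; left.
  have [m0|m0] := leP 0 m; [rewrite ger0_norm// in i1 j1 k1 *|rewrite ltr0_norm// in i1 j1 k1 *]; lra.
- have z1' : z%:~R + 1 <= 0 :> R.
    by rewrite -[1]/(1%:~R) -intrD lerz0 lezD1.
  rewrite -zE in z1'; rewrite ler_normr; apply/orP; right.
  have [m0|m0] := leP 0 m; [rewrite ger0_norm// in i1 j1 k1 *|rewrite ltr0_norm// in i1 j1 k1 *]; lra.
Qed.

End Divisors.

(** * Quadratic letters of the modes *)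

Section Modes.
Context {R : realType}.
Variable m : R.
Local Notation C := (complex R).
Local Notation toC := (real_complex R).
Local Notation iC := (Complex (0 : R) 1).
Local Notation nrm := (@ComplexField.Normc.normc R).
Local Notation om := (omega m).

(** For the mode variable [psi = a + i b] the letters of mode [j] are
    [`|psi| ^ 2] for [None], [psi ^ 2] for [Some true] and its conjugate for
    [Some false].  The coupling and the energy are linear in them, and the
    equations of motion are linear in them up to the scalar coupling. *)
Definition letter := (option bool * nat)%type.

Definition letter_phase (s : option bool) : R :=
  match s with None => 0 | Some true => 1 | Some false => -1 end.

Definition letter_freq (l : letter) : R := 2 * letter_phase l.1 * om l.2.

(** The coupling strength of mode [j]; it is bounded in [j], which is why the
    nonlinearity loses no derivatives in the variables [a] and [b]. *)
Definition lam (j : nat) : R := j%:R ^+ 2 / om j.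

Definition letter_flow (l : letter) : seq (R * letter) :=
  let j := l.2 in
  match l.1 with
  | None => [:: (lam j / 2, (Some true, j)); (- (lam j / 2), (Some false, j))]
  | Some true => [:: (- lam j, (Some true, j)); (- lam j, (None, j))]
  | Some false => [:: (lam j, (Some false, j)); (lam j, (None, j))]
  end.

Definition letter_val (a b : nat -> R) (l : letter) : C :=
  let j := l.2 in
  match l.1 with
  | None => Complex (a j ^+ 2 + b j ^+ 2) 0
  | Some true => Complex (a j ^+ 2 - b j ^+ 2) (2 * a j * b j)
  | Some false => Complex (a j ^+ 2 - b j ^+ 2) (- (2 * a j * b j))
  end.

(** A common bound of the absolute values of the three letters. *)
Definition letter_amp (a b : nat -> R) (l : letter) : R := a l.2 ^+ 2 + b l.2 ^+ 2.

Definition good_letter (l : letter) : bool := (0 < l.2)%N.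

(** The Kirchhoff term of the modes below [n], from
    [a ^ 2 = (`|psi| ^ 2 + Re (psi ^ 2)) / 2]. *)
Definition kirchhoff_poly (n : nat) : @npoly R letter :=
  flatten [seq [:: ((4 * pi)^-1, [:: (None, j)]);
                   ((4 * pi)^-1 / 2, [:: (Some true, j)]);
                   ((4 * pi)^-1 / 2, [:: (Some false, j)])]
          | j <- index_iota 1 n].

Definition energy_poly (n : nat) : @npoly R letter :=
  [seq (1, [:: (None, j)]) | j <- index_iota 1 n].

Lemma good_letter_flow l : good_letter l -> all (fun t => good_letter t.2) (letter_flow l).
Proof. by case: l => -[[]|] j; rewrite /good_letter /= => ->. Qed.

Lemma homog_kirchhoff n : homog good_letter 1 (kirchhoff_poly n).
Proof.
apply/allP => t /flattenP[_ /mapP[j hj ->]].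
move: hj; rewrite mem_index_iota => /andP[j0 _].
by rewrite !inE => /or3P[] /eqP -> /=; rewrite /good_letter /= j0.
Qed.

Lemma homog_energy n : homog good_letter 1 (energy_poly n).
Proof.
apply/allP => t /mapP[j hj ->]; move: hj.
by rewrite mem_index_iota => /andP[j0 _] /=; rewrite /good_letter /= j0.
Qed.

Lemma letter_amp_ge0 a b l : 0 <= letter_amp a b l.
Proof. by rewrite /letter_amp addr_ge0 ?sqr_ge0. Qed.

Lemma normc_letter_val a b l : nrm (letter_val a b l) <= letter_amp a b l.
Proof.
have h : Num.sqrt ((a l.2 ^+ 2 - b l.2 ^+ 2) ^+ 2 + (2 * a l.2 * b l.2) ^+ 2) <= letter_amp a b l.
  rewrite (_ : _ + _ = letter_amp a b l ^+ 2); last by rewrite /letter_amp; ring.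
  by rewrite sqrtr_sqr ger0_norm ?letter_amp_ge0.
by case: l h => -[[]|] j h; rewrite /letter_val /= ?sqrrN// expr0n/= addr0 sqrtr_sqr ger0_norm ?(letter_amp_ge0 a b (None, j)).
Qed.

Lemma maj_kirchhoff a b n : maj (letter_amp a b) (kirchhoff_poly n) =
  (2 * pi)^-1 * \sum_(1 <= j < n) (a j ^+ 2 + b j ^+ 2).
Proof.
rewrite /maj /kirchhoff_poly big_flatten big_map mulr_sumr; apply: eq_bigr => j _.
rewrite !big_cons !big_nil /letter_amp /=.
have p0 := @pi_gt0 R.
have t0 : 0 <= (4 * pi)^-1 :> R by rewrite invr_ge0 mulr_ge0// ltW.
have t1 : 0 <= (4 * pi)^-1 / 2 :> R by rewrite divr_ge0.
rewrite (ger0_norm t0) (ger0_norm t1).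
by move: (pi : R) p0 {t0 t1} => q q0; field; rewrite gt_eqF.
Qed.

Lemma maj_energy a b n : maj (letter_amp a b) (energy_poly n) = \sum_(1 <= j < n) (a j ^+ 2 + b j ^+ 2).
Proof.
rewrite /maj /energy_poly big_map; apply: eq_bigr => j _.
by rewrite big_cons big_nil /= normr1 mulr1 mul1r.
Qed.

Lemma Re_ev_energy a b n : complex.Re (ev (letter_val a b) (energy_poly n)) =
  \sum_(1 <= j < n) (a j ^+ 2 + b j ^+ 2).
Proof.
rewrite /ev /energy_poly big_map Re_sum; apply: eq_bigr => j _.
by rewrite ReZ /mon big_cons big_nil mulr1 /= mul1r.
Qed.

Lemma ev_kirchhoff a b n : ev (letter_val a b) (kirchhoff_poly n) = toC ((2 * pi)^-1 * \sum_(1 <= j < n) a j ^+ 2).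
Proof.
rewrite /ev /kirchhoff_poly big_flatten big_map mulr_sumr rmorph_sum; apply: eq_bigr => j _.
rewrite !big_cons !big_nil /= /mon !big_cons !big_nil /letter_val /=.
have p0 := @pi_gt0 R.
apply/eqP; rewrite eq_complex !(ReD, ImD, ReM, ImM) /=; apply/andP; split; apply/eqP.
  by move: (pi : R) p0 => q q0; field; rewrite gt_eqF.
ring.
Qed.

Lemma energy_poly_freq0 n : freq_part letter_freq (energy_poly n) = [seq (0, u.2) | u <- energy_poly n].
Proof.
rewrite /freq_part /energy_poly -!map_comp; apply: eq_map => j /=.
by rewrite /freq big_cons big_nil /letter_freq /=; congr pair; ring.
Qed.

(** The two coefficients feeding a letter sum to at most [2 * c]. *)
Lemma letter_flow_bound (c : R) a b l : (forall j, 0 <= lam j <= c) ->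
  \sum_(t <- letter_flow l) `|t.1| * letter_amp a b t.2 <= 2 * c * letter_amp a b l.
Proof.
move=> hc; have p0 := letter_amp_ge0 a b l.
have /andP[l0 lc] := hc l.2.
have h := ler_wpM2r p0 lc.
have l2 : 0 <= lam l.2 / 2 by rewrite divr_ge0.
have q0 := mulr_ge0 l0 p0.
by case: l p0 l0 lc h l2 q0 => -[[]|] j; rewrite /letter_flow /letter_amp /= => p0 l0 lc h l2 q0;
  rewrite !big_cons big_nil /= ?normrN ?(ger0_norm l0) ?(ger0_norm l2); lra.
Qed.

(* The frequency is bounded below by signs (pos, neg), by a triple gap (tri) or by a pair gap (eq); in the last case equal modes give a real monomial. *)
Local Ltac pos := right; rewrite ler_normr; apply/orP; left; lra.
Local Ltac neg := right; rewrite ler_normr; apply/orP; right; lra.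
Local Ltac tri_pos H := right; move: H; rewrite !ler_normr => /orP[H|H];
  apply/orP; [left; lra|right; lra].
Local Ltac tri_neg H := right; move: H; rewrite !ler_normr => /orP[H|H];
  apply/orP; [right; lra|left; lra].
Local Ltac eq_pos H := case: H => [<-|[H|H]]; [left; split; ring|pos|neg].
Local Ltac eq_neg H := case: H => [<-|[H|H]]; [left; split; ring|neg|pos].

Section Gaps.
Hypotheses (hm1 : - (1 / 2) <= m) (hm2 : m <= 1).

Lemma om_pair i j : (0 < i)%N -> (0 < j)%N ->
  i = j \/ (3 / 2 <= om i - om j \/ 3 / 2 <= om j - om i).
Proof.
move=> i0 j0; case: (ltngtP i j) => [ij|ij|->]; [right; right|right; left|by left].
- exact: omega_gap2.
- exact: omega_gap2.
Qed.

(** The frequency of a quadratic monomial is [0], [2 om i] or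
    [2 (om i - om j)] or [2 (om i + om j)] up to sign; for [i = j] the
    difference comes from the monomial [`|psi| ^ 4], which is real. *)
Lemma quadratic_gap a b (mu : R) l : mu <= 2 * Num.sqrt (1 + m) -> size l = 2%N ->
  all good_letter l -> gap letter_freq (letter_val a b) mu l.
Proof.
move=> hmu; case: l => [|[s i] [|[s' j] []]]//= _ /and3P[i0 j0 _].
rewrite /good_letter /= in i0 j0.
have oi := omega_ge1 hm1 hm2 i0; have oj := omega_ge1 hm1 hm2 j0.
have /andP[q1 q2] := sqrt1m_bounds hm1 hm2.
have pr := om_pair i0 j0.
rewrite /gap /freq /mon !big_cons !big_nil /letter_freq /=.
case: s => [[]|]; case: s' => [[]|]; rewrite /letter_phase /letter_val /=.
- pos.
- eq_pos pr.
- pos.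
- eq_neg pr.
- neg.
- neg.
- pos.
- neg.
- by left; split; ring.
Qed.

(** Frequencies combining three modes reduce to [omega_gap3] when the signs
    differ; with fewer rotating letters the quadratic gaps, which are of order
    one, apply. *)
Lemma cubic_gap a b l : size l = 3%N ->
  all good_letter l -> gap letter_freq (letter_val a b) (`|m| / 2) l.
Proof.
case: l => [|[s1 i] [|[s2 j] [|[s3 k] []]]]//= _ /and4P[i0 j0 k0 _].
rewrite /good_letter /= in i0 j0 k0.
have /andP[q _] := sqrt1m_bounds hm1 hm2.
have oi := le_trans q (omega_ge1 hm1 hm2 i0).
have oj := le_trans q (omega_ge1 hm1 hm2 j0).
have ok := le_trans q (omega_ge1 hm1 hm2 k0).
have am : `|m| <= 1 by rewrite ler_norml; move: hm1 hm2 => *; lra.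
have pij := om_pair i0 j0; have pik := om_pair i0 k0; have pjk := om_pair j0 k0.
have ti := omega_gap3 hm1 hm2 i0 j0 k0.
have tj := omega_gap3 hm1 hm2 j0 i0 k0.
have tk := omega_gap3 hm1 hm2 k0 i0 j0.
clear q hm1 hm2.
rewrite /gap /freq /mon !big_cons !big_nil /letter_freq /=.
case: s1 => [[]|]; case: s2 => [[]|]; case: s3 => [[]|]; rewrite /letter_phase /letter_val /=.
- pos.
- tri_neg tk.
- pos.
- tri_neg tj.
- tri_pos ti.
- eq_pos pij.
- pos.
- eq_pos pik.
- pos.
- tri_neg ti.
- tri_pos tj.
- eq_neg pij.
- tri_pos tk.
- neg.
- neg.
- eq_neg pik.
- neg.
- neg.
- pos.
- eq_pos pjk.
- pos.
- eq_neg pjk.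
- neg.
- neg.
- pos.
- neg.
- by left; split; ring.
Qed.

End Gaps.
End Modes.

(** * The corrected energy *)

Section RealInduction.
Context {R : realType}.

(** Continuity method: the largest time up to which the weak bound [K'] holds
    cannot be interior, since there the strict improvement [K] is available. *)
Lemma bootstrap (f : R -> R) (T K K' : R) : 0 <= T -> K < K' ->
  (forall t, 0 <= t <= T -> {for t, continuous f}) ->
  (forall t, 0 <= t <= T -> (forall s, 0 <= s <= t -> f s <= K') -> f t <= K) ->
  f 0 <= K' -> f T <= K.
Proof.
move=> T0 KK fc step f0.
pose E := [set t | 0 <= t <= T /\ forall s, 0 <= s <= t -> f s <= K'].
have E0 : E 0.
  split; first by rewrite lexx.
  by move=> s s0; have -> : s = 0 by lra.
have hE : has_sup E by split; [exists 0|exists T => t [/andP[]]].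
pose tau := sup E.
have tau0 : 0 <= tau by exact: ub_le_sup hE.2 _ E0.
have tauT : tau <= T by apply: ge_sup; [exists 0|move=> t [/andP[]]].
have below s : 0 <= s -> s < tau -> f s <= K'.
  move=> s0 st.
  have [|t [tT ht] st'] := @sup_adherent R E (tau - s) _ hE; first by rewrite subr_gt0.
  by apply: ht; rewrite s0/= ltW//; move: st'; rewrite -/tau; lra.
have ftau : f tau <= K'.
  have [tau_gt0|] := ltP 0 tau; last by move=> h; have -> : tau = 0 by lra.
  rewrite leNgt; apply/negP => h.
  have fct : {for tau, continuous f} by apply: fc; rewrite tau0.
  have d0 : 0 < f tau - K' by rewrite subr_gt0.
  have /cvgrPdist_lt/(_ _ d0)/nbhs_ballP[d /= dp hd] := fct.
  pose s := tau - Num.min d tau / 2.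
  have mp : 0 < Num.min d tau by rewrite lt_min dp tau_gt0.
  have md : Num.min d tau <= d by rewrite ge_min lexx.
  have mt : Num.min d tau <= tau by rewrite ge_min lexx orbT.
  have h1 : ball tau d s by rewrite /ball /= /s opprB addrCA subrr addr0 ger0_norm; lra.
  have := hd _ h1; rewrite ltr_norml => /andP[_ h2].
  have : f s <= K' by apply: below; rewrite /s; lra.
  lra.
have allt s : 0 <= s <= tau -> f s <= K'.
  move=> /andP[s0]; rewrite le_eqVlt => /predU1P[->//|]; exact: below.
have ftau' : f tau <= K by apply: step => //; rewrite tau0.
have [tT|] := ltP tau T; last by move=> h; have <- : tau = T by lra.
have fct : {for tau, continuous f} by apply: fc; rewrite tau0.
have d0 : 0 < K' - f tau by lra.
have /cvgrPdist_lt/(_ _ d0)/nbhs_ballP[d /= dp hd] := fct.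
pose s := tau + Num.min d (T - tau) / 2.
have mp : 0 < Num.min d (T - tau) by rewrite lt_min dp subr_gt0.
have md : Num.min d (T - tau) <= d by rewrite ge_min lexx.
have mt : Num.min d (T - tau) <= T - tau by rewrite ge_min lexx orbT.
have Es : E s.
  split; first by rewrite /s; apply/andP; split; lra.
  move=> x /andP[x0 xs]; have [xt|xt] := leP x tau; first by apply: allt; rewrite x0.
  have h1 : ball tau d x.
    by rewrite /ball /= distrC ger0_norm; move: xs; rewrite /s; lra.
  have := hd _ h1; rewrite ltr_norml; lra.
have : s <= tau by exact: ub_le_sup hE.2 _ Es.
rewrite /s; lra.
Qed.

End RealInduction.

Section Stability.
Context {R : realType}.
Local Notation C := (complex R).
Local Notation toC := (real_complex R).
Local Notation iC := (Complex (0 : R) 1).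

(** The equations of motion of one mode, in the variables [a = j u_j] and
    [b = j u_j' / omega_j] that make the norm of [H^1] a sum of squares. *)
Definition mode_ode (m : R) (a b : R -> nat -> R) (kap : R -> R) (t : R) : Prop :=
  forall j, is_derive t 1 (a^~ j) (omega m j * b t j) /\
    is_derive t 1 (b^~ j) (- (omega m j * a t j) - kap t * lam m j * a t j).

(** The letters satisfy the hypothesis of the normal form. *)
Lemma letter_val_flow (m : R) a b kap t : mode_ode m a b kap t -> forall l,
  is_cderive ((fun s => letter_val (a s) (b s))^~ l) t
   (iC * (toC (kap t) * (\sum_(s <- letter_flow m l) toC s.1 * letter_val (a t) (b t) s.2)
      - toC (letter_freq m l) * letter_val (a t) (b t) l)).
Proof.
move=> h [s j]; have [da db] := h j.
rewrite /letter_flow /letter_freq /letter_val /=.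
case: s => [[]|] /=; rewrite !big_cons big_nil /=; split => /=.
- by apply: drv_eq (drvB (drvM da da) (drvM db db)) _; ring.
- by apply: drv_eq (drvM (drvZ 2 da) db) _; ring.
- by apply: drv_eq (drvB (drvM da da) (drvM db db)) _; ring.
- by apply: drv_eq (drvN (drvM (drvZ 2 da) db)) _; ring.
- by apply: drv_eq (drvD (drvM da da) (drvM db db)) _; field.
- by apply: drv_eq (drvC 0 t) _; ring.
Qed.

Definition mode_energy (a b : R -> nat -> R) (n : nat) (t : R) : R :=
  psum (fun j => a t j ^+ 2 + b t j ^+ 2) n.

Lemma mode_energy_ge0 a b n t : 0 <= mode_energy a b n t.
Proof. by rewrite sumr_ge0// => j _; rewrite addr_ge0 ?sqr_ge0. Qed.

Definition corrected_energy (m : R) (a b : R -> nat -> R) (n : nat) (t : R) : R :=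
  complex.Re (ev (letter_val (a t) (b t)) (energy_poly n)) +
  complex.Re (ev (letter_val (a t) (b t)) (corrector2 (letter_freq m) (letter_flow m) (kirchhoff_poly n) (energy_poly n))) +
  complex.Re (ev (letter_val (a t) (b t)) (corrector3 (letter_freq m) (letter_flow m) (kirchhoff_poly n) (energy_poly n))).

Variables (m c mu : R).
Hypotheses (hm1 : - (1 / 2) <= m) (hm2 : m <= 1) (hm0 : m != 0).
Hypotheses (mu0 : 0 < mu) (hmu : mu <= 2 * Num.sqrt (1 + m)).
Hypotheses (c0 : 0 < c) (hc : forall j, 0 <= lam m j <= c).

Section Pointwise.
Variables (a b : R -> nat -> R) (n : nat) (t : R).
Let S := mode_energy a b n t.
Let p := letter_amp (a t) (b t).
Let W := @kirchhoff_poly R n.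
Let B1 := @energy_poly R n.
Let B2 := corrector2 (letter_freq m) (letter_flow m) W B1.
Let B3 := corrector3 (letter_freq m) (letter_flow m) W B1.
Let D B := nonlin_part (letter_flow m) B.

Let p0 l : 0 <= p l. Proof. exact: letter_amp_ge0. Qed.
Let S0 : 0 <= S. Proof. exact: mode_energy_ge0. Qed.
Let m_gt0 : 0 < `|m|. Proof. by rewrite normr_gt0. Qed.
Let sb l := @letter_flow_bound R m c (a t) (b t) l hc.

Let hA2 : homog good_letter 2 (mulp W (D B1)).
Proof. by apply: (homog_mulp (homog_kirchhoff n)); apply: homog_nonlin_part (@good_letter_flow R m) _ _ (homog_energy n). Qed.

Let hB2 : homog good_letter 2 B2. Proof. exact: homog_homological_inv. Qed.

Let hA3 : homog good_letter 3 (mulp W (D B2)).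
Proof. by apply: (homog_mulp (homog_kirchhoff n)); apply: homog_nonlin_part (@good_letter_flow R m) _ _ hB2. Qed.

Let hB3 : homog good_letter 3 B3. Proof. exact: homog_homological_inv. Qed.

Let gapA2 u : u \in mulp W (D B1) -> gap (letter_freq m) (letter_val (a t) (b t)) mu u.2.
Proof. by move/allP: hA2 => /(_ u) + hu => /(_ hu) /andP[/eqP]; exact: quadratic_gap. Qed.

Let gapA3 u : u \in mulp W (D B2) -> gap (letter_freq m) (letter_val (a t) (b t)) (`|m| / 2) u.2.
Proof. by move/allP: hA3 => /(_ u) + hu => /(_ hu) /andP[/eqP]; exact: cubic_gap. Qed.

Let majW : 0 <= maj p W <= S / 4.
Proof.
rewrite maj_ge0//= /p maj_kirchhoff -[X in _ * X]/S mulrC ler_wpM2l//.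
have := @pi_ge2 R; move: (pi : R) => q h.
by rewrite lef_pV2 ?posrE; lra.
Qed.

Let m2 : 0 < `|m| / 2. Proof. by rewrite divr_gt0. Qed.

Let majD1 : maj p (D B1) <= 2 * c * S.
Proof.
have := maj_nonlin_part p0 sb (homog_size (homog_energy n)).
by rewrite maj_energy mulr1; exact.
Qed.

Let majB2 : maj p B2 <= c * S ^+ 2 / (2 * mu).
Proof.
apply: le_trans (maj_homological_inv mu0 p0 gapA2) _; rewrite maj_mulp.
have /andP[w0 w1] := majW.
have h := ler_pM w0 (maj_ge0 (D B1) p0) w1 majD1.
apply: (@le_trans _ _ (S / 4 * (2 * c * S) / mu)).
  by apply: ler_wpM2r => //; rewrite invr_ge0 ltW.
by apply: le_of_eq; field; rewrite gt_eqF.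
Qed.

Let majD2 : maj p (D B2) <= 2 * c ^+ 2 * S ^+ 2 / mu.
Proof.
have h := maj_nonlin_part p0 sb (homog_size hB2).
apply: le_trans h _.
apply: (@le_trans _ _ (2 * c * 2 * (c * S ^+ 2 / (2 * mu)))).
  by apply: ler_wpM2l majB2; rewrite !mulr_ge0// ltW.
by apply: le_of_eq; field; rewrite gt_eqF.
Qed.

Let majB3 : maj p B3 <= c ^+ 2 * S ^+ 3 / (mu * `|m|).
Proof.
apply: le_trans (maj_homological_inv m2 p0 gapA3) _; rewrite maj_mulp.
have /andP[w0 w1] := majW.
have h := ler_pM w0 (maj_ge0 (D B2) p0) w1 majD2.
apply: (@le_trans _ _ (S / 4 * (2 * c ^+ 2 * S ^+ 2 / mu) / (`|m| / 2))).
  by apply: ler_wpM2r => //; rewrite invr_ge0 ltW.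
by apply: le_of_eq; field; rewrite !gt_eqF.
Qed.

Let majD3 : maj p (D B3) <= 6 * c ^+ 3 * S ^+ 3 / (mu * `|m|).
Proof.
apply: le_trans (maj_nonlin_part p0 sb (homog_size hB3)) _.
apply: (@le_trans _ _ (2 * c * 3 * (c ^+ 2 * S ^+ 3 / (mu * `|m|)))).
  by apply: ler_wpM2l majB3; rewrite !mulr_ge0// ltW.
by apply: le_of_eq; field; rewrite !gt_eqF.
Qed.

(** The correctors are of second and third order in the energy, so that for
    small energy the correction is relatively small. *)
Lemma corrected_energy_close : `|corrected_energy m a b n t - S| <=
  c * S ^+ 2 / (2 * mu) + c ^+ 2 * S ^+ 3 / (mu * `|m|).
Proof.
have e (x y z : R) : x + y + z - x = y + z by ring.
rewrite /corrected_energy (_ : complex.Re (ev _ (energy_poly n)) = S) ?e; last exact: Re_ev_energy.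
apply: le_trans (ler_normD _ _) _; apply: lerD.
  apply: le_trans (normc_ge_absRe _) (le_trans _ majB2).
  by apply: normc_ev => l; exact: normc_letter_val.
apply: le_trans (normc_ge_absRe _) (le_trans _ majB3).
by apply: normc_ev => l; exact: normc_letter_val.
Qed.

(** The derivative is of fourth order in the energy [S], up to the remainder
    [r] of the modes from [n] on.  The fourth order is what produces a time scale
    of the inverse third power of the energy. *)
Lemma corrected_energy_derive (kap : R -> R) (r : R) : mode_ode m a b kap t ->
  kap t = (2 * pi)^-1 * psum (fun j => a t j ^+ 2) n + r -> 0 <= r ->
  exists d, is_derive t 1 (corrected_energy m a b n) d /\
   `|d| <= r * (2 * c * S + 2 * c ^+ 2 * S ^+ 2 / mu) +
           (S / 4 + r) * (6 * c ^+ 3 * S ^+ 3 / (mu * `|m|)).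
Proof.
move=> ode kapE r0.
have kapE' : kap t = complex.Re (ev (letter_val (a t) (b t)) W) + r by rewrite ev_kirchhoff.
have ImW : complex.Im (ev (letter_val (a t) (b t)) W) = 0 by rewrite ev_kirchhoff.
have d := is_derive_normal_form (letter_val_flow ode) kapE' ImW mu0 m2 gapA2 gapA3 (energy_poly_freq0 m n).
eexists; split; first exact: d.
have imb B : `|complex.Im (ev (letter_val (a t) (b t)) B)| <= maj p B.
  by apply: le_trans (normc_ge_absIm _) _; apply: normc_ev => l; exact: normc_letter_val.
have h1 := le_trans (imb (D B1)) majD1.
have h2 := le_trans (imb (D B2)) majD2.
have h3 := le_trans (imb (D B3)) majD3.
have /andP[w0 w1] := majW.
have k0 : 0 <= kap t <= S / 4 + r.
  rewrite kapE'; apply/andP; split.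
    rewrite ev_kirchhoff /= addr_ge0// mulr_ge0//.
      by rewrite invr_ge0 mulr_ge0 ?pi_ge0.
    by rewrite sumr_ge0// => j _; exact: sqr_ge0.
  rewrite lerD2r; apply: le_trans w1; apply: le_trans (ler_norm _) _.
  apply: le_trans (normc_ge_absRe _) _; apply: normc_ev => l; exact: normc_letter_val.
apply: le_trans (ler_normB _ _) _; apply: lerD.
  rewrite normrM normrN (ger0_norm r0); apply: ler_wpM2l => //.
  exact: le_trans (ler_normD _ _) (lerD h1 h2).
case/andP: k0 => k0 k1; rewrite normrM (ger0_norm k0); exact: ler_pM.
Qed.

End Pointwise.
End Stability.

(** * Energy bound for finitely many modes *)

Section FiniteStability.
Context {R : realType}.
Variables (m c mu : R).
Hypotheses (hm1 : - (1 / 2) <= m) (hm2 : m <= 1) (hm0 : m != 0).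
Hypotheses (mu0 : 0 < mu) (hmu : mu <= 2 * Num.sqrt (1 + m)).
Hypotheses (c0 : 0 < c) (c2 : c <= 2) (hc : forall j, 0 <= lam m j <= c).

Let m_gt0 : 0 < `|m|. Proof. by rewrite normr_gt0. Qed.

Variable e2 : R.
Hypotheses (e0 : 0 < e2) (e1 : e2 <= 64 / 10000 * mu)
  (e4 : e2 ^+ 2 <= `|m| * mu / (3222 * c ^+ 2)).

(** With the smallness of [e2] the two corrections are at most
    [192 / 10000] and [9 / 3222] of the energy. *)
Lemma corrected_energy_close_rel a b n (t : R) : mode_energy a b n t <= 3 * e2 ->
  `|corrected_energy m a b n t - mode_energy a b n t| <= 22 / 1000 * mode_energy a b n t.
Proof.
move=> S3; have S0 := mode_energy_ge0 a b n t.
apply: le_trans (corrected_energy_close hm1 hm2 hm0 mu0 hmu c0 hc a b n t) _.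
move: (mode_energy a b n t) S0 S3 => S S0 S3.
have h1 : c * S / mu <= 384 / 10000.
  rewrite ler_pdivrMr//; apply: (@le_trans _ _ (2 * (3 * e2))).
    by apply: ler_pM => //; exact: ltW.
  have e1' := e1; lra.
have h2 : c ^+ 2 * S ^+ 2 / (mu * `|m|) <= 9 / 3222.
  rewrite ler_pdivrMr ?mulr_gt0//.
  have : S ^+ 2 <= 9 * e2 ^+ 2.
    rewrite (_ : 9 * e2 ^+ 2 = (3 * e2) ^+ 2); last by ring.
    by rewrite ler_sqr ?nnegrE// mulr_ge0// ltW.
  have c20 : 0 < c ^+ 2 by rewrite exprn_gt0.
  have p0 : 0 < 3222 * c ^+ 2 by apply: mulr_gt0 c20; rewrite ltr0n.
  move: e4; rewrite (ler_pdivlMr _ _ p0) => h h'.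
  have h3 := ler_wpM2l (ltW c20) h'.
  apply: le_trans h3 _; rewrite [mu * _]mulrC; move: h.
  move: (`|m| * mu) (c ^+ 2) (e2 ^+ 2) => x y z h; lra.
have -> : c * S ^+ 2 / (2 * mu) + c ^+ 2 * S ^+ 3 / (mu * `|m|) =
   (c * S / mu / 2 + c ^+ 2 * S ^+ 2 / (mu * `|m|)) * S.
  by field; rewrite !gt_eqF.
by apply: ler_wpM2r => //; lra.
Qed.

(** The modes from [n] on enter through the remainder [r] of the Kirchhoff
    term.  Under the weak bound [3 * e2] the corrected energy moves by at most [469 / 10000 * e2] on the
    whole interval, of which [243 / 6595 * e2] comes from the fourth order
    terms; since the correction changes the energy by [22 / 1000] at most, the
    energy stays below [11 / 5 * e2] and [bootstrap] closes. *)
Lemma finite_stability (a b : R -> nat -> R) (kap r : R -> R) (rho T : R) n :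
  0 <= T -> T * e2 ^+ 3 <= 2 * (`|m| * mu / (6595 * c ^+ 3)) ->
  (forall t, 0 <= t <= T -> mode_ode m a b kap t) ->
  (forall t, 0 <= t <= T -> mode_energy a b n t <= 3 * e2 ->
    kap t = (2 * pi)^-1 * psum (fun j => a t j ^+ 2) n + r t) ->
  (forall t, 0 <= t <= T -> 0 <= r t <= rho) ->
  rho * (T * (6 * c * e2 + 18 * c ^+ 2 * e2 ^+ 2 / mu +
              162 * c ^+ 3 * e2 ^+ 3 / (mu * `|m|))) <= e2 / 100 ->
  mode_energy a b n 0 <= 2 * e2 ->
  mode_energy a b n T <= 11 / 5 * e2.
Proof.
move=> T0 hT ode kapE rb rhoK S0.
have dE (t : R) : 0 <= t <= T -> exists d, is_derive t 1 (mode_energy a b n) d.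
  move=> /ode h; eexists.
  apply: (@drv_sum R _ _ (fun j s => a s j ^+ 2 + b s j ^+ 2)) => j.
  have [da db] := h j.
  exact: drvD (drvM da da) (drvM db db).
apply: (@bootstrap R (mode_energy a b n) T (11 / 5 * e2) (3 * e2)) => //.
- by have e0' := e0; lra.
- by move=> t /dE[d]; exact: is_derive_continuous.
- move=> t /andP[t0 tT] St.
  have inT s : 0 <= s <= t -> 0 <= s <= T by move=> /andP[-> st]; exact: le_trans st tT.
  pose K := 6 * c * e2 + 18 * c ^+ 2 * e2 ^+ 2 / mu + 162 * c ^+ 3 * e2 ^+ 3 / (mu * `|m|).
  pose D := rho * K + 3 * e2 / 4 * (162 * c ^+ 3 * e2 ^+ 3 / (mu * `|m|)).
  have dF s : 0 <= s <= t -> exists d, is_derive s 1 (corrected_energy m a b n) d /\ `|d| <= D.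
    move=> st; have Ss := St s st; have sT := inT s st.
    have /andP[r0 r1] := rb s sT.
    have [d [hd dD]] := corrected_energy_derive hm1 hm2 hm0 mu0 hmu c0 hc (ode s sT) (kapE s sT Ss) r0.
    exists d; split => //; apply: le_trans dD _.
    have s0 := mode_energy_ge0 a b n s.
    move: (mode_energy a b n s) s0 Ss => S s0 Ss.
    have e30 : 0 <= 3 * e2 by rewrite mulr_ge0// ltW.
    have S2 : S ^+ 2 <= 9 * e2 ^+ 2.
      by rewrite (_ : 9 * e2 ^+ 2 = (3 * e2) ^+ 2); [rewrite ler_sqr|ring].
    have S3 : S ^+ 3 <= 27 * e2 ^+ 3.
      by rewrite (_ : 27 * e2 ^+ 3 = (3 * e2) ^+ 3); [apply: lerXn2r|ring].
    have k1 : 2 * c * S <= 6 * c * e2.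
      by rewrite (_ : 6 * c * e2 = 2 * c * (3 * e2)); [apply: ler_wpM2l => //; rewrite mulr_ge0// ltW|ring].
    have k2 : 2 * c ^+ 2 * S ^+ 2 / mu <= 18 * c ^+ 2 * e2 ^+ 2 / mu.
      apply: ler_wpM2r; first by rewrite invr_ge0 ltW.
      rewrite (_ : 18 * _ * _ = 2 * c ^+ 2 * (9 * e2 ^+ 2)); last by ring.
      by apply: ler_wpM2l => //; rewrite mulr_ge0// exprn_ge0// ltW.
    have k3 : 6 * c ^+ 3 * S ^+ 3 / (mu * `|m|) <= 162 * c ^+ 3 * e2 ^+ 3 / (mu * `|m|).
      apply: ler_wpM2r; first by rewrite invr_ge0 mulr_ge0// ltW.
      rewrite (_ : 162 * _ * _ = 6 * c ^+ 3 * (27 * e2 ^+ 3)); last by ring.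
      by apply: ler_wpM2l => //; rewrite mulr_ge0// exprn_ge0// ltW.
    have q3 : 0 <= 6 * c ^+ 3 * S ^+ 3 / (mu * `|m|).
      by rewrite divr_ge0// ?mulr_ge0// ?exprn_ge0// ltW.
    have q2 : 0 <= 2 * c ^+ 2 * S ^+ 2 / mu.
      by rewrite divr_ge0// ?mulr_ge0// ?exprn_ge0// ltW.
    have q1 : 0 <= 2 * c * S by rewrite !mulr_ge0// ltW.
    rewrite /D /K.
    move: (2 * c * S) (2 * c ^+ 2 * S ^+ 2 / mu) (6 * c ^+ 3 * S ^+ 3 / (mu * `|m|))
      (6 * c * e2) (18 * c ^+ 2 * e2 ^+ 2 / mu) (162 * c ^+ 3 * e2 ^+ 3 / (mu * `|m|)) k1 k2 k3 q1 q2 q3.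
    move=> x1 x2 x3 y1 y2 y3 k1 k2 k3 q1 q2 q3.
    have hA : r s * (x1 + x2 + x3) <= rho * (y1 + y2 + y3).
      by apply: ler_pM => //; [rewrite !addr_ge0|rewrite !lerD].
    have hB : S / 4 * x3 <= 3 * e2 / 4 * y3.
      by apply: ler_pM => //; [exact: divr_ge0|rewrite ler_wpM2r// invr_ge0].
    apply: le_trans (lerD hA hB).
    by apply: le_of_eq; ring.
  pose dFf (s : R) := get [set d : R | is_derive s 1 (corrected_energy m a b n) d /\ `|d| <= D].
  have dFP s : 0 <= s <= t -> is_derive s 1 (corrected_energy m a b n) (dFf s) /\ `|dFf s| <= D.
    by move=> /dF; exact: getPex.
  have [|z [zT]] := @mvt_seg R (corrected_energy m a b n) dFf 0 t t0.
    by move=> s /dFP[].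
  rewrite subr0 => Fe.
  have Fb : `|corrected_energy m a b n t - corrected_energy m a b n 0| <= 469 / 10000 * e2.
    rewrite Fe normrM (ger0_norm t0).
    apply: le_trans (ler_wpM2r t0 (dFP z zT).2) _.
    have D0 : 0 <= D by exact: le_trans (normr_ge0 _) (dFP z zT).2.
    apply: le_trans (ler_wpM2l D0 tT) _.
    have c30 : 0 < c ^+ 3 by rewrite exprn_gt0.
    have h1 : 3 * e2 / 4 * (162 * c ^+ 3 * e2 ^+ 3 / (mu * `|m|)) * T <= 243 / 6595 * e2.
      have -> : 3 * e2 / 4 * (162 * c ^+ 3 * e2 ^+ 3 / (mu * `|m|)) * T =
        T * e2 ^+ 3 * (243 / 2 * c ^+ 3 * e2 / (mu * `|m|)).
        by field; rewrite !gt_eqF.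
      have -> : 243 / 6595 * e2 = 2 * (`|m| * mu / (6595 * c ^+ 3)) * (243 / 2 * c ^+ 3 * e2 / (mu * `|m|)).
        by field; rewrite !gt_eqF.
      have h243 : 0 <= 243 / 2 :> R by exact: divr_ge0 (ler0n _ 243) (ler0n _ 2).
      apply: ler_wpM2r hT.
      exact: divr_ge0 (mulr_ge0 (mulr_ge0 h243 (ltW c30)) (ltW e0)) (mulr_ge0 (ltW mu0) (ltW m_gt0)).
    rewrite /D mulrDl; have e0' := e0.
    have : rho * K * T <= e2 / 100 by rewrite -mulrA [K * T]mulrC.
    by move: h1; lra.
  have St0 : mode_energy a b n t <= 3 * e2 by apply: St; rewrite t0 lexx.
  have c1 := corrected_energy_close_rel St0.
  have S03 : mode_energy a b n 0 <= 3 * e2.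
    by apply: le_trans S0 _; apply: ler_wpM2r; [exact: ltW|rewrite ler_nat].
  have c3 := corrected_energy_close_rel S03.
  move: c1 c3 Fb; rewrite !ler_norml; have := mode_energy_ge0 a b n 0; have e0' := e0; lra.
- by have e0' := e0; lra.
Qed.

End FiniteStability.

(** * Energy bound for all modes *)

Section InfiniteStability.
Context {R : realType}.
Implicit Types (a b : R -> nat -> R) (kap : R -> R).

Lemma inv2pi_le : (2 * pi)^-1 <= 4^-1 :> R.
Proof. by have := @pi_ge2 R; move: (pi : R) => q h; rewrite lef_pV2 ?posrE; lra. Qed.

(** Each mode is a linear oscillator, so that its amplitude grows at most
    exponentially, at a rate that does not involve its frequency. *)
Lemma mode_growth (m c M : R) a b kap (T : R) j : 0 <= T ->
  (forall i, 0 <= lam m i <= c) ->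
  (forall t, 0 <= t <= T -> mode_ode m a b kap t) ->
  (forall t, 0 <= t <= T -> 0 <= kap t <= M) ->
  a T j ^+ 2 + b T j ^+ 2 <= (a 0 j ^+ 2 + b 0 j ^+ 2) * expR (c * M * T).
Proof.
move=> T0 hc ode kM.
pose P t := a t j ^+ 2 + b t j ^+ 2.
pose dP t := - (2 * kap t * lam m j * (a t j * b t j)).
have dPP t : 0 <= t <= T -> is_derive t 1 P (dP t).
  move=> /ode /(_ j) [da db].
  by apply: drv_eq (drvD (drvM da da) (drvM db db)) _; rewrite /dP; ring.
pose z t := P t * expR (- (c * M) * t).
pose dz t := dP t * expR (- (c * M) * t) + P t * (- (c * M) * expR (- (c * M) * t)).
have dzz t : 0 <= t <= T -> is_derive t 1 z (dz t).
  move=> /dPP h; apply: drvM h _; rewrite [X in is_derive _ _ _ X]mulrC.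
  apply: (@drv_comp R expR (fun s => - (c * M) * s)).
  exact: drv_eq (drvZ _ (drv_id t)) (mulr1 _).
have [x [xT]] := @mvt_seg R z dz 0 T T0 dzz.
rewrite subr0 => e.
have dz0 : dz x <= 0.
  rewrite /dz mulrA -mulrDl; apply: mulr_le0_ge0; last exact: expR_ge0.
  have /andP[k0 k1] := kM x xT; have /andP[l0 l1] := hc j.
  have kl : 0 <= kap x * lam m j <= c * M.
    by rewrite mulr_ge0//= mulrC; apply: ler_pM.
  case/andP: kl => kl0 kl1; rewrite /dP /P.
  have P0 : 0 <= a x j ^+ 2 + b x j ^+ 2 by rewrite addr_ge0 ?sqr_ge0.
  have h1 := ler_wpM2r P0 kl1.
  have h2 : 0 <= kap x * lam m j * (a x j + b x j) ^+ 2 by rewrite mulr_ge0 ?sqr_ge0.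
  rewrite [X in X <= 0](_ : _ = kap x * lam m j * (a x j ^+ 2 + b x j ^+ 2)
    - c * M * (a x j ^+ 2 + b x j ^+ 2) - kap x * lam m j * (a x j + b x j) ^+ 2); last by ring.
  by rewrite -addrA -opprD subr_le0; apply: (le_trans h1); rewrite lerDl.
have zT : z T <= z 0.
  rewrite -subr_le0 e; exact: mulr_le0_ge0.
move: zT; rewrite /z mulr0 expR0 mulr1 mulNr expRN.
by rewrite ler_pdivrMr ?expR_gt0.
Qed.

Definition between0 (T t : R) : Prop := 0 <= t <= T \/ T <= t <= 0.

Section Data.
Variables (m c mu e2 : R).
Hypotheses (hm1 : - (1 / 2) <= m) (hm2 : m <= 1) (hm0 : m != 0).
Hypotheses (mu0 : 0 < mu) (hmu : mu <= 2 * Num.sqrt (1 + m)).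
Hypotheses (c0 : 0 < c) (c2 : c <= 2) (hc : forall j, 0 <= lam m j <= c).
Hypotheses (e0 : 0 < e2) (e1 : e2 <= 64 / 10000 * mu)
  (e4 : e2 ^+ 2 <= `|m| * mu / (3222 * c ^+ 2)).

(** Exponential growth bounds the tail of the Kirchhoff term uniformly on
    the interval by a tail of the initial data, so that the finite statement
    applies to sufficiently many modes. *)
Lemma stability_forward a b kap (M T : R) n : 0 <= T ->
  T * e2 ^+ 3 <= 2 * (`|m| * mu / (6595 * c ^+ 3)) ->
  (forall t, 0 <= t <= T -> mode_ode m a b kap t) ->
  (forall t, 0 <= t <= T -> 0 <= kap t <= M) ->
  (forall t, 0 <= t <= T ->
    (2 * pi)^-1 * tsum (fun j => a t j ^+ 2) <= e2 ->
    kap t = (2 * pi)^-1 * tsum (fun j => a t j ^+ 2)) ->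
  (forall k, mode_energy a b k 0 <= 2 * e2) ->
  mode_energy a b n T <= 11 / 5 * e2.
Proof.
move=> T0 hT ode kM kapE init.
pose K := 6 * c * e2 + 18 * c ^+ 2 * e2 ^+ 2 / mu + 162 * c ^+ 3 * e2 ^+ 3 / (mu * `|m|).
have m_gt0 : 0 < `|m| by rewrite normr_gt0.
have K0 : 0 <= K.
  by rewrite /K !addr_ge0// ?divr_ge0 ?mulr_ge0 ?exprn_ge0 ?ltW.
have TK : 0 < 1 + T * K by rewrite ltr_pwDl// mulr_ge0.
(* a remainder below delta keeps the error term of the finite bound under e2 / 100 *)
pose delta := Num.min e2 (e2 / (100 * (1 + T * K))).
have d0 : 0 < delta by rewrite lt_min e0 divr_gt0// mulr_gt0.
have M0 : 0 <= M by have /andP[h1 h2] := kM 0 (introT andP (conj (lexx 0) T0)); exact: le_trans h2.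
have cM0 : 0 <= c * M by rewrite mulr_ge0// ltW.
pose P0 j := a 0 j ^+ 2 + b 0 j ^+ 2.
have P00 j : 0 <= P0 j by rewrite addr_ge0 ?sqr_ge0.
pose EE := expR (c * M * T).
have EE0 : 0 < EE by exact: expR_gt0.
have sP0 : abs_summable P0.
  exists (2 * e2) => k; apply: le_trans (init k).
  by apply: ler_sum => j _; rewrite ger0_norm.
have grow t j : 0 <= t <= T -> a t j ^+ 2 + b t j ^+ 2 <= P0 j * EE.
  move=> /andP[t0 tT].
  have sub s : 0 <= s <= t -> 0 <= s <= T by move=> /andP[-> st]; exact: le_trans st tT.
  apply: le_trans (mode_growth j t0 hc (fun s h => ode s (sub s h)) (fun s h => kM s (sub s h))) _.
  apply: (ler_wpM2l (P00 j)); rewrite /EE ler_expR; exact: (ler_wpM2l cM0 tT).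
have grow_a t j : 0 <= t <= T -> a t j ^+ 2 <= P0 j * EE.
  by move=> /(grow t j); apply: le_trans; rewrite lerDl sqr_ge0.
have [N [N0 hN]] := abs_summable_tail sP0 (divr_gt0 d0 EE0).
have sa t : 0 <= t <= T -> abs_summable (fun j => a t j ^+ 2).
  move=> tT; apply: abs_summable_le (abs_summableZ EE sP0) => j j0.
  by rewrite mulrC !ger0_norm ?sqr_ge0 ?mulr_ge0 ?(ltW EE0)//; exact: grow_a.
pose N' := maxn N n.
have NN : (N <= N')%N by exact: leq_maxl.
have N'0 : (0 < N')%N by exact: leq_trans NN.
have tail t : 0 <= t <= T ->
    0 <= tsum (fun j => a t j ^+ 2) - psum (fun j => a t j ^+ 2) N' <= delta.
  move=> tT; have sat := sa t tT.
  rewrite subr_ge0 psum_le_tsum//=; last by move=> j _; exact: sqr_ge0.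
  apply: le_trans (ler_norm _) _.
  apply: (@tsum_tail R _ (fun j => P0 j * EE) N') => //.
    by move=> j _; rewrite ger0_norm ?sqr_ge0// grow_a.
  move=> k; rewrite -mulr_suml -ler_pdivlMr//.
  apply: le_trans (hN k).
  have [kN|Nk] := leqP k N'; first by rewrite big_geq// sumr_ge0.
  rewrite [leRHS](big_cat_nat (n := N'))//=; last exact: ltnW.
  apply: le_trans (_ : \sum_(N' <= j < k) `|P0 j| <= _).
    by apply: ler_sum => j _; exact: ler_norm.
  by rewrite lerDr sumr_ge0.
have p0 : 0 < (2 * pi)^-1 :> R by rewrite invr_gt0 mulr_gt0 ?pi_gt0.
have p4 := inv2pi_le.
apply: (@le_trans _ _ (mode_energy a b N' T)).
  have nN : (n <= N')%N by exact: leq_maxr.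
  case: (n) nN => [|k] nN; first by rewrite [leLHS]/mode_energy /psum big_geq// mode_energy_ge0.
  rewrite /mode_energy (psum_tail _ (ltn0Sn k) nN) lerDl sumr_ge0// => j _.
  by rewrite addr_ge0 ?sqr_ge0.
pose r t := (2 * pi)^-1 * (tsum (fun j => a t j ^+ 2) - psum (fun j => a t j ^+ 2) N').
apply: (@finite_stability R m c mu hm1 hm2 hm0 mu0 hmu c0 c2 hc e2 e0 e1 e4 a b kap r (delta / 4) T N') => //.
- move=> t tT S3; have /andP[h1 h2] := tail t tT.
  rewrite (kapE t tT); first by rewrite /r; ring.
  have s3 : psum (fun j => a t j ^+ 2) N' <= 3 * e2.
    by apply: le_trans S3; apply: ler_sum => j _; rewrite lerDl sqr_ge0.
  have de : delta <= e2 by rewrite ge_min lexx.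
  have A0 : 0 <= tsum (fun j => a t j ^+ 2).
    by apply: tsum_ge0; [exact: sa|move=> j _; exact: sqr_ge0].
  apply: le_trans (ler_wpM2r A0 p4) _.
  clear -h2 s3 de; lra.
- move=> t tT; have /andP[h1 h2] := tail t tT; rewrite /r mulr_ge0//=; last exact: ltW.
  by rewrite mulrC; apply: ler_pM => //; exact: ltW.
- rewrite -/K.
  have dl : delta <= e2 / (100 * (1 + T * K)) by rewrite ge_min lexx orbT.
  have TK0 : 0 <= T * K by rewrite mulr_ge0.
  apply: (@le_trans _ _ (delta * (1 + T * K))).
    apply: ler_pM => //; [by rewrite divr_ge0// ltW| |by rewrite lerDr].
    by rewrite ler_pdivrMr// ler_peMr ?ler1n// ltW.
  apply: le_trans (ler_wpM2r (ltW TK) dl) _.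
  by apply: le_of_eq; field; rewrite gt_eqF.
Qed.

(** Reversing time, [b] changes sign, reduces negative times to positive ones. *)
Lemma stability a b kap (M T : R) n :
  `|T| * e2 ^+ 3 <= 2 * (`|m| * mu / (6595 * c ^+ 3)) ->
  (forall t, between0 T t -> mode_ode m a b kap t) ->
  (forall t, between0 T t -> 0 <= kap t <= M) ->
  (forall t, between0 T t ->
    (2 * pi)^-1 * tsum (fun j => a t j ^+ 2) <= e2 ->
    kap t = (2 * pi)^-1 * tsum (fun j => a t j ^+ 2)) ->
  (forall k, mode_energy a b k 0 <= 2 * e2) ->
  mode_energy a b n T <= 11 / 5 * e2.
Proof.
move=> hT ode kM kapE init; have [T0|T0] := leP 0 T.
  rewrite (ger0_norm T0) in hT.
  by apply: (@stability_forward a b kap M) => // t t0T; [apply: ode|apply: kM|apply: kapE]; left.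
rewrite (ltr0_norm T0) in hT.
have nt t : 0 <= t <= - T -> between0 T (- t).
  by move=> /andP[t0 tT]; right; rewrite lerNr tT oppr_le0.
have Em k t : mode_energy a b k t = mode_energy (fun t => a (- t)) (fun t j => - b (- t) j) k (- t).
  by apply: eq_bigr => j _; rewrite opprK sqrrN.
rewrite Em; apply: (@stability_forward _ _ (fun t => kap (- t)) M) => //.
- by rewrite oppr_ge0 ltW.
- move=> t /nt /ode h j; have [da db] := h j.
  have dn := drvN (drv_id t).
  split.
    by apply: drv_eq (drv_comp (f := a^~ j) (g := fun s => - s) da dn) _; ring.
  by apply: drv_eq (drvN (drv_comp (f := b^~ j) (g := fun s => - s) db dn)) _; ring.
- by move=> t /nt; exact: kM.
- by move=> t /nt; exact: kapE.
- by move=> k; have := init k; rewrite Em oppr0.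
Qed.

End Data.

Lemma mode_growth_abs (m c M : R) a b kap (T : R) j :
  (forall i, 0 <= lam m i <= c) ->
  (forall t, between0 T t -> mode_ode m a b kap t) ->
  (forall t, between0 T t -> 0 <= kap t <= M) ->
  a T j ^+ 2 + b T j ^+ 2 <= (a 0 j ^+ 2 + b 0 j ^+ 2) * expR (c * M * `|T|).
Proof.
move=> hc ode kM; have [T0|T0] := leP 0 T.
  rewrite (ger0_norm T0).
  by apply: (mode_growth (kap := kap)) => // t t0T; [apply: ode|apply: kM]; left.
rewrite (ltr0_norm T0).
have nt t : 0 <= t <= - T -> between0 T (- t).
  by move=> /andP[t0 tT]; right; rewrite lerNr tT oppr_le0.
have := @mode_growth m c M (fun t => a (- t)) (fun t j => - b (- t) j) (fun t => kap (- t)) (- T) j.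
rewrite opprK oppr0 !sqrrN; apply => //.
- by rewrite oppr_ge0 ltW.
- move=> t /nt /ode h i; have [da db] := h i.
  have dn := drvN (drv_id t).
  split.
    by apply: drv_eq (drv_comp (f := a^~ i) (g := fun s => - s) da dn) _; ring.
  by apply: drv_eq (drvN (drv_comp (f := b^~ i) (g := fun s => - s) db dn)) _; ring.
- by move=> t /nt; exact: kM.
Qed.

End InfiniteStability.

(** * Sine and cosine series *)

Section RInt.
Context {R : realType}.
Notation mu := (@lebesgue_measure R).

(** With integrals as increments of primitives, integration by parts and changes
    of variable are computations of derivatives. *)
Definition rint (a b : R) (f : R -> R) : R := prim f b - prim f a.

Lemma rint_ftc (F f : R -> R) (a b : R) : continuous f ->
  (forall x : R, is_derive x 1 F (f x)) -> rint a b f = F b - F a.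
Proof.
move=> cf dF.
have h (x : R) : is_derive x 1 (fun y => prim f y - F y) 0.
  by rewrite -(subrr (f x)); exact: drvB ((primP cf).2 x) (dF x).
have := is_derive_0_is_cst b a h; rewrite /rint; lra.
Qed.

Lemma Rintegral_rint (f : R -> R) (a b : R) : a < b -> continuous f ->
  \int[mu]_(x in `[a, b]) f x = rint a b f.
Proof. by move=> ab cf; rewrite (Rintegral_ftc ab (primP cf).2 cf). Qed.

Lemma Rintegral_oo_rint (f g : R -> R) (a b : R) : a < b -> continuous f ->
  {in `]a, b[, g =1 f} -> \int[mu]_(x in `]a, b[) g x = rint a b f.
Proof. by move=> ab cf gf; rewrite (Rintegral_oo_ftc ab (primP cf).2 cf gf). Qed.

Lemma rint_le (f g : R -> R) (a b : R) : a <= b -> continuous f -> continuous g ->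
  (forall x, f x <= g x) -> rint a b f <= rint a b g.
Proof.
move=> ab cf cg fg; rewrite /rint -subr_ge0.
have d (x : R) := drvB ((primP cg).2 x) ((primP cf).2 x).
have [z [_ e]] := mvt_seg ab (fun x _ => d x).
suff : 0 <= prim g b - prim f b - (prim g a - prim f a) by lra.
by rewrite e mulr_ge0 ?subr_ge0.
Qed.

Lemma eq_rint (f g : R -> R) (a b : R) : f =1 g -> rint a b f = rint a b g.
Proof. by move=> /funext ->. Qed.

Lemma rint_norm (f g : R -> R) (a b : R) : a <= b -> continuous f -> continuous g ->
  (forall x, `|f x| <= g x) -> `|rint a b f| <= rint a b g.
Proof.
move=> ab cf cg fg; rewrite ler_norml; apply/andP; split; last first.
  by apply: rint_le => // x; exact: le_trans (ler_norm _) (fg x).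
have cng : continuous (fun x => - g x) by move=> x; apply: continuousN; exact: cg.
have -> : - rint a b g = rint a b (fun x => - g x).
  by rewrite (rint_ftc _ _ cng (fun x => drvN ((primP cg).2 x))) /rint; ring.
by apply: rint_le => // x; have := fg x; rewrite ler_norml => /andP[].
Qed.

Lemma continuousMM (f g : R -> R) : continuous f -> continuous g ->
  continuous (fun x => f x * g x).
Proof. by move=> cf cg x; apply: continuousM; [exact: cf|exact: cg]. Qed.

Lemma tsum_continuous (c : nat -> R) (g : nat -> R -> R) (G : R) :
  abs_summable c -> (forall j, continuous (g j)) ->
  (forall j x, `|g j x| <= G) -> continuous (fun x => tsum (fun j => c j * g j x)).
Proof.
move=> cs cg gG x.
apply: (@tannery R R (nbhs x) _ (fun y j => c j * g j y) (fun j => c j * g j x) (fun j => G * `|c j|)).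
- by apply: abs_summable_le (abs_summableZ G cs) => j _; rewrite !normrM normr_id.
- near=> y => j j0; rewrite normrM mulrC; exact: ler_wpM2r.
- by move=> j _; apply: cvgMr; exact: cg.
Unshelve. all: by end_near. Qed.

Lemma abs_summableM (c g : nat -> R) (G : R) : abs_summable c ->
  (forall j, (0 < j)%N -> `|g j| <= G) -> abs_summable (fun j => c j * g j).
Proof.
move=> cs gG; apply: abs_summable_le (abs_summableZ G cs) => j j0.
rewrite !normrM mulrC; apply: ler_wpM2r => //.
exact: le_trans (gG j j0) (ler_norm _).
Qed.

(** Term-by-term integration, obtained by term-by-term differentiation of the
    primitives. *)
Lemma rint_tsum (c : nat -> R) (g : nat -> R -> R) (e : R -> R) (G E a b : R) :
  abs_summable c -> (forall j, continuous (g j)) ->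
  (forall j x, `|g j x| <= G) -> continuous e -> (forall x, `|e x| <= E) ->
  abs_summable (fun j => c j * rint a b (fun x => g j x * e x)) /\
  rint a b (fun x => tsum (fun j => c j * g j x) * e x) =
  tsum (fun j => c j * rint a b (fun x => g j x * e x)).
Proof.
move=> cs cg gG ce eE.
have G0 : 0 <= G by exact: le_trans (normr_ge0 _) (gG 0%N 0).
have E0 : 0 <= E by exact: le_trans (normr_ge0 _) (eE 0).
have cge j : continuous (fun x => g j x * e x) by exact: continuousMM.
pose P j := prim (fun x => g j x * e x).
have dP j (x : R) : is_derive x 1 (P j) (g j x * e x) by exact: (primP (cge j)).2.
have P0 j : P j 0 = 0 by exact: (primP (cge j)).1.
have Pb j x : `|P j x| <= G * E * `|x|.
  have [z [_]] := @mvt_ball R (P j) (fun x => g j x * e x) 0 x (fun y _ => dP j y).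
  rewrite P0 !subr0 => ->; rewrite normrM; apply: ler_wpM2r => //.
  by rewrite normrM; exact: ler_pM.
have sP x : abs_summable (fun j => c j * P j x).
  by apply: abs_summableM cs _ => j _; exact: Pb.
have dS (x : R) : is_derive x 1 (fun y => tsum (fun j => c j * P j y))
    (tsum (fun j => c j * g j x) * e x).
  have -> : tsum (fun j => c j * g j x) * e x = tsum (fun j => c j * (g j x * e x)).
    rewrite mulrC -tsumZ; first by apply: eq_tsum => j _; ring.
    by apply: abs_summableM cs _ => j _; exact: gG.
  apply: (@is_derive_tsum R (fun y j => c j * P j y) (fun y j => c j * (g j y * e y))
    (fun j => G * E * `|c j|) x 1) => //.
  - by apply: abs_summable_le (abs_summableZ (G * E) cs) => j _; rewrite !normrM normr_id.
  - move=> y j _ _; split; first exact: drvZ.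
    by rewrite normrM mulrC; apply: ler_wpM2r => //; rewrite normrM; exact: ler_pM.
have cS : continuous (fun x => tsum (fun j => c j * g j x) * e x).
  by apply: continuousMM => //; exact: tsum_continuous cs cg gG.
have rE j : c j * rint a b (fun x => g j x * e x) = c j * P j b + (-1) * (c j * P j a).
  by rewrite /rint -/(P j); ring.
split.
  have -> : (fun j => c j * rint a b (fun x => g j x * e x)) =
            (fun j => c j * P j b + (-1) * (c j * P j a)) by exact: funext.
  by apply: abs_summableD => //; exact: abs_summableZ.
rewrite (rint_ftc _ _ cS dS).
rewrite (@eq_tsum _ (fun j => c j * rint a b _) _ (fun j _ => rE j)).
rewrite tsumD//; last exact: abs_summableZ.
by rewrite tsumZ// mulN1r.
Qed.

Lemma tsum_single (f : nat -> R) k : (0 < k)%N ->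
  (forall j, (0 < j)%N -> j != k -> f j = 0) -> tsum f = f k.
Proof.
move=> k0 h; apply: tsum_cvg_eq.
apply: cvg_near_cst; near=> n.
have kn : (k < n)%N by near: n; exact: nbhs_infty_gt.
rewrite /psum (big_cat_nat (n := k))//=; last exact: ltnW.
rewrite (@big_ltn _ _ _ k)//= !big_nat big1; last first.
  by move=> j /andP[j0 jk]; apply: h => //; rewrite ltn_eqF.
rewrite big1; first by rewrite add0r addr0.
move=> j /andP[kj _]; apply: h; first exact: leq_trans k0 (ltnW kj).
by rewrite gtn_eqF.
Unshelve. all: by end_near. Qed.

End RInt.

Section SineSeries.
Context {R : realType}.
Notation mu := (@lebesgue_measure R).

Implicit Types (c : nat -> R) (x : R) (j k : nat).

(** The amplitude of the normalized sine functions. *)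
Definition phi_max : R := Num.sqrt (2 / pi).

Definition psi (j : nat) (x : R) : R := phi_max * cos (j%:R * x).

Lemma phi_max_ge0 : 0 <= phi_max. Proof. exact: sqrtr_ge0. Qed.

Lemma phi_max_sqr : phi_max ^+ 2 = 2 / pi.
Proof. by rewrite sqr_sqrtr// divr_ge0// pi_ge0. Qed.

Lemma phiE j x : phi j x = phi_max * sin (j%:R * x). Proof. by []. Qed.

Lemma phi_bound j x : `|phi j x| <= phi_max.
Proof.
rewrite phiE normrM (ger0_norm phi_max_ge0) -[leRHS]mulr1.
by apply: ler_wpM2l; [exact: phi_max_ge0|exact: sin_max].
Qed.

Lemma psi_bound j x : `|psi j x| <= phi_max.
Proof.
rewrite /psi normrM (ger0_norm phi_max_ge0) -[leRHS]mulr1.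
by apply: ler_wpM2l; [exact: phi_max_ge0|exact: cos_max].
Qed.

Lemma drv_lin (k x : R) : is_derive x 1 (fun y : R => k * y) k.
Proof. exact: drv_eq (drvZ k (drv_id x)) (mulr1 _). Qed.

Lemma drv_sin (k x : R) : is_derive x 1 (fun y : R => sin (k * y)) (k * cos (k * x)).
Proof.
by rewrite mulrC; exact: (drv_comp (f := sin) (is_derive_sin _) (drv_lin k x)).
Qed.

Lemma drv_cos (k x : R) : is_derive x 1 (fun y : R => cos (k * y)) (- (k * sin (k * x))).
Proof.
by rewrite -mulrN mulrC; exact: (drv_comp (f := cos) (is_derive_cos _) (drv_lin k x)).
Qed.

Lemma drv_phi j (x : R) : is_derive x 1 (phi j) (j%:R * psi j x).
Proof.
by apply: drv_eq (drvZ phi_max (drv_sin j%:R x)) _; rewrite /psi; ring.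
Qed.

Lemma drv_psi j (x : R) : is_derive x 1 (psi j) (- (j%:R * phi j x)).
Proof.
by apply: drv_eq (drvZ phi_max (drv_cos j%:R x)) _; rewrite phiE; ring.
Qed.

Lemma phi_continuous j : continuous (@phi R j).
Proof. by move=> x; exact: is_derive_continuous (drv_phi j x). Qed.

Lemma psi_continuous j : continuous (psi j).
Proof. by move=> x; exact: is_derive_continuous (drv_psi j x). Qed.

Lemma phi0 j : phi j (0 : R) = 0.
Proof. by rewrite phiE mulr0 sin0 mulr0. Qed.

Lemma sin_natpi j : sin (j%:R * pi : R) = 0.
Proof.
elim: j => [|j IH]; first by rewrite mul0r sin0.
by rewrite -natr1 mulrDl mul1r sinDpi IH oppr0.
Qed.

Lemma phipi j : phi j (pi : R) = 0.
Proof. by rewrite phiE sin_natpi mulr0. Qed.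

Lemma nat_sqrB_neq0 j k : j != k -> (j%:R ^+ 2 - k%:R ^+ 2 : R) != 0.
Proof.
move=> jk; rewrite subr_eq0 eqrXn2 ?ler0n//.
by rewrite eqr_nat.
Qed.

Lemma int_phi_phi j k : (0 < j)%N -> (0 < k)%N ->
  rint 0 pi (fun x : R => phi j x * phi k x) = (j == k)%:R.
Proof.
move=> j0 k0; have cc i : continuous (fun x : R => phi j x * phi i x).
  by apply: continuousMM; exact: phi_continuous.
case: eqVneq => [<-|jk] /=.
  have jn : j%:R != 0 :> R by rewrite pnatr_eq0 -lt0n.
  have dF (x : R) : is_derive x 1 (fun x => phi_max ^+ 2 / 2 * x - (2 * j%:R)^-1 * (phi j x * psi j x)) (phi j x * phi j x).
    apply: drv_eq (drvB (drv_lin _ x) (drvZ _ (drvM (drv_phi j x) (drv_psi j x)))) _.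
    have e : phi_max ^+ 2 = phi j x ^+ 2 + psi j x ^+ 2.
      by rewrite phiE /psi !exprMn -mulrDr addrC cos2Dsin2 mulr1.
    by rewrite e; field.
  rewrite (rint_ftc 0 pi (cc j) dF) phi0 phipi phi_max_sqr !mul0r !mulr0 !subr0.
  have := @pi_gt0 R; move: (pi : R) => q q0.
  by field; rewrite gt_eqF.
have jk' := nat_sqrB_neq0 jk.
have dF (x : R) : is_derive x 1 (fun x => (j%:R ^+ 2 - k%:R ^+ 2)^-1 * (k%:R * (phi j x * psi k x) - j%:R * (psi j x * phi k x))) (phi j x * phi k x).
  apply: drv_eq (drvZ _ (drvB (drvZ _ (drvM (drv_phi j x) (drv_psi k x))) (drvZ _ (drvM (drv_psi j x) (drv_phi k x))))) _.
  by field.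
by rewrite (rint_ftc 0 pi (cc k) dF) !phi0 !phipi !(mul0r, mulr0, subrr).
Qed.

Lemma int_psi_psi j k : (0 < j)%N -> (0 < k)%N ->
  rint 0 pi (fun x => psi j x * psi k x) = (j == k)%:R.
Proof.
move=> j0 k0; have cc i : continuous (fun x : R => psi j x * psi i x).
  by apply: continuousMM; exact: psi_continuous.
case: eqVneq => [<-|jk] /=.
  have jn : j%:R != 0 :> R by rewrite pnatr_eq0 -lt0n.
  have dF (x : R) : is_derive x 1 (fun x => phi_max ^+ 2 / 2 * x + (2 * j%:R)^-1 * (phi j x * psi j x)) (psi j x * psi j x).
    apply: drv_eq (drvD (drv_lin _ x) (drvZ _ (drvM (drv_phi j x) (drv_psi j x)))) _.
    have e : phi_max ^+ 2 = phi j x ^+ 2 + psi j x ^+ 2.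
      by rewrite phiE /psi !exprMn -mulrDr addrC cos2Dsin2 mulr1.
    by rewrite e; field.
  rewrite (rint_ftc 0 pi (cc j) dF) phi0 phipi phi_max_sqr !mul0r !mulr0 !addr0 subr0.
  have := @pi_gt0 R; move: (pi : R) => q q0.
  by field; rewrite gt_eqF.
have jk' := nat_sqrB_neq0 jk.
have dF (x : R) : is_derive x 1 (fun x => (j%:R ^+ 2 - k%:R ^+ 2)^-1 * (j%:R * (phi j x * psi k x) - k%:R * (psi j x * phi k x))) (psi j x * psi k x).
  apply: drv_eq (drvZ _ (drvB (drvZ _ (drvM (drv_phi j x) (drv_psi k x))) (drvZ _ (drvM (drv_psi j x) (drv_phi k x))))) _.
  by field.
by rewrite (rint_ftc 0 pi (cc k) dF) !phi0 !phipi !(mul0r, mulr0, subrr).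
Qed.

Definition sser (c : nat -> R) (x : R) : R := tsum (fun j => c j * phi j x).
Definition cser (c : nat -> R) (x : R) : R := tsum (fun j => c j * psi j x).

Lemma sser_continuous c : abs_summable c -> continuous (sser c).
Proof. move=> cs; exact: tsum_continuous cs phi_continuous phi_bound. Qed.

Lemma cser_continuous c : abs_summable c -> continuous (cser c).
Proof. move=> cs; exact: tsum_continuous cs psi_continuous psi_bound. Qed.

Lemma sser_summable c x : abs_summable c -> abs_summable (fun j => c j * phi j x).
Proof. by move=> cs; apply: abs_summableM cs _ => j _; exact: phi_bound. Qed.

Lemma cser_summable c x : abs_summable c -> abs_summable (fun j => c j * psi j x).
Proof. by move=> cs; apply: abs_summableM cs _ => j _; exact: psi_bound. Qed.

Lemma sser_bound c x : abs_summable c -> `|sser c x| <= phi_max * tsum (fun j => `|c j|).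
Proof.
move=> cs.
have cs' : abs_summable (fun j => `|c j|).
  by apply: abs_summable_le cs => j _; rewrite normr_id.
rewrite -tsumZ//; apply: ler_norm_tsum; first exact: abs_summableZ.
by move=> j _; rewrite normrM mulrC; apply: ler_wpM2r => //; exact: phi_bound.
Qed.

Lemma cser_bound c x : abs_summable c -> `|cser c x| <= phi_max * tsum (fun j => `|c j|).
Proof.
move=> cs.
have cs' : abs_summable (fun j => `|c j|).
  by apply: abs_summable_le cs => j _; rewrite normr_id.
rewrite -tsumZ//; apply: ler_norm_tsum; first exact: abs_summableZ.
by move=> j _; rewrite normrM mulrC; apply: ler_wpM2r => //; exact: psi_bound.
Qed.

Lemma abs_summable_natM (c : nat -> R) : abs_summable (fun j => j%:R * c j) ->
  abs_summable c.
Proof.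
apply: abs_summable_le => j j0; rewrite normrM ler_peMl//.
by rewrite ger0_norm ?ler0n// ler1n.
Qed.

Lemma drv_sser c (x : R) : abs_summable (fun j => j%:R * c j) ->
  is_derive x 1 (sser c) (cser (fun j => j%:R * c j) x).
Proof.
move=> cs.
apply: (@is_derive_tsum R (fun y j => c j * phi j y) (fun y j => j%:R * c j * psi j y)
    (fun j => phi_max * `|j%:R * c j|) x 1) => //.
- apply: abs_summable_le (abs_summableZ phi_max cs) => j _.
  by rewrite [in leLHS]normrM normr_id [in leRHS]normrM.
- move=> y j _ _; split.
    by apply: drv_eq (drvZ (c j) (drv_phi j y)) _; ring.
  by rewrite normrM mulrC; apply: ler_wpM2r => //; exact: psi_bound.
- by move=> y _; apply: sser_summable; exact: abs_summable_natM.
Qed.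

Lemma drv_cser c (x : R) : abs_summable (fun j => j%:R * c j) ->
  is_derive x 1 (cser c) (sser (fun j => - (j%:R * c j)) x).
Proof.
move=> cs.
apply: (@is_derive_tsum R (fun y j => c j * psi j y) (fun y j => - (j%:R * c j) * phi j y)
    (fun j => phi_max * `|j%:R * c j|) x 1) => //.
- apply: abs_summable_le (abs_summableZ phi_max cs) => j _.
  by rewrite [in leLHS]normrM normr_id [in leRHS]normrM.
- move=> y j _ _; split.
    by apply: drv_eq (drvZ (c j) (drv_psi j y)) _; ring.
  by rewrite normrM normrN mulrC; apply: ler_wpM2r => //; exact: phi_bound.
- by move=> y _; apply: cser_summable; exact: abs_summable_natM.
Qed.

Lemma coef_rint (f g : R -> R) k : continuous g -> {in `[0, pi], f =1 g} ->
  coef f k = rint 0 pi (fun x => phi k x * g x).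
Proof.
move=> cg fg; rewrite /coef.
rewrite (@eq_Rintegral _ _ _ mu `[0, pi] (fun x => phi k x * g x)).
  apply: Rintegral_rint; first exact: pi_gt0.
  by apply: continuousMM => //; exact: phi_continuous.
by move=> x; rewrite inE => /= hx; rewrite mulrC; congr (_ * _); exact: fg.
Qed.

Lemma int_phi_sser c k : abs_summable c -> (0 < k)%N ->
  rint 0 pi (fun x => phi k x * sser c x) = c k.
Proof.
move=> cs k0.
rewrite (@eq_rint _ _ (fun x => sser c x * phi k x)); last by move=> x; rewrite mulrC.
have [_ ->] := rint_tsum 0 pi cs phi_continuous phi_bound (@phi_continuous k) (phi_bound k).
rewrite (@tsum_single _ _ k)//; first by rewrite int_phi_phi// eqxx mulr1.
by move=> j j0 jk; rewrite int_phi_phi// (negbTE jk) mulr0.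
Qed.

Lemma int_psi_cser c k : abs_summable c -> (0 < k)%N ->
  rint 0 pi (fun x => psi k x * cser c x) = c k.
Proof.
move=> cs k0.
rewrite (@eq_rint _ _ (fun x => cser c x * psi k x)); last by move=> x; rewrite mulrC.
have [_ ->] := rint_tsum 0 pi cs psi_continuous psi_bound (@psi_continuous k) (psi_bound k).
rewrite (@tsum_single _ _ k)//; first by rewrite int_psi_psi// eqxx mulr1.
by move=> j j0 jk; rewrite int_psi_psi// (negbTE jk) mulr0.
Qed.

Lemma coef_sser (f : R -> R) c k : abs_summable c -> (0 < k)%N ->
  {in `[0, pi], f =1 sser c} -> coef f k = c k.
Proof.
move=> cs k0 fc.
by rewrite (coef_rint _ (sser_continuous cs) fc) int_phi_sser.
Qed.

(** Only absolutely convergent series occur, for which Parseval's identity is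
    term-by-term integration. *)
Lemma parseval_cser c : abs_summable c ->
  rint 0 pi (fun x => cser c x * cser c x) = tsum (fun j => c j ^+ 2).
Proof.
move=> cs.
have [_ ->] := rint_tsum 0 pi cs psi_continuous psi_bound (cser_continuous cs) (fun x => cser_bound x cs).
by apply: eq_tsum => j j0; rewrite int_psi_cser// expr2.
Qed.

Lemma Hstar_sser (s : R) (f : R -> R) : Hstar s f -> abs_summable (coef f) ->
  {in `[0, pi], f =1 sser (coef f)}.
Proof.
by move=> [_ h] cs x hx; apply/esym; apply: tsum_cvg_eq; exact: h x hx.
Qed.

Lemma Hstar_summable (s p : R) (f : R -> R) : 1 / 2 < s - p -> Hstar s f ->
  abs_summable (fun j => j%:R `^ p * coef f j).
Proof.
move=> sp [h _]; apply: (@abs_summable_sqr R s) => //.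
by apply: wsq_lty h => j _; exact: powR_ge0.
Qed.

Lemma abs_summable_ext (f g : nat -> R) : (forall j, (0 < j)%N -> f j = g j) ->
  abs_summable f -> abs_summable g.
Proof. by move=> fg; apply: abs_summable_le => j j0; rewrite fg. Qed.

Lemma Hstar_abs_summable (s : R) (f : R -> R) : 1 / 2 < s -> Hstar s f ->
  abs_summable (coef f).
Proof.
move=> s2 h; have /(_ _) := @Hstar_summable s 0 f _ h; rewrite subr0 => /(_ s2).
by apply: abs_summable_ext => j _; rewrite powRr0 mul1r.
Qed.

End SineSeries.

(** * Smooth bumps and test functions *)

Section Smooth.
Context {R : realType}.
Implicit Types (f g : R -> R).

(** Differentiability [n] times, by recursion on the derivative; unlike
    differentiability of the iterates it passes to products directly. *)
Fixpoint smooth (n : nat) f : Prop :=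
  if n is n'.+1 then (forall x : R, derivable f x 1) /\ smooth n' (derive1 f)
  else True.

Lemma derivable_drv f x : derivable f x 1 -> is_derive x 1 f (derive1 f x).
Proof. by move=> h; rewrite derive1E; exact: DeriveDef. Qed.

Lemma drv_derivable f (x d : R) : is_derive x 1 f d -> derivable f x 1.
Proof. by case. Qed.

Lemma drv_derive1 f (x d : R) : is_derive x 1 f d -> derive1 f x = d.
Proof. by move=> h; rewrite derive1E; exact: derive_val. Qed.

Lemma smooth_ext n f g : f =1 g -> smooth n f -> smooth n g.
Proof. by move=> /funext ->. Qed.

Lemma smoothS n f : smooth n.+1 f -> smooth n f.
Proof. by elim: n f => [//|n IH] f [h1 h2]; split => //; exact: IH. Qed.

Lemma smooth_derive n f (df : R -> R) : (forall x : R, is_derive x 1 f (df x)) ->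
  smooth n df -> smooth n.+1 f.
Proof.
move=> h s; split; first by move=> x; exact: drv_derivable (h x).
by apply: smooth_ext s => x; rewrite (drv_derive1 (h x)).
Qed.

Lemma smoothD n f g : smooth n f -> smooth n g -> smooth n (fun x => f x + g x).
Proof.
elim: n f g => [//|n IH] f g [f1 f2] [g1 g2].
apply: (@smooth_derive n _ (fun x => derive1 f x + derive1 g x)); last exact: IH.
by move=> x; apply: drvD; exact: derivable_drv.
Qed.

Lemma smoothZ n c f : smooth n f -> smooth n (fun x => c * f x).
Proof.
elim: n f => [//|n IH] f [f1 f2].
apply: (@smooth_derive n _ (fun x => c * derive1 f x)); last exact: IH.
by move=> x; apply: drvZ; exact: derivable_drv.
Qed.

Lemma smoothM n f g : smooth n f -> smooth n g -> smooth n (fun x => f x * g x).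
Proof.
elim: n f g => [//|n IH] f g fs gs; have fn := smoothS fs; have gn := smoothS gs.
case: fs gs => f1 f2 [g1 g2].
apply: (@smooth_derive n _ (fun x => derive1 f x * g x + f x * derive1 g x)).
  by move=> x; apply: drvM; exact: derivable_drv.
by apply: smoothD; exact: IH.
Qed.

Lemma smooth_affine n f a e : smooth n f -> smooth n (fun x => f (a + e * x)).
Proof.
elim: n f => [//|n IH] f [f1 f2].
apply: (@smooth_derive n _ (fun x => e * derive1 f (a + e * x))).
  move=> x; rewrite mulrC.
  have d : is_derive x 1 (fun y => a + e * y) e.
    exact: drv_eq (drvD (drvC a x) (drv_lin e x)) (add0r _).
  exact: (drv_comp (f := f) (derivable_drv (f1 _)) d).
by apply: smoothZ; exact: IH.
Qed.

Lemma smooth_derive1n n f : (forall k, smooth k f) ->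
  forall x : R, derivable (derive1n n f) x 1.
Proof.
move=> fs; have : forall k, smooth k (derive1n n f).
  elim: n => [|n IH] k; first exact: fs.
  by have [_] := IH k.+1.
by move=> /(_ 1%N) [].
Qed.

(** The flat function [expR (- x^-1)] and its companions, a family closed
    under differentiation. *)
Definition flat (n : nat) (x : R) : R :=
  if 0 < x then x^-1 ^+ n * expR (- x^-1) else 0.

Lemma flat_ge0 n x : 0 <= flat n x.
Proof.
rewrite /flat; case: ltP => // x0.
by rewrite mulr_ge0 ?expR_ge0// exprn_ge0// invr_ge0 ltW.
Qed.

(** The exponential dominates every power of [x^-1]. *)
Lemma flat_small n x : `|flat n x| <= n.+2`!%:R * x ^+ 2.
Proof.
rewrite ger0_norm ?flat_ge0// /flat; case: ltP => [x0|x0]; last first.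
  by rewrite mulr_ge0 ?sqr_ge0.
have y0 : 0 < x^-1 by rewrite invr_gt0.
have f0 : 0 < (n.+2)`!%:R :> R by rewrite ltr0n fact_gt0.
rewrite expRN ler_pdivrMr ?expR_gt0//.
have := expR_ge1Dxn n.+1 (ltW y0).
have -> : x ^+ 2 = x^-1 ^- 2 by rewrite exprVn invrK.
move: (x^-1) y0 => y y0 h.
have y2 : 0 < y ^+ 2 by rewrite exprn_gt0.
have : y ^+ n.+2 / n.+2`!%:R <= expR y by apply: le_trans h; rewrite lerDr.
rewrite ler_pdivrMr// => {}h.
by rewrite mulrAC ler_pdivlMr// -exprD addn2 [leRHS]mulrC.
Qed.

Lemma drv_flat n (x : R) : is_derive x 1 (flat n) (flat n.+2 x - n%:R * flat n.+1 x).
Proof.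
have [x0|x0|->] := ltgtP x 0.
- have -> : flat n.+2 x - n%:R * flat n.+1 x = 0.
    by rewrite /flat ltNge (ltW x0)/= mulr0 subr0.
  apply: near_eq_is_derive (drvC 0 x); near=> y.
  rewrite /flat ltNge.
  have -> // : y <= 0.
  by apply: ltW; near: y; exact: lt_nbhsl.
- have xn : x != 0 by rewrite gt_eqF.
  have dV : is_derive x 1 (fun y : R => y^-1) (- (x^-1 ^+ 2)).
    apply: drv_eq (is_deriveV xn (drv_id x)) _.
    by rewrite [_ *: _]mulr1 exprVn.
  have dE : is_derive x 1 (fun y : R => expR (- y^-1)) (expR (- x^-1) * - - (x^-1 ^+ 2)).
    exact: (drv_comp (f := expR) (is_derive_expR _) (drvN dV)).
  have dP k : is_derive x 1 (fun y : R => y^-1 ^+ k) (- k%:R * x^-1 ^+ k.+1).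
    elim: k => [|k IH]; first by rewrite oppr0 mul0r; exact: drvC.
    rewrite (_ : (fun y : R => y^-1 ^+ k.+1) = fun y => y^-1 * y^-1 ^+ k); last first.
      by apply: funext => y; rewrite exprS.
    by apply: drv_eq (drvM dV IH) _; rewrite -natr1 !exprS expr0; ring.
  have h := drvM (dP n) dE.
  have e : - n%:R * x^-1 ^+ n.+1 * expR (- x^-1) + x^-1 ^+ n * (expR (- x^-1) * - - x^-1 ^+ 2) = flat n.+2 x - n%:R * flat n.+1 x.
    by rewrite /flat x0 opprK !exprS expr0; ring.
  rewrite e in h; apply: near_eq_is_derive h.
  near=> y; rewrite /flat ifT//.
  by near: y; exact: lt_nbhsr.
- have -> : flat n.+2 0 - n%:R * flat n.+1 0 = 0 by rewrite /flat ltxx mulr0 subr0.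
  apply/is_deriveP.
  have f00 : flat n 0 = 0 by rewrite /flat ltxx.
  apply/cvgrPdist_le => e e0.
  have C0 : 0 < n.+2`!%:R :> R by rewrite ltr0n fact_gt0.
  have ec : 0 < e / n.+2`!%:R by rewrite divr_gt0.
  near=> h; rewrite sub0r normrN add0r f00 subr0 normrM normfV.
  have h0 : h != 0 by near: h; exact: nbhs_dnbhs_neq.
  have hn : 0 < `|h| by rewrite normr_gt0.
  rewrite ler_pdivrMr//; apply: le_trans (flat_small n h) _.
  rewrite -[h ^+ 2]real_normK ?num_real// expr2 mulrA ler_pM2r//.
  rewrite mulrC -ler_pdivlMr//.
  apply: ltW; rewrite -[h]subr0 distrC; near: h.
  by apply: nbhs_dnbhs; exact: (@nbhsx_ballx _ _ (0 : R) _ ec).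
Unshelve. all: by end_near. Qed.

Lemma smooth_flat k n : smooth k (flat n).
Proof.
elim: k n => [//|k IH] n.
apply: (smooth_derive (drv_flat n)).
apply: (@smooth_ext k (fun x => flat n.+2 x + (- n%:R) * flat n.+1 x)).
  by move=> x; rewrite mulNr.
by apply: smoothD => //; exact: smoothZ.
Qed.

(** Supported in [[- r, r]].  Evenness makes the Fourier transform real; the
    factors [1] and [-1] display the affine substitutions. *)
Definition bump (r x : R) : R := flat 0 (r + 1 * x) * flat 0 (r + -1 * x).

Lemma smooth_bump r n : smooth n (bump r).
Proof. by apply: smoothM; apply: smooth_affine; exact: smooth_flat. Qed.

Lemma bump_ge0 r x : 0 <= bump r x.
Proof. by rewrite mulr_ge0// flat_ge0. Qed.

Lemma bumpN r x : bump r (- x) = bump r x.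
Proof. by rewrite /bump mulrC; congr (flat _ _ * flat _ _); ring. Qed.

Lemma bump_out r x : r <= `|x| -> bump r x = 0.
Proof.
rewrite ler_normr /bump => /orP[h|h].
  by rewrite [X in _ * X]/flat ifF ?mulr0//; apply/negbTE; rewrite -leNgt; lra.
by rewrite [X in X * _]/flat ifF ?mul0r//; apply/negbTE; rewrite -leNgt; lra.
Qed.

Lemma bump_gt0 r x : `|x| < r -> 0 < bump r x.
Proof.
rewrite ltr_norml => /andP[h1 h2]; rewrite /bump /flat.
rewrite !ifT; [|lra|lra].
by rewrite !expr0 !mul1r mulr_gt0 ?expR_gt0.
Qed.

End Smooth.

Section TestFunctions.
Context {R : realType}.
Implicit Types (eta : R -> R).

Lemma test_derivable eta n (x : R) : test_function eta ->
  is_derive x 1 (derive1n n eta) (derive1n n.+1 eta x).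
Proof. by move=> [h _]; apply: derivable_drv; exact: h. Qed.

Lemma test_continuous eta n : test_function eta -> continuous (derive1n n eta).
Proof. by move=> h x; exact: is_derive_continuous (test_derivable n x h). Qed.

(** The complement of the support is open, so that derivatives vanish there. *)
Lemma test_out eta n : test_function eta -> exists K : set R,
  [/\ compact K, K `<=` `]0, pi[ & forall x, ~ K x -> derive1n n eta x = 0].
Proof.
move=> [_ [K [cK Kpi K0]]]; exists K; split => //.
have oK : open (~` K) by apply: closed_openC; exact: compact_closed.
elim: n => [//|n IH] x nK.
apply: drv_derive1; apply: near_eq_is_derive (drvC 0 x).
near=> y; apply/esym; apply: IH; near: y.
by have := open_nbhs_nbhs (conj oK nK : open_nbhs x (~` K)).
Unshelve. all: by end_near. Qed.

Lemma test_out0 eta n : test_function eta ->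
  derive1n n eta 0 = 0 /\ derive1n n eta pi = 0.
Proof.
move=> /(test_out n)[K [_ Kpi K0]]; split; apply: K0 => /Kpi /=.
  by rewrite in_itv/= ltxx.
by rewrite in_itv/= ltxx andbF.
Qed.

Lemma continuous_seg_bound (f : R -> R) (a b : R) : a <= b -> continuous f ->
  exists E : R, forall x, a <= x <= b -> `|f x| <= E.
Proof.
move=> ab cf.
have cn : {within `[a, b], continuous (fun x => `|f x|)}.
  apply: continuous_subspaceT => x; apply: cvg_norm; exact: cf.
have [c _ hc] := EVT_max ab cn.
by exists `|f c| => x xab; apply: hc; rewrite in_itv.
Qed.

Lemma test_bound eta n : test_function eta ->
  exists E : R, forall x, `|derive1n n eta x| <= E.
Proof.
move=> h; have [K [_ Kpi K0]] := test_out n h.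
have [E hE] := continuous_seg_bound (@pi_ge0 R) (@test_continuous eta n h).
exists E => x; have [Kx|nKx] := pselect (K x).
  by apply: hE; have := Kpi x Kx; rewrite /= in_itv/= => /andP[/ltW -> /ltW ->].
rewrite K0// normr0; apply: le_trans (normr_ge0 _) (hE 0 _).
by rewrite lexx pi_ge0.
Qed.

Lemma coef_test eta j : test_function eta ->
  coef eta j = rint 0 pi (fun x => phi j x * eta x).
Proof. by move=> h; apply: coef_rint => //; exact: (@test_continuous eta 0 h). Qed.

(** Integration by parts twice, written as an explicit primitive. *)
Lemma rint_phi_eta2 eta j : test_function eta ->
  rint 0 pi (fun x => phi j x * derive1n 2 eta x) = - (j%:R ^+ 2 * coef eta j).
Proof.
move=> h; have c0 : continuous eta := @test_continuous eta 0 h.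
have c2 := @test_continuous eta 2 h.
have cp := @phi_continuous R j.
have cA := continuousMM cp c2; have cB := continuousMM cp c0.
have [e0 ep] := test_out0 0 h; have [f0 fp] := test_out0 1 h.
pose P := prim (fun x => phi j x * eta x).
have dF (x : R) : is_derive x 1
    (fun x => phi j x * derive1n 1 eta x - j%:R * (psi j x * derive1n 0 eta x) - j%:R ^+ 2 * P x)
    (phi j x * derive1n 2 eta x).
  apply: drv_eq (drvB (drvB (drvM (drv_phi j x) (test_derivable 1 x h))
    (drvZ _ (drvM (drv_psi j x) (test_derivable 0 x h)))) (drvZ _ ((primP cB).2 x))) _.
  by rewrite /=; ring.
rewrite (rint_ftc 0 pi cA dF) f0 fp e0 ep phi0 coef_test// /rint -/P.
by rewrite !(mulr0, mul0r, subr0, sub0r); ring.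
Qed.

Lemma rint_psi_eta1 eta j : test_function eta ->
  rint 0 pi (fun x => psi j x * derive1n 1 eta x) = j%:R * coef eta j.
Proof.
move=> h; have c0 : continuous eta := @test_continuous eta 0 h.
have c1 := @test_continuous eta 1 h.
have cp := @phi_continuous R j.
have cA := continuousMM (@psi_continuous R j) c1; have cB := continuousMM cp c0.
have [e0 ep] := test_out0 0 h.
pose P := prim (fun x => phi j x * eta x).
have dF (x : R) : is_derive x 1
    (fun x => psi j x * derive1n 0 eta x + j%:R * P x)
    (psi j x * derive1n 1 eta x).
  apply: drv_eq (drvD (drvM (drv_psi j x) (test_derivable 0 x h))
    (drvZ _ ((primP cB).2 x))) _.
  by rewrite /=; ring.
rewrite (rint_ftc 0 pi cA dF) e0 ep coef_test// /rint -/P.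
by rewrite !(mulr0, add0r); ring.
Qed.

(** This decay makes the pairing of a test function with the second derivative
    of an absolutely convergent series an absolutely convergent series. *)
Lemma coef_test_bound eta : test_function eta -> exists E : R,
  forall j, `|j%:R ^+ 2 * coef eta j| <= E.
Proof.
move=> h; have [E hE] := test_bound 2 h.
have c2 := @test_continuous eta 2 h.
exists (rint 0 pi (fun=> phi_max * E)) => j.
rewrite -normrN -rint_phi_eta2//; apply: rint_norm; first exact: pi_ge0.
- by apply: continuousMM => //; exact: phi_continuous.
- exact: cst_continuous.
- by move=> x; rewrite normrM; apply: ler_pM => //; exact: phi_bound.
Qed.

End TestFunctions.

(** * Sine series that vanish on test functions *)

Section BumpTransform.
Context {R : realType}.
Variable (r : R).
Hypothesis r0 : 0 < r.

Let bs n : smooth n (bump r) := smooth_bump r n.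
Let db (x : R) : is_derive x 1 (bump r) (derive1 (bump r) x).
Proof. by apply: derivable_drv; have [] := bs 1. Qed.
Let ddb (x : R) : is_derive x 1 (derive1 (bump r)) (derive1 (derive1 (bump r)) x).
Proof. by apply: derivable_drv; have [_ []] := bs 2. Qed.

Lemma bump_continuous : continuous (bump r).
Proof. by move=> x; exact: is_derive_continuous (db x). Qed.

Let b2c : continuous (derive1 (derive1 (bump r))).
Proof.
have [_ [_ [h _]]] := bs 3.
by move=> x; exact: is_derive_continuous (derivable_drv (h x)).
Qed.

Let cosc (j : nat) : continuous (fun z : R => cos (j%:R * z)).
Proof. by move=> x; exact: is_derive_continuous (drv_cos j%:R x). Qed.

Let sinc (j : nat) : continuous (fun z : R => sin (j%:R * z)).
Proof. by move=> x; exact: is_derive_continuous (drv_sin j%:R x). Qed.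

Let bcc j := continuousMM bump_continuous (@cosc j).
Let bsc j := continuousMM bump_continuous (@sinc j).

(** The even Fourier transform of the bump: by [coef_bump] the coefficients of
    its translate by [y] are [phi j y * bhat j].  Testing with all translates is
    therefore a mollification of the tested series. *)
Definition bhat (j : nat) : R := rint (- r) r (fun z => bump r z * cos (j%:R * z)).

Let Nr_le_r : - r <= r. Proof. by have h := r0; lra. Qed.

Lemma bhat0E : bhat 0 = rint (- r) r (bump r).
Proof. by apply: eq_rint => z; rewrite mul0r cos0 mulr1. Qed.

Lemma bhat0_gt0 : 0 < bhat 0.
Proof.
have h := r0; have rr' : - r < r by lra.
have [|z zr e] := MVT rr' (fun x _ => (primP bump_continuous).2 x).
  by apply: continuous_subspaceT => x; exact: is_derive_continuous ((primP bump_continuous).2 x).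
rewrite bhat0E /rint e mulr_gt0//; last by lra.
by apply: bump_gt0; move: zr; rewrite in_itv/= ltr_norml.
Qed.

Lemma bhat_le j : `|bhat j| <= bhat 0.
Proof.
rewrite bhat0E; apply: rint_norm => //; first exact: bump_continuous.
move=> x; rewrite normrM ger0_norm ?bump_ge0// -[leRHS]mulr1.
by apply: ler_wpM2l; [exact: bump_ge0|exact: cos_max].
Qed.

Lemma cos_close (x : R) : `|1 - cos x| <= `|x|.
Proof.
have [z [_]] := @mvt_ball R cos (fun y => - sin y) 0 x (fun y _ => is_derive_cos y).
rewrite cos0 subr0 distrC => ->; rewrite normrM normrN ler_piMl//.
exact: sin_max.
Qed.

(** [bhat j / bhat 0] tends to [1] as the bump concentrates. *)
Lemma bhat_close j : `|bhat 0 - bhat j| <= j%:R * r * bhat 0.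
Proof.
have c1 : continuous (fun z => bump r z - bump r z * cos (j%:R * z)).
  by move=> z; apply: continuousB; [exact: bump_continuous|exact: bcc].
have c2 : continuous (fun z => j%:R * r * bump r z).
  by apply: continuousMM; [exact: cst_continuous|exact: bump_continuous].
have -> : bhat 0 - bhat j = rint (- r) r (fun z => bump r z - bump r z * cos (j%:R * z)).
  rewrite (rint_ftc _ _ c1 (fun x => drvB ((primP bump_continuous).2 x) ((primP (@bcc j)).2 x))).
  by rewrite bhat0E /bhat /rint; ring.
have -> : j%:R * r * bhat 0 = rint (- r) r (fun z => j%:R * r * bump r z).
  rewrite (rint_ftc _ _ c2 (fun x => drvZ (j%:R * r) ((primP bump_continuous).2 x))).
  by rewrite bhat0E /rint; ring.
apply: rint_norm => // z.
have [zr|zr] := leP r `|z|.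
  by rewrite (bump_out zr) mul0r subrr normr0 mulr0.
rewrite -{1}[bump r z]mulr1 -mulrBr normrM ger0_norm ?bump_ge0// mulrC.
apply: ler_wpM2r; first exact: bump_ge0.
apply: le_trans (cos_close _) _; rewrite normrM ger0_norm//.
by apply: ler_wpM2l => //; exact: ltW.
Qed.

Let b_r : bump r r = 0. Proof. by apply: bump_out; exact: ler_norm. Qed.
Let b_Nr : bump r (- r) = 0. Proof. by rewrite bumpN. Qed.

Let db_out x : r <= `|x| -> derive1 (bump r) x = 0.
Proof.
(* a nonnegative function has a vanishing derivative at its zeros *)
move=> rx; apply/eqP.
have bx : bump r x = 0 by exact: bump_out.
rewrite derive1E; have [_ e] := db x.
have := @derive1_at_min R (bump r) (x - 1) (x + 1) x.
have h1 : x - 1 <= x + 1 by lra.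
have h2 : {in `](x - 1), (x + 1)[, forall t, derivable (bump r) t 1}.
  by move=> t _; have [] := db t.
have h3 : x \in `](x - 1), (x + 1)[ by rewrite in_itv/=; apply/andP; split; lra.
move=> /(_ h1 h2 h3) [|_ ->//].
by move=> t _; rewrite bx bump_ge0.
Qed.

(** Integration by parts twice; this makes mollified series twice
    differentiable. *)
Lemma bhat_decay j : `|j%:R ^+ 2 * bhat j| <=
  rint (- r) r (fun z => `|derive1 (derive1 (bump r)) z|).
Proof.
have cA := continuousMM b2c (@cosc j).
have dF (x : R) : is_derive x 1 (fun x =>
    derive1 (bump r) x * cos (j%:R * x) + j%:R * (bump r x * sin (j%:R * x))
    - j%:R ^+ 2 * prim (fun z => bump r z * cos (j%:R * z)) x)
    (derive1 (derive1 (bump r)) x * cos (j%:R * x)).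
  apply: drv_eq (drvB (drvD (drvM (ddb x) (drv_cos j%:R x))
    (drvZ _ (drvM (db x) (drv_sin j%:R x)))) (drvZ _ ((primP (@bcc j)).2 x))) _.
  by ring.
have e : j%:R ^+ 2 * bhat j = - rint (- r) r (fun z => derive1 (derive1 (bump r)) z * cos (j%:R * z)).
  rewrite (rint_ftc _ _ cA dF) b_r b_Nr !db_out ?normrN ?ler_norm// /bhat /rint.
  by ring.
rewrite e normrN; apply: rint_norm => //.
  by move=> x; apply: cvg_norm; exact: b2c.
move=> x; rewrite normrM -[leRHS]mulr1; apply: ler_wpM2l => //; exact: cos_max.
Qed.

Section Translate.
Variable y : R.
Hypotheses (y1 : r < y) (y2 : y < pi - r).

Lemma bump_test : test_function (fun x => bump r (x - y)).
Proof.
split.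
  move=> n; apply: smooth_derive1n => k.
  apply: (@smooth_ext R k (fun x => bump r (- y + 1 * x))).
    by move=> x; congr (bump r _); ring.
  by apply: smooth_affine; exact: smooth_bump.
exists `[y - r, y + r]%classic; split; first exact: segment_compact.
  move=> x /=; rewrite !in_itv/= => /andP[h1 h2]; move: y1 y2 => h3 h4.
  by apply/andP; split; lra.
move=> x /= nx; apply: bump_out; rewrite leNgt; apply/negP => h; apply: nx.
move: h; rewrite ltr_norml in_itv/= => /andP[h1 h2].
by apply/andP; split; lra.
Qed.

(** The addition formula of the sine, the odd part of the bump being zero. *)
Lemma coef_bump j : coef (fun x => bump r (x - y)) j = phi j y * bhat j.
Proof.
have h1 := y1; have h2 := y2; have h0 := r0.
rewrite (coef_test _ bump_test).
pose Fc := prim (fun z => bump r z * cos (j%:R * z)).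
pose Fs := prim (fun z => bump r z * sin (j%:R * z)).
have dl (x : R) : is_derive x 1 (fun x => x - y) (1 : R).
  by have := drvB (drv_id x) (drvC y x); rewrite subr0.
have cA : continuous (fun x => phi j x * bump r (x - y)).
  apply: continuousMM; first exact: phi_continuous.
  by move=> x; exact: is_derive_continuous (drv_comp (f := bump r) (g := fun x => x - y) (db (x - y)) (dl x)).
have dF (x : R) : is_derive x 1 (fun x => phi j y * Fc (x - y) + psi j y * Fs (x - y))
    (phi j x * bump r (x - y)).
  apply: drv_eq (drvD (drvZ _ (drv_comp (f := Fc) (g := fun x => x - y) ((primP (@bcc j)).2 (x - y)) (dl x)))
    (drvZ _ (drv_comp (f := Fs) (g := fun x => x - y) ((primP (@bsc j)).2 (x - y)) (dl x)))) _.
  rewrite !mulr1 phiE /psi [phi j x]phiE.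
  have -> : j%:R * x = j%:R * y + j%:R * (x - y) by ring.
  by rewrite sinD; ring.
rewrite (rint_ftc _ _ cA dF) sub0r.
have Fpi (f : R -> R) : continuous f -> (forall x, bump r x = 0 -> f x = 0) ->
    prim f (pi - y) = prim f r /\ prim f (- y) = prim f (- r).
  move=> cf f0.
  have dp := (primP cf).2.
  split.
    have ry : r <= pi - y by lra.
    have [z [/andP[rz _] e]] := mvt_seg ry (fun x _ => dp x).
    apply/eqP; rewrite -subr_eq0 e f0 ?mul0r//.
    by apply: bump_out; apply: le_trans (ler_norm _).
  have ry : - y <= - r by lra.
  have [z [/andP[_ zr] e]] := mvt_seg ry (fun x _ => dp x).
  apply/esym/eqP; rewrite -subr_eq0 e f0 ?mul0r//.
  by apply: bump_out; rewrite ler_normr; apply/orP; right; lra.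
have [c1 c2] := Fpi _ (@bcc j) (fun x h => etrans (congr1 (fun t => t * _) h) (mul0r _)).
have [s1 s2] := Fpi _ (@bsc j) (fun x h => etrans (congr1 (fun t => t * _) h) (mul0r _)).
rewrite /Fc /Fs c1 c2 s1 s2.
have even : Fs r = Fs (- r).
  have d0 (x : R) : is_derive x 1 (fun x => Fs x - Fs (- x)) 0.
    apply: drv_eq (drvB ((primP (@bsc j)).2 x) (drv_comp (f := Fs) (g := fun x => - x) ((primP (@bsc j)).2 (- x)) (drvN (drv_id x)))) _.
    have sE : sin (j%:R * - x) = - sin (j%:R * x) by rewrite mulrN sinN.
    by rewrite bumpN sE; ring.
  have := is_derive_0_is_cst r 0 d0; rewrite oppr0 subrr => /eqP.
  by rewrite subr_eq0 => /eqP.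
by rewrite /bhat /rint -/Fc -/Fs even; ring.
Qed.

End Translate.
End BumpTransform.

Section DuBoisReymond.
Context {R : realType}.
Variable h : nat -> R.
Hypothesis hs : abs_summable h.
Hypothesis weak0 : forall eta, test_function eta ->
  tsum (fun j => h j * (j%:R ^+ 2 * coef eta j)) = 0.

Let g (r : R) j := h j * bhat r j.

Let g_summable r : 0 < r -> abs_summable (fun j => j%:R * (j%:R * g r j)).
Proof.
move=> r0; apply: (@abs_summable_ext _ (fun j => h j * (j%:R ^+ 2 * bhat r j))).
  by move=> j _; rewrite /g; ring.
by apply: abs_summableM hs _ => j _; exact: bhat_decay.
Qed.

(** The second derivative of the mollified series is its pairing with a
    translated bump, hence zero, so that the series is affine away from the
    end points. *)
Let mollified_affine r y d : 0 < r -> 0 <= d -> r < y - d -> y + d < pi - r ->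
  sser (g r) (y + d) + sser (g r) (y - d) = 2 * sser (g r) y.
Proof.
move=> r0 d0 yd1 yd2.
have gs2 := g_summable r0; have gs1 := abs_summable_natM gs2.
have gs0 := abs_summable_natM gs1.
have zero x : r < x < pi - r -> sser (fun j => - (j%:R * (j%:R * g r j))) x = 0.
  move=> /andP[x1 x2]; have := weak0 (bump_test x1 x2) => e.
  rewrite /sser (@eq_tsum _ _ (fun j => (-1) * (h j * (j%:R ^+ 2 * coef (fun z => bump r (z - x)) j)))); last first.
    by move=> j _; rewrite coef_bump// /g; ring.
  rewrite tsumZ ?e ?mulr0//.
  by have [E hE] := coef_test_bound (bump_test x1 x2); apply: abs_summableM hs _ => j _; exact: hE.
have slope x : `|x - y| <= d -> cser (fun j => j%:R * g r j) x = cser (fun j => j%:R * g r j) y.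
  move=> xd.
  have [z [zy e]] := @mvt_ball R (cser (fun j => j%:R * g r j)) _ y x (fun z _ => drv_cser z gs2).
  apply/eqP; rewrite -subr_eq0 e zero ?mul0r//.
  have := le_trans zy xd; rewrite ler_norml => /andP[q1 q2]; apply/andP; split; lra.
have [z1 [zy1 e1]] := @mvt_ball R (sser (g r)) _ y (y + d) (fun z _ => drv_sser z gs1).
have [z2 [zy2 e2]] := @mvt_ball R (sser (g r)) _ y (y - d) (fun z _ => drv_sser z gs1).
have a1 : y + d - y = d by ring.
have a2 : y - d - y = - d by ring.
rewrite a1 in zy1 e1; rewrite a2 normrN in zy2; rewrite a2 in e2.
rewrite (ger0_norm d0) in zy1 zy2.
rewrite (slope _ zy1) in e1; rewrite (slope _ zy2) in e2.
rewrite -[sser _ (y + d)](subrK (sser (g r) y)) e1.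
by rewrite -[sser _ (y - d)](subrK (sser (g r) y)) e2; ring.
Qed.

(** The bumps are concentrated at a point in [mollified_affine]. *)
Let affine y d : 0 <= d -> 0 < y - d -> y + d < pi ->
  sser h (y + d) + sser h (y - d) = 2 * sser h y.
Proof.
move=> d0 yd1 yd2.
pose rn (n : nat) : R := n.+1%:R^-1.
have rn0 n : 0 < rn n by rewrite invr_gt0 ltr0n.
have rnc : rn @ \oo --> (0 : R) by exact: cvg_harmonic.
pose q n j := h j * (bhat (rn n) j / bhat (rn n) 0).
have qc x : (fun n => sser (q n) x) @ \oo --> sser h x.
  apply: (@tannery R nat \oo _ (fun n j => q n j * phi j x) (fun j => h j * phi j x) (fun j => phi_max * `|h j|)).
  - by apply: abs_summable_le (abs_summableZ phi_max hs) => j _; rewrite !normrM normr_id.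
  - near=> n => j _; rewrite normrM mulrC; apply: ler_pM => //; first exact: phi_bound.
    rewrite normrM ler_piMr// normrM normfV (ger0_norm (ltW (bhat0_gt0 (rn0 n)))).
    by rewrite ler_pdivrMr ?bhat0_gt0// mul1r bhat_le.
  - move=> j _; apply: cvgMl; rewrite -[X in _ --> X]mulr1; apply: cvgMr.
    apply/cvgrPdist_le => e e0.
    have h1 : (fun n => j%:R * rn n) @ \oo --> (0 : R).
      by rewrite -(mulr0 (j%:R : R)); apply: cvgMr.
    have /cvgrPdist_le/(_ _ e0) := h1.
    apply: filterS => n; rewrite sub0r normrN => h2.
    have b0 := bhat0_gt0 (rn0 n).
    have -> : 1 - bhat (rn n) j / bhat (rn n) 0 = (bhat (rn n) 0 - bhat (rn n) j) / bhat (rn n) 0.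
      by field; rewrite gt_eqF.
    rewrite normrM normfV (ger0_norm (ltW b0)) ler_pdivrMr//.
    apply: le_trans (bhat_close (rn0 n) j) _.
    by apply: ler_wpM2r; [exact: ltW|exact: le_trans (ler_norm _) h2].
have L : (fun n => sser (q n) (y + d) + sser (q n) (y - d) - 2 * sser (q n) y) @ \oo -->
    sser h (y + d) + sser h (y - d) - 2 * sser h y.
  by apply: cvgB; [apply: cvgD; exact: qc|apply: cvgMr; exact: qc].
have L0 : (fun n => sser (q n) (y + d) + sser (q n) (y - d) - 2 * sser (q n) y) @ \oo --> (0 : R).
  have m0 : 0 < Num.min (y - d) (pi - (y + d)) by rewrite lt_min yd1 subr_gt0.
  apply: cvg_near_cst; near=> n.
  have rnm : rn n < Num.min (y - d) (pi - (y + d)).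
    near: n; move/cvgrPdist_lt: rnc => /(_ _ m0); apply: filterS => n.
    by rewrite sub0r normrN ger0_norm// ltW.
  move: rnm; rewrite lt_min => /andP[r1 r2].
  have sE x : sser (q n) x = (bhat (rn n) 0)^-1 * sser (g (rn n)) x.
    rewrite /sser -tsumZ; first by apply: eq_tsum => j _; rewrite /q /g; ring.
    by apply: sser_summable; apply: abs_summable_natM; apply: abs_summable_natM; exact: g_summable.
  have ma : sser (g (rn n)) (y + d) + sser (g (rn n)) (y - d) = 2 * sser (g (rn n)) y.
    by apply: mollified_affine => //; lra.
  by rewrite !sE -mulrDr ma; ring.
by apply/eqP; rewrite -subr_eq0; apply/eqP; exact: cvg_unique L L0.
Unshelve. all: by end_near. Qed.

Let zero_at_end (F : R -> R) (a : R) : continuous F -> 0 < a ->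
  (forall d, 0 < d < a -> F d = 0) -> F a = 0.
Proof.
move=> cF a0 F0; apply/eqP/negP => /negP Fa.
have Fa0 : 0 < `|F a| by rewrite normr_gt0.
have /cvgrPdist_lt/(_ _ Fa0)/nbhs_ballP[e /= ep he] := cF a.
pose m := Num.min e a.
have mp : 0 < m by rewrite lt_min ep a0.
have md : m <= e by rewrite ge_min lexx.
have ma : m <= a by rewrite ge_min lexx orbT.
have hb : ball a e (a - m / 2) by rewrite /ball/= opprB addrCA subrr addr0 ger0_norm; lra.
have Fz : F (a - m / 2) = 0 by apply: F0; apply/andP; split; lra.
by have := he _ hb; rewrite Fz subr0 ltxx.
Qed.

(** By continuity the segment may reach the nearest end point. *)
Let affine_end y : 0 < y < pi -> let a := Num.min y (pi - y) in
  sser h (y + a) + sser h (y - a) = 2 * sser h y.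
Proof.
move=> /andP[y0 ypi] a.
have a0 : 0 < a by rewrite lt_min y0 subr_gt0.
have a1 : a <= y by rewrite ge_min lexx.
have a2 : a <= pi - y by rewrite ge_min lexx orbT.
have cs := sser_continuous hs.
have cF : continuous (fun d => sser h (y + d) + sser h (y - d) - 2 * sser h y).
  have cp : continuous (fun d => sser h (y + d)).
    move=> x; apply: (@continuous_comp _ _ _ (fun d => y + d)); last exact: cs.
    exact: is_derive_continuous (drvD (drvC y x) (drv_id x)).
  have cm : continuous (fun d => sser h (y - d)).
    move=> x; apply: (@continuous_comp _ _ _ (fun d => y - d)); last exact: cs.
    exact: is_derive_continuous (drvB (drvC y x) (drv_id x)).
  by move=> x; apply: cvgB; [apply: cvgD; [exact: cp|exact: cm]|exact: cvg_cst].
have := zero_at_end cF a0.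
move=> z; apply/eqP; rewrite -subr_eq0; apply/eqP; apply: z => d /andP[d0 da].
apply/eqP; rewrite subr_eq0; apply/eqP; apply: affine; lra.
Qed.

Let sser_h_end : sser h 0 = 0 /\ sser h pi = 0.
Proof.
split; rewrite /sser -[RHS](@tsum0 R); apply: eq_tsum => j _.
  by rewrite phi0 mulr0.
by rewrite phipi mulr0.
Qed.

(** The lemma of du Bois-Reymond in the class at hand: [sser h] is the
    twofold primitive of the tested distribution, so it is affine in the open
    interval; being continuous on the closed interval and zero at both ends,
    it vanishes.  No multiple of a distribution carried by the end points can
    be added, because the series [sser h] converges absolutely. *)
Lemma distribution_zero j : (0 < j)%N -> h j = 0.
Proof.
move=> j0; have [e0 epi] := sser_h_end.
pose C := phi_max * tsum (fun j => `|h j|).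
(* the midpoint identity at an end point gives |F y| = |F y'| / 2 for some y' *)
have dec n : forall y, 0 <= y <= pi -> `|sser h y| <= C / 2 ^+ n.
  elim: n => [|n IH] y /andP[y0 ypi].
    by rewrite expr0 divr1; exact: sser_bound.
  have C0 : 0 <= C / 2 ^+ n by apply: le_trans (normr_ge0 _) (IH 0 _); rewrite lexx pi_ge0.
  have C1 : C / 2 ^+ n.+1 = C / 2 ^+ n / 2 by rewrite exprS; field; rewrite expf_neq0.
  have [->|yn0] := eqVneq y 0; first by rewrite e0 normr0 C1 divr_ge0.
  have [->|ynpi] := eqVneq y pi; first by rewrite epi normr0 C1 divr_ge0.
  have y0' : 0 < y by rewrite lt_neqAle eq_sym yn0.
  have ypi' : y < pi by rewrite lt_neqAle ynpi.
  have yy : 0 < y < pi by rewrite y0' ypi'.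
  have := affine_end yy => /=; case: (leP y (pi - y)) => hy.
    rewrite subrr e0 addr0 => e.
    have := IH (y + y) _; rewrite e normrM ger0_norm// C1 => /(_ _) q.
    by rewrite ler_pdivlMr// mulrC q//; apply/andP; split; lra.
  have -> : y + (pi - y) = pi by ring.
  rewrite epi add0r => e.
  have := IH (y - (pi - y)) _; rewrite e normrM ger0_norm// C1 => /(_ _) q.
  by rewrite ler_pdivlMr// mulrC q//; apply/andP; split; lra.
have z y : 0 <= y <= pi -> sser h y = 0.
  move=> hy; apply/eqP; rewrite -normr_le0.
  apply: (cvgr_to_ge (cvg_geometric_bound C)); near=> n; exact: dec.
have zs : abs_summable (fun=> 0 : R) := abs_summable0.
have := @coef_sser R (fun=> 0) (fun=> 0) j zs j0.
have s0 x : sser (fun=> 0 : R) x = 0.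
  by rewrite /sser -[RHS](@tsum0 R); apply: eq_tsum => i _; rewrite mul0r.
move=> <-; last by move=> x _; rewrite s0.
rewrite (@coef_sser R (fun=> 0) h j hs j0)// => x; rewrite in_itv/= => hx.
by rewrite z.
Unshelve. all: by end_near. Qed.

End DuBoisReymond.

(** * The weak equation in modes *)

Section WeakForm.
Context {R : realType}.
Notation mu := (@lebesgue_measure R).

Lemma rintD (f g : R -> R) (a b k : R) : continuous f -> continuous g ->
  rint a b (fun x => f x + k * g x) = rint a b f + k * rint a b g.
Proof.
move=> cf cg.
have c : continuous (fun x => f x + k * g x).
  move=> x; apply: cvgD; first exact: cf.
  by apply: cvgMr; exact: cg.
rewrite (rint_ftc _ _ c (fun x => drvD ((primP cf).2 x) (drvZ k ((primP cg).2 x)))).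
by rewrite /rint; ring.
Qed.

Lemma near_oo (a b x : R) : a < x < b -> \forall y \near x, a < y < b.
Proof.
move=> /andP[ax xb]; near=> y; apply/andP; split; near: y.
- exact: lt_nbhsr.
- exact: lt_nbhsl.
Unshelve. all: by end_near. Qed.

Variables (m s : R) (u : R -> R -> R) (t : R).
Let A := coef_path u t.
Let A2 := dpath (dpath (coef_path u)) t.
Hypotheses (hs : 1 / 2 < s) (hu : Hstar (s + 2) (u t))
  (hA2 : (wsq (wH (s - 2)) A2 < +oo)%E).

Let As2 : abs_summable (fun j => j%:R * (j%:R * A j)).
Proof.
have sp : 1 / 2 < s + 2 - 2 by have h := hs; lra.
apply: abs_summable_ext (Hstar_summable sp hu) => j j0.
by rewrite powR_mulrn ?ler0n// expr2 mulrA.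
Qed.
Let As1 : abs_summable (fun j => j%:R * A j) := abs_summable_natM As2.
Let As0 : abs_summable A := abs_summable_natM As1.

Let A2s : abs_summable (fun j => A2 j / j%:R ^+ 2).
Proof.
have sp : 1 / 2 < s - 2 - (- 2) by have h := hs; lra.
have h := wsq_lty (fun j _ => powR_ge0 _ _) hA2.
apply: abs_summable_ext (abs_summable_sqr sp h) => j j0.
by rewrite powRN powR_mulrn ?ler0n// mulrC.
Qed.

Let uE : {in `[0, pi], u t =1 sser A}. Proof. exact: Hstar_sser hu As0. Qed.

Let u1E x : 0 < x < pi -> derive1 (u t) x = cser (fun j => j%:R * A j) x.
Proof.
move=> hx; apply: drv_derive1; apply: near_eq_is_derive (drv_sser x As1).
near=> y; apply/esym/uE; rewrite in_itv/=.
have : 0 < y < pi by near: y; exact: near_oo.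
by move=> /andP[/ltW -> /ltW ->].
Unshelve. all: by end_near. Qed.

Let u2E x : 0 < x < pi ->
  derive1n 2 (u t) x = sser (fun j => - (j%:R * (j%:R * A j))) x.
Proof.
move=> hx; apply: drv_derive1; apply: near_eq_is_derive (drv_cser x As2).
near=> y; apply/esym/u1E; near: y; exact: near_oo.
Unshelve. all: by end_near. Qed.

Definition kirchhoff (B : nat -> R) : R :=
  (2 * pi)^-1 * tsum (fun j => (j%:R * B j) ^+ 2).

(** The mode equation divided by [j ^ 2]; since [u_tt] is only in [H^(s - 2)],
    this is the form in which it is absolutely summable. *)
Definition residual j : R :=
  A2 j / j%:R ^+ 2 + (j%:R ^+ 2 + m + kirchhoff A) * A j.

Lemma residual_summable : abs_summable residual.
Proof.
apply: (@abs_summable_ext _ (fun j => A2 j / j%:R ^+ 2 +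
    (j%:R * (j%:R * A j) + (m + kirchhoff A) * A j))).
  by move=> j _; rewrite /residual; ring.
by apply: abs_summableD => //; apply: abs_summableD => //; exact: abs_summableZ.
Qed.

Lemma weak_formE eta : test_function eta ->
  weak_form m u t eta = tsum (fun j => residual j * (j%:R ^+ 2 * coef eta j)).
Proof.
move=> he; rewrite /weak_form.
have cu1 := cser_continuous As1.
have As2' : abs_summable (fun j => - (j%:R * (j%:R * A j))).
  by apply: abs_summable_le As2 => j _; rewrite normrN.
have cu2 := sser_continuous As2'.
have -> : \int[mu]_(x in `]0, pi[) (derive1 (u t) x ^+ 2) = tsum (fun j => (j%:R * A j) ^+ 2).
  rewrite -(parseval_cser As1); apply: Rintegral_oo_rint; first exact: pi_gt0.
    exact: continuousMM.
  by move=> x; rewrite in_itv/= => hx; rewrite u1E// expr2.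
have -> : 1 / (2 * pi) * tsum (fun j => (j%:R * A j) ^+ 2) = kirchhoff A.
  by rewrite /kirchhoff mul1r.
set k := m + _.
have ce1 := @test_continuous R eta 1 he; have ce2 := @test_continuous R eta 2 he.
have c2 := continuousMM cu2 ce2; have c1 := continuousMM cu1 ce1.
rewrite (@Rintegral_oo_rint R (fun x => sser (fun j => - (j%:R * (j%:R * A j))) x * derive1n 2 eta x
    + k * (cser (fun j => j%:R * A j) x * derive1n 1 eta x))); first last.
- move=> x xI; have hx : 0 < x < pi by move: xI; rewrite in_itv.
  by rewrite u2E// u1E// -[derive1 eta]/(derive1n 1 eta); ring.
- move=> x; apply: cvgD; first exact: c2.
  by apply: cvgMr; exact: c1.
- exact: pi_gt0.
rewrite rintD//.
have [E1 hE1] := test_bound 1 he; have [E2 hE2] := test_bound 2 he.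
have [q2s ->] := rint_tsum 0 pi As2' (@phi_continuous R) phi_bound ce2 hE2.
have [q1s ->] := rint_tsum 0 pi As1 (@psi_continuous R) psi_bound ce1 hE1.
have -> : utt_pairing u t eta = tsum (fun j => A2 j * coef eta j) by [].
have [E hE] := coef_test_bound he.
have q0s : abs_summable (fun j => A2 j * coef eta j).
  apply: (@abs_summable_ext _ (fun j => A2 j / j%:R ^+ 2 * (j%:R ^+ 2 * coef eta j))).
    move=> j j0; have jn : j%:R != 0 :> R by rewrite pnatr_eq0 -lt0n.
    by field.
  by apply: abs_summableM A2s _ => j _; exact: hE.
rewrite -tsumZ// -tsumD//; last exact: abs_summableZ.
rewrite -tsumD//; last by apply: abs_summableD => //; exact: abs_summableZ.
apply: eq_tsum => j j0; rewrite rint_phi_eta2// rint_psi_eta1//.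
have jn : j%:R != 0 :> R by rewrite pnatr_eq0 -lt0n.
by rewrite /residual /k; field.
Qed.

(** The weak form is the pairing of the second derivative of the series of
    residuals with the test function, so that [distribution_zero] applies. *)
Lemma weak_form_modes : (forall eta, test_function eta -> weak_form m u t eta = 0) <->
  forall j, (0 < j)%N -> A2 j = - ((j%:R ^+ 4 + (m + kirchhoff A) * j%:R ^+ 2) * A j).
Proof.
split=> [h j j0|h eta he].
  have := distribution_zero residual_summable (fun eta he => etrans (esym (weak_formE he)) (h eta he)) j0.
  have jn : j%:R != 0 :> R by rewrite pnatr_eq0 -lt0n.
  rewrite /residual => e.
  have -> : A2 j = j%:R ^+ 2 * (A2 j / j%:R ^+ 2) by field.
  have -> : A2 j / j%:R ^+ 2 = - ((j%:R ^+ 2 + m + kirchhoff A) * A j).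
    by apply/eqP; rewrite -subr_eq0 opprK; apply/eqP.
  by ring.
rewrite weak_formE// -[RHS](@tsum0 R); apply: eq_tsum => j j0.
have jn : j%:R != 0 :> R by rewrite pnatr_eq0 -lt0n.
by rewrite /residual h//; field.
Qed.

End WeakForm.

Section WeightedLimits.
Context {R : realType}.
Implicit Types (w : nat -> R).

Lemma wsq_term w (a : nat -> R) j : (forall i, (0 < i)%N -> 0 <= w i) -> (0 < j)%N ->
  ((w j * a j ^+ 2)%:E <= wsq w a)%E.
Proof.
move=> w0 j0; rewrite /wsq.
have g0 i : (1 <= i)%N -> true -> (0 <= (w i * a i ^+ 2)%:E)%E.
  by move=> i0 _; rewrite lee_fin mulr_ge0 ?sqr_ge0// w0.
apply: le_trans (nneseries_lim_ge j.+1 g0).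
rewrite sumEFin lee_fin big_nat_recr//= lerDr big_nat sumr_ge0// => i /andP[i0 _].
by rewrite mulr_ge0 ?sqr_ge0// w0.
Qed.

Lemma wsq_near (T : Type) (F : set_system T) {FF : Filter F} (x : T -> nat -> R) w :
  (wsq w (x t) @[t --> F] --> 0%E) -> forall d, 0 < d ->
  \forall t \near F, (wsq w (x t) < d%:E)%E.
Proof.
move=> /fine_cvgP[fin cf] d d0.
move/cvgrPdist_lt: cf => /(_ _ d0) cf.
apply: filterS2 fin cf => t f1 f2.
rewrite -(fineK f1) lte_fin; move: f2; rewrite sub0r normrN.
by move=> h; exact: le_lt_trans (ler_norm _) h.
Qed.

Lemma wsq_cvg_term (T : Type) (F : set_system T) {FF : Filter F} (x : T -> nat -> R) w j :
  (forall i, (0 < i)%N -> 0 < w i) -> (0 < j)%N ->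
  (wsq w (x t) @[t --> F] --> 0%E) -> (fun t => x t j) @ F --> (0 : R).
Proof.
move=> w0 j0 h; apply/cvgrPdist_le => e e0.
have we : 0 < w j * e ^+ 2 by rewrite mulr_gt0 ?w0// exprn_gt0.
have hn : \forall t \near F, (wsq w (x t) < (w j * e ^+ 2)%:E)%E by exact: wsq_near.
apply: filterS hn => t ht; rewrite sub0r normrN.
have w0' i : (0 < i)%N -> 0 <= w i by move=> i0; rewrite ltW// w0.
have := le_lt_trans (wsq_term (x t) w0' j0) ht.
rewrite lte_fin ltr_pM2l ?w0// => h2.
rewrite -(ler_pXn2r (n := 2))// ?nnegrE ?(ltW e0)//.
by rewrite real_normK ?num_real// ltW.
Qed.

(** Dominated convergence in weighted square-summable sequences. *)
Lemma cvg_wsq0 (T : Type) (F : set_system T) {FF : ProperFilter F} (x : T -> nat -> R) w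
    (mj : nat -> R) :
  (forall i, (0 < i)%N -> 0 <= w i) -> abs_summable mj ->
  (\forall t \near F, forall j, (0 < j)%N -> w j * x t j ^+ 2 <= mj j) ->
  (forall j, (0 < j)%N -> (fun t => x t j) @ F --> (0 : R)) ->
  wsq w (x t) @[t --> F] --> 0%E.
Proof.
move=> w0 ms dom lim.
have c : (fun t => tsum (fun j => w j * x t j ^+ 2)) @ F --> tsum (fun=> 0 : R).
  apply: (@tannery R T F _ (fun t j => w j * x t j ^+ 2) (fun=> 0) mj ms).
    apply: filterS dom => t ht j j0; rewrite ger0_norm; first exact: ht.
    by rewrite mulr_ge0 ?sqr_ge0// w0.
  move=> j j0; rewrite -(mulr0 (w j)); apply: cvgMr.
  rewrite (_ : 0 = 0 * 0 :> R); last by rewrite mulr0.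
  by rewrite (_ : (fun t => _) = (fun t => x t j * x t j)); [apply: cvgM; exact: lim|apply: funext => t; rewrite expr2].
rewrite tsum0 in c.
have E : \forall t \near F, wsq w (x t) = (tsum (fun j => w j * x t j ^+ 2))%:E.
  apply: filterS dom => t ht; apply: wsqE => //.
  apply: abs_summable_le ms => j j0.
  have p0 : 0 <= w j * x t j ^+ 2 by rewrite mulr_ge0 ?sqr_ge0// w0.
  by rewrite ger0_norm//; apply: le_trans (ht j j0) (ler_norm _).
apply/fine_cvgP; split; first by apply: filterS E => t ->.
apply: cvg_trans c; apply: near_eq_cvg.
by apply: filterS E => t /= ->.
Qed.

(** The inequality of Young, the form of Cauchy-Schwarz used for series. *)
Lemma young_scaled (y q d : R) : 0 < q -> 0 < d ->
  y <= (2 * d)^-1 * (q * y ^+ 2) + d / 2 * q^-1.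
Proof.
move=> q0 d0.
have -> : (2 * d)^-1 * (q * y ^+ 2) + d / 2 * q^-1 = ((q * y - d) ^+ 2) / (2 * d * q) + y.
  by field; rewrite !gt_eqF.
by rewrite lerDr divr_ge0 ?sqr_ge0// !mulr_ge0// ltW.
Qed.

(** By [young_scaled] the sum is at most a small multiple of the convergent sum
    of [j `^ (- (2 * s))] plus a large multiple of the weighted norm, which is
    eventually smaller.  This makes sine series converge uniformly. *)
Lemma wsq_cvg_l1 (T : Type) (F : set_system T) {FF : Filter F} (s : R) (x : T -> nat -> R) :
  1 / 2 < s -> (wsq (wH s) (x t) @[t --> F] --> 0%E) ->
  forall e, 0 < e -> \forall t \near F, abs_summable (x t) /\ tsum (fun j => `|x t j|) <= e.
Proof.
move=> s2 h e e0.
have sz : abs_summable (fun j => j%:R `^ (- (2 * s)) : R) by apply: abs_summable_powR; lra.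
pose Z := tsum (fun j => j%:R `^ (- (2 * s)) : R).
have Z0 : 0 <= Z by apply: tsum_ge0 => // j _; exact: powR_ge0.
pose d := e / (Z + 1).
have d0 : 0 < d by rewrite divr_gt0// ltr_wpDl.
have de0 : 0 < d * e by rewrite mulr_gt0.
have hn : \forall t \near F, (wsq (wH s) (x t) < (d * e)%:E)%E by exact: wsq_near.
apply: filterS hn => t ht.
have w0 j : (0 < j)%N -> 0 <= wH s j by move=> _; exact: powR_ge0.
have st := wsq_lty w0 (lt_trans ht (ltry _)).
rewrite wsqE// lte_fin in ht.
have key j : (0 < j)%N -> `|x t j| <= (2 * d)^-1 * (wH s j * x t j ^+ 2) + d / 2 * j%:R `^ (- (2 * s)).
  move=> j0; have jp : 0 < j%:R `^ (2 * s) :> R by apply: powR_gt0; rewrite ltr0n.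
  rewrite /wH powRN -[x t j ^+ 2]real_normK ?num_real//.
  exact: young_scaled.
have sx : abs_summable (x t).
  apply: abs_summable_le (abs_summableD (abs_summableZ (2 * d)^-1 st) (abs_summableZ (d / 2) sz)) => j j0.
  exact: le_trans (key j j0) (ler_norm _).
split => //.
have sx' : abs_summable (fun j => `|x t j|).
  by apply: abs_summable_le sx => j _; rewrite normr_id.
apply: le_trans (tsum_le sx' (abs_summableD (abs_summableZ (2 * d)^-1 st) (abs_summableZ (d / 2) sz)) key) _.
rewrite tsumD ?tsumZ//; [|exact: abs_summableZ|exact: abs_summableZ].
apply: (@le_trans _ _ ((2 * d)^-1 * (d * e) + d / 2 * Z)).
  by rewrite lerD2r; apply: ler_wpM2l; [rewrite invr_ge0 mulr_ge0// ltW|exact: ltW].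
have -> : (2 * d)^-1 * (d * e) = e / 2 by field; rewrite gt_eqF.
have : d * Z <= e.
  rewrite /d mulrAC ler_pdivrMr; last by rewrite ltr_wpDl.
  by rewrite ler_pM2l//; lra.
lra.
Qed.

End WeightedLimits.

(** * Modes of a weak solution *)

Section WeakSolutionModes.
Context {R : realType}.
Variables (m s : R) (u0 v0 : R -> R) (I : set R) (u : R -> R -> R).
Hypotheses (hm1 : - (1 / 2) <= m) (hm2 : m <= 1) (hs : 1 / 2 < s).
Hypothesis sol : weak_solution m s u0 v0 I u.

Let A := coef_path u.
Let V := dpath A.
Let VV := dpath V.

Lemma wH_gt0 (r : R) i : (0 < i)%N -> 0 < wH r i.
Proof. by move=> i0; apply: powR_gt0; rewrite ltr0n. Qed.

Lemma wH_ge0 (r : R) i : (0 < i)%N -> 0 <= wH r i.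
Proof. by move=> i0; exact: powR_ge0. Qed.

Lemma path_derivative_drv (r : R) (X Y : R -> nat -> R) t j : path_derivative r I X Y ->
  I t -> (0 < j)%N -> is_derive t 1 (X^~ j) (Y t j).
Proof.
move=> h It j0; apply/is_deriveP.
have c0 : (fun z => (X (t + z) j - X t j) / z - Y t j) @ (0 : R)^' --> (0 : R).
  exact: wsq_cvg_term (@wH_gt0 r) j0 (h t It).
have c1 : (fun z => ((X (t + z) j - X t j) / z - Y t j) + Y t j) @ (0 : R)^' --> 0 + Y t j.
  by apply: cvgD; [exact: c0|exact: cvg_cst].
rewrite add0r in c1; apply: cvg_trans c1; apply: near_eq_cvg.
by near=> z; rewrite /= subrK.
Unshelve. all: by end_near. Qed.

Let C2 : C2_path s I u. Proof. by case: sol. Qed.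

Let hH t : I t -> Hstar (s + 2) (u t). Proof. by case: C2 => h _ _ _; exact: h. Qed.

Lemma modes_drv t j : I t -> (0 < j)%N ->
  is_derive t 1 (A^~ j) (V t j) /\ is_derive t 1 (V^~ j) (VV t j).
Proof.
move=> It j0; case: C2 => _ _ [d1 _] [d2 _].
by split; [exact: path_derivative_drv d1 It j0|exact: path_derivative_drv d2 It j0].
Qed.

Lemma modes_eq t j : I t -> (0 < j)%N ->
  VV t j = - ((j%:R ^+ 4 + (m + kirchhoff (A t)) * j%:R ^+ 2) * A t j).
Proof.
move=> It j0; case: sol => _ _ _ _ wf.
have fin : (wsq (wH (s - 2)) (VV t) < +oo)%E.
  by case: C2 => _ _ _ [_ h]; have [] := h t It.
have /(_ _) := (weak_form_modes m hs (hH It) fin).1 (fun eta he => wf eta he t It).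
exact.
Qed.

Definition modeA (t : R) (j : nat) : R := j%:R * A t j.
Definition modeB (t : R) (j : nat) : R := j%:R * V t j / omega m j.
Definition modeK (t : R) : R := (2 * pi)^-1 * tsum (fun j => modeA t j ^+ 2).

Lemma modes_ode t : I t -> mode_ode m modeA modeB modeK t.
Proof.
move=> It [|j].
  rewrite /modeA /modeB; split.
    rewrite (_ : (fun x => _) = fun=> 0); last by apply: funext => x; rewrite mul0r.
    by rewrite !(mul0r, mulr0); exact: drvC.
  rewrite (_ : (fun x => _) = fun=> 0); last by apply: funext => x; rewrite !mul0r.
  by rewrite !(mul0r, mulr0, subr0, oppr0); exact: drvC.
have [dA dV] := modes_drv It (ltn0Sn j).
have o0 := omega_gt0 hm1 hm2 (ltn0Sn j).
have o2 := omega_sqr hm1 hm2 j.+1.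
split.
  apply: drv_eq (drvZ _ dA) _; rewrite /modeB.
  by move: (omega m j.+1) o0 => o o0; field; rewrite gt_eqF.
rewrite (_ : modeB^~ j.+1 = fun t => j.+1%:R / omega m j.+1 * V t j.+1); last first.
  by apply: funext => x; rewrite /modeB mulrAC.
apply: drv_eq (drvZ _ dV) _; rewrite modes_eq// /modeA /lam.
rewrite -[modeK t]/(kirchhoff (A t)).
have -> : j.+1%:R ^+ 4 + (m + kirchhoff (A t)) * j.+1%:R ^+ 2 =
   omega m j.+1 ^+ 2 + kirchhoff (A t) * j.+1%:R ^+ 2 by rewrite o2; ring.
by move: (omega m j.+1) o0 => o o0; field; rewrite gt_eqF.
Qed.

Let sqr_le_wH j : (0 < j)%N -> j%:R ^+ 2 <= wH (s + 2) j :> R.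
Proof.
move=> j0; rewrite /wH -powR_mulrn ?ler0n//; apply: ler_powR; first by rewrite ler1n.
by have h := hs; lra.
Qed.

Let A_summable t : I t -> abs_summable (fun j => wH (s + 2) j * A t j ^+ 2).
Proof. by move=> It; have [h _] := hH It; exact: wsq_lty (@wH_ge0 _) h. Qed.

Let dom_H1 (x : nat -> R) : abs_summable (fun j => wH (s + 2) j * x j ^+ 2) ->
  abs_summable (fun j => (j%:R * x j) ^+ 2).
Proof.
apply: abs_summable_le => j j0; rewrite (ger0_norm (sqr_ge0 _)).
rewrite (ger0_norm (mulr_ge0 (wH_ge0 _ j0) (sqr_ge0 _))).
by rewrite exprMn; apply: ler_wpM2r; [exact: sqr_ge0|exact: sqr_le_wH].
Qed.

Lemma modeA_summable t : I t -> abs_summable (fun j => modeA t j ^+ 2).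
Proof. by move=> It; apply: dom_H1; exact: A_summable. Qed.

Lemma modeK_ge0 t : I t -> 0 <= modeK t.
Proof.
move=> It; rewrite mulr_ge0//; first by rewrite invr_ge0 mulr_ge0// pi_ge0.
by apply: tsum_ge0 => [|j _]; [exact: modeA_summable|exact: sqr_ge0].
Qed.

Let K t := tsum (fun j => modeA t j ^+ 2).

Lemma sqr_close (x y d : R) : 0 < d -> `|x ^+ 2 - y ^+ 2| <= d * y ^+ 2 + (1 + d^-1) * (x - y) ^+ 2.
Proof.
move=> d0; have -> : x ^+ 2 - y ^+ 2 = (x - y) ^+ 2 + 2 * y * (x - y) by ring.
have h1 : 0 <= d * (y + d^-1 * (x - y)) ^+ 2 by rewrite mulr_ge0 ?sqr_ge0// ltW.
have h2 : 0 <= d * (y - d^-1 * (x - y)) ^+ 2 by rewrite mulr_ge0 ?sqr_ge0// ltW.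
have dn : d != 0 by rewrite gt_eqF.
have e1 : d * (y + d^-1 * (x - y)) ^+ 2 = d * y ^+ 2 + 2 * y * (x - y) + d^-1 * (x - y) ^+ 2 by field.
have e2 : d * (y - d^-1 * (x - y)) ^+ 2 = d * y ^+ 2 - 2 * y * (x - y) + d^-1 * (x - y) ^+ 2 by field.
rewrite {}e1 in h1; rewrite {}e2 in h2; have h3 := sqr_ge0 (x - y).
have -> : (1 + d^-1) * (x - y) ^+ 2 = (x - y) ^+ 2 + d^-1 * (x - y) ^+ 2 by ring.
move: (d * y ^+ 2) (2 * y * (x - y)) (d^-1 * (x - y) ^+ 2) ((x - y) ^+ 2) h1 h2 h3 => p q r v h1 h2 h3.
by rewrite ler_norml; apply/andP; split; lra.
Qed.

(** The Kirchhoff term is continuous in time because the solution is continuous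
    in a space smaller than [H^1]; together with [modeK_bounded] this makes the
    growth bounds of the modes available. *)
Lemma modeK_continuous t : I t -> {for t, continuous K}.
Proof.
move=> It; apply/cvgrPdist_le => e e0.
have [oI _ _] : [/\ open I, is_interval I & I 0] by case: sol.
have pc : path_continuous (s + 2) I A by case: C2.
have K0 : 0 <= K t by apply: tsum_ge0 => [|j _]; [exact: modeA_summable|exact: sqr_ge0].
pose d := e / (2 * (K t + 1)).
have d0 : 0 < d by rewrite divr_gt0// mulr_gt0// ltr_wpDl.
pose q := e / (2 * (1 + d^-1)).
have q1 : 0 < 1 + d^-1 by rewrite ltr_wpDr// invr_ge0 ltW.
have q0 : 0 < q by rewrite divr_gt0// mulr_gt0.
have hn : \forall t' \near t, (wsq (wH (s + 2)%R) (fun j => A t' j - A t j)%R < q%:E)%E.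
  exact: (wsq_near (pc t It).2 q0).
have nI : \forall t' \near t, I t' by exact: open_nbhs_nbhs.
near=> t'.
have It' : I t' by near: t'.
have ht' : (wsq (wH (s + 2)%R) (fun j => A t' j - A t j)%R < q%:E)%E by near: t'; exact: hn.
have st' := wsq_lty (@wH_ge0 _) (lt_trans ht' (ltry _)).
rewrite wsqE// in ht'; last by move=> j; exact: wH_ge0.
rewrite lte_fin in ht'.
have sd := dom_H1 st'.
have s1 := modeA_summable It'; have s2 := modeA_summable It.
have KE : K t - K t' = tsum (fun j => modeA t j ^+ 2 + -1 * modeA t' j ^+ 2).
  by rewrite tsumD ?tsumZ//; [rewrite mulN1r|exact: abs_summableZ].
rewrite KE.
apply: (@le_trans _ _ (tsum (fun j => d * modeA t j ^+ 2 + (1 + d^-1) * (j%:R * (A t' j - A t j)) ^+ 2))).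
  apply: ler_norm_tsum; first by apply: abs_summableD; exact: abs_summableZ.
  move=> j _; rewrite mulN1r distrC; have := sqr_close (modeA t' j) (modeA t j) d0.
  by rewrite /modeA -mulrBr.
rewrite tsumD; [|exact: abs_summableZ|exact: abs_summableZ].
rewrite !tsumZ// -/(K t).
have h1 : d * K t <= e / 2.
  rewrite /d -(ler_pM2r (_ : 0 < 2 * (K t + 1))); last by rewrite mulr_gt0// ltr_wpDl.
  rewrite mulrAC divfK; last by rewrite gt_eqF// mulr_gt0// ltr_wpDl.
  have -> : e / 2 * (2 * (K t + 1)) = e * K t + e by field.
  by rewrite lerDl ltW.
have h2 : (1 + d^-1) * tsum (fun j => (j%:R * (A t' j - A t j)) ^+ 2) <= e / 2.
  have h3 : tsum (fun j => (j%:R * (A t' j - A t j)) ^+ 2) <= q.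
    apply: le_trans (ltW ht'); apply: tsum_le => // j j0.
    by rewrite exprMn; apply: ler_wpM2r; [exact: sqr_ge0|exact: sqr_le_wH].
  apply: le_trans (ler_wpM2l (ltW q1) h3) _.
  by rewrite /q; move: (1 + d^-1) q1 => k k0; apply: le_of_eq; field; rewrite gt_eqF.
lra.
Unshelve. all: by end_near. Qed.

Lemma between_I T t : I T -> between0 T t -> I t.
Proof.
move=> IT; have [[_ itv I0] _ _ _ _] := sol.
by move=> [/(itv _ _ I0 IT)|/(itv _ _ IT I0)].
Qed.

Lemma modeK_bounded T : I T -> exists M, forall t, between0 T t -> 0 <= modeK t <= M.
Proof.
move=> IT.
have [T0|T0] := leP 0 T.
- have cK : {within `[0, T], continuous K}.
    apply: continuous_in_subspaceT => x; rewrite inE /= in_itv/= => hx.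
    by apply: modeK_continuous; apply: between_I IT _; left.
  have [c _ hc] := EVT_max T0 cK.
  exists ((2 * pi)^-1 * K c) => t bt; rewrite modeK_ge0; last exact: between_I IT bt.
  apply: ler_wpM2l; first by rewrite invr_ge0 mulr_ge0// pi_ge0.
  by apply: hc; rewrite in_itv/=; case: bt => // /andP[h1 h2]; apply/andP; split; lra.
- have cK : {within `[T, 0], continuous K}.
    apply: continuous_in_subspaceT => x; rewrite inE /= in_itv/= => hx.
    by apply: modeK_continuous; apply: between_I IT _; right.
  have [c _ hc] := EVT_max (ltW T0) cK.
  exists ((2 * pi)^-1 * K c) => t bt; rewrite modeK_ge0; last exact: between_I IT bt.
  apply: ler_wpM2l; first by rewrite invr_ge0 mulr_ge0// pi_ge0.
  by apply: hc; rewrite in_itv/=; case: bt => // /andP[h1 h2]; apply/andP; split; lra.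
Qed.

Lemma coef_initial j : A 0 j = coef u0 j.
Proof.
have [_ _ h _ _] := sol.
rewrite /A /coef_path /coef; apply: eq_Rintegral => x; rewrite inE => /= hx.
by rewrite h.
Qed.

(** The derivative of [u] at time [0] is prescribed pointwise, whereas the modes
    are differentiated in [H^s]; the latter convergence is uniform in [x], so
    both derivatives agree. *)
Lemma coef_initial_velocity j : (0 < j)%N -> V 0 j = coef v0 j.
Proof.
move=> j0; have [[oI _ I0] _ _ hv _] := sol.
have [_ _ [pd pc] _] := C2.
have [Vfin _] := pc 0 I0.
have Vs : abs_summable (V 0).
  have s0 : 1 / 2 < s - 0 by have h := hs; lra.
  apply: abs_summable_ext (abs_summable_sqr s0 (wsq_lty (@wH_ge0 _) Vfin)) => i _.
  by rewrite powRr0 mul1r.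
have As t : I t -> abs_summable (A t).
  by move=> It; apply: Hstar_abs_summable (hH It); have h := hs; lra.
apply/esym/(coef_sser Vs j0) => x hx.
have hx' : x \in `[0, pi] by [].
have /is_deriveP c1 := hv x hx'.
suff c2 : (fun h => (u (0 + h) x - u 0 x) / h) @ (0 : R)^' --> sser (V 0) x.
  exact: cvg_unique c1 c2.
apply/cvgrPdist_le => e e0.
have n0 := @phi_max_ge0 R.
have e1 : 0 < e / (phi_max + 1) by rewrite divr_gt0// ltr_wpDl.
have c3 := wsq_cvg_l1 hs (pd 0 I0) e1.
have nI : \forall h \near (0 : R)^', I (0 + h).
  have : \forall t \near (0 : R), I t by exact: open_nbhs_nbhs.
  by move=> /nbhs_dnbhs; apply: filterS => h; rewrite add0r.
near=> h.
have Ih : I (0 + h) by near: h; exact: nI.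
have h0 : h != 0 by near: h; exact: nbhs_dnbhs_neq.
have [c4 c5] : abs_summable (fun j => (A (0 + h) j - A 0 j) / h - V 0 j) /\
  tsum (fun j => `|(A (0 + h) j - A 0 j) / h - V 0 j|) <= e / (phi_max + 1).
  by near: h; exact: c3.
have uE t : I t -> u t x = sser (A t) x.
  by move=> It; apply: (Hstar_sser (hH It)) => //; exact: As.
rewrite !uE// distrC.
have -> : (sser (A (0 + h)) x - sser (A 0) x) / h - sser (V 0) x =
  sser (fun j => (A (0 + h) j - A 0 j) / h - V 0 j) x.
  have q1 := sser_summable x (As _ Ih); have q2 := sser_summable x (As _ I0).
  have q3 := sser_summable x Vs.
  rewrite [in RHS]/sser (@eq_tsum _ _ (fun j => (h^-1 * (A (0 + h) j * phi j x) + (- h^-1) * (A 0 j * phi j x)) + (-1) * (V 0 j * phi j x))); last first.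
    by move=> i _; ring.
  rewrite tsumD; [|by apply: abs_summableD; exact: abs_summableZ|exact: abs_summableZ].
  rewrite tsumD; [|exact: abs_summableZ|exact: abs_summableZ].
  by rewrite !tsumZ// /sser; ring.
apply: le_trans (sser_bound x c4) _.
apply: le_trans (ler_wpM2l n0 c5) _.
rewrite mulrC mulrAC ler_pdivrMr; last by rewrite ltr_wpDl.
by apply: ler_wpM2l; [exact: ltW|rewrite lerDl].
Unshelve. all: by end_near. Qed.

End WeakSolutionModes.

(** * Existence for the truncated mode equations *)

Section ModesExist.
Context {R : realType}.
Variables (m c M0 : R) (a0 b0 : nat -> R).
Hypotheses (c0 : 0 < c) (hc : forall j, 0 <= lam m j <= c) (M00 : 0 <= M0).
Local Notation om := (omega m).
Let w j := `|a0 j| + `|b0 j|.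
Hypothesis ws : abs_summable (fun j => w j ^+ 2).

Let w0 j : 0 <= w j. Proof. by rewrite addr_ge0. Qed.

(** The unknowns of the initial value problem are the modes in the frame that
    rotates with their own frequencies.  There the field has linear
    growth and is Lipschitz relative to the weight, although the frequencies are unbounded. *)
Definition unrotA (t : R) (x : bool * nat -> R) (j : nat) : R :=
  cos (om j * t) * x (true, j) + sin (om j * t) * x (false, j).

Definition unrotB (t : R) (x : bool * nat -> R) (j : nat) : R :=
  cos (om j * t) * x (false, j) - sin (om j * t) * x (true, j).

(** The Kirchhoff term is truncated at [M0], which gives the field linear
    growth and makes its solutions global. *)
Definition truncK (t : R) (x : bool * nat -> R) : R :=
  Num.min ((2 * pi)^-1 * tsum (fun j => unrotA t x j ^+ 2)) M0.

Definition rotField (t : R) (x : bool * nat -> R) (i : bool * nat) : R :=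
  truncK t x * (lam m i.2 * unrotA t x i.2) *
  (if i.1 then sin (om i.2 * t) else - cos (om i.2 * t)).

Let W (i : bool * nat) := w i.2.

Let bound2 (p q r s k : R) : `|p| <= 1 -> `|q| <= 1 -> `|r| <= k -> `|s| <= k ->
  `|p * r + q * s| <= 2 * k.
Proof.
move=> p1 q1 rk sk; apply: le_trans (ler_normD _ _) _.
have h1 : `|p * r| <= k by rewrite normrM -[leRHS]mul1r; exact: ler_pM.
have h2 : `|q * s| <= k by rewrite normrM -[leRHS]mul1r; exact: ler_pM.
by have := lerD h1 h2; lra.
Qed.

Lemma unrotA_bound t x C : (forall i, `|x i| <= C * W i) ->
  forall j, `|unrotA t x j| <= 2 * (C * w j).
Proof.
move=> h j; apply: bound2; [exact: cos_max|exact: sin_max|exact: (h (true, j))|exact: (h (false, j))].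
Qed.

Lemma unrotB_bound t x C : (forall i, `|x i| <= C * W i) ->
  forall j, `|unrotB t x j| <= 2 * (C * w j).
Proof.
move=> h j; rewrite /unrotB -mulNr; apply: bound2; [exact: cos_max|rewrite normrN; exact: sin_max|exact: (h (false, j))|exact: (h (true, j))].
Qed.

Let unrotA_sub t x y j : unrotA t x j - unrotA t y j = unrotA t (fun i => x i - y i) j.
Proof. by rewrite /unrotA; ring. Qed.

Let sA t x C : 0 <= C -> (forall i, `|x i| <= C * W i) -> abs_summable (fun j => unrotA t x j ^+ 2).
Proof.
move=> C0 h; apply: abs_summable_le (abs_summableZ (4 * C ^+ 2) ws) => j _.
rewrite ger0_norm ?sqr_ge0// (le_trans _ (ler_norm _))//.
have := unrotA_bound t h j.
rewrite -(ler_pXn2r (n := 2))// ?nnegrE ?mulr_ge0// real_normK ?num_real// => q.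
by apply: le_trans q _; apply: le_of_eq; ring.
Qed.

Let truncK_bound t x C : 0 <= C -> (forall i, `|x i| <= C * W i) -> 0 <= truncK t x <= M0.
Proof.
move=> C0 h; rewrite /truncK le_min ge_min M00 lexx orbT !andbT.
rewrite mulr_ge0//; first by rewrite invr_ge0 mulr_ge0// pi_ge0.
by apply: tsum_ge0 => [|j _]; [exact: sA h|exact: sqr_ge0].
Qed.

Let field_bound t x C : 0 <= C -> (forall i, `|x i| <= C * W i) ->
  forall i, `|rotField t x i| <= M0 * (c * (2 * (C * W i))).
Proof.
move=> C0 h i; have /andP[k0 k1] := truncK_bound t C0 h.
have /andP[l0 l1] := hc i.2.
rewrite /rotField normrM -[leRHS]mulr1; apply: ler_pM => //.
  rewrite normrM; apply: ler_pM => //; first by rewrite ger0_norm.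
  rewrite normrM; apply: ler_pM => //; first by rewrite ger0_norm.
  exact: unrotA_bound.
by case: ifP => _; rewrite ?normrN; [exact: sin_max|exact: cos_max].
Qed.

Let min_lip (x y : R) : `|Num.min x M0 - Num.min y M0| <= `|x - y|.
Proof.
rewrite !minr_absE.
have -> : (x + M0 - `|x - M0|) / 2 - (y + M0 - `|y - M0|) / 2 =
   ((x - y) + (`|y - M0| - `|x - M0|)) / 2 by field.
rewrite normrM normfV (ger0_norm (_ : 0 <= 2 :> R))// ler_pdivrMr//.
apply: le_trans (ler_normD _ _) _.
have : `| `|y - M0| - `|x - M0| | <= `|x - y|.
  apply: le_trans (ler_dist_dist _ _) _.
  by rewrite (_ : y - M0 - (x - M0) = - (x - y)) ?normrN//; ring.
lra.
Qed.

Let Z := tsum (fun j => w j ^+ 2).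

Let full_lip t x y C d : 0 <= C -> 0 <= d -> (forall i, `|x i| <= C * W i) ->
  (forall i, `|y i| <= C * W i) -> (forall i, `|x i - y i| <= d * W i) ->
  `|truncK t x - truncK t y| <= 2 * C * Z * d.
Proof.
move=> C0 d0 hx hy hxy; apply: le_trans (min_lip _ _) _.
have s1 := sA t C0 hx; have s2 := sA t C0 hy.
have s2' := abs_summableZ (-1) s2.
have -> : (2 * pi)^-1 * tsum (fun j => unrotA t x j ^+ 2) - (2 * pi)^-1 * tsum (fun j => unrotA t y j ^+ 2) =
  (2 * pi)^-1 * tsum (fun j => unrotA t x j ^+ 2 + -1 * unrotA t y j ^+ 2).
  by rewrite tsumD// tsumZ//; ring.
have p0 : 0 <= (2 * pi)^-1 :> R by rewrite invr_ge0 mulr_ge0// pi_ge0.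
rewrite normrM (ger0_norm p0).
have h : `|tsum (fun j => unrotA t x j ^+ 2 + -1 * unrotA t y j ^+ 2)| <= 8 * C * d * Z.
  rewrite -tsumZ//; apply: ler_norm_tsum; first exact: abs_summableZ.
  move=> j _.
  have -> : unrotA t x j ^+ 2 + -1 * unrotA t y j ^+ 2 =
    (unrotA t x j - unrotA t y j) * (unrotA t x j + unrotA t y j) by ring.
  rewrite normrM unrotA_sub.
  have q1 := unrotA_bound t hxy j.
  have q2 : `|unrotA t x j + unrotA t y j| <= 4 * (C * w j).
    apply: le_trans (ler_normD _ _) _.
    by have := unrotA_bound t hx j; have := unrotA_bound t hy j; lra.
  apply: le_trans (ler_pM _ _ q1 q2) _ => //.
  by apply: le_of_eq; ring.
apply: le_trans (ler_pM p0 (normr_ge0 _) (@inv2pi_le R) h) _.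
by apply: le_of_eq; field.
Qed.

Let Z_ge0 : 0 <= Z. Proof. by apply: tsum_ge0 => // j _; exact: sqr_ge0. Qed.

Let field_lip C : 0 <= C -> exists L : R, 0 < L /\
  forall t x y d, 0 <= d -> (forall j, `|x j| <= C * W j) ->
    (forall j, `|y j| <= C * W j) ->
    (forall j, `|x j - y j| <= d * W j) ->
    forall j, `|rotField t x j - rotField t y j| <= L * (d * W j).
Proof.
move=> C0; have z0 := Z_ge0.
exists (4 * c * C ^+ 2 * Z + 2 * c * M0 + 1); split.
  by rewrite ltr_wpDl// addr_ge0// !mulr_ge0 ?exprn_ge0 ?(ltW c0).
move=> t x y d d0 hx hy hxy i.
have /andP[l0 l1] := hc i.2.
have /andP[k0 k1] := truncK_bound t C0 hx.
have wi : 0 <= W i by exact: w0.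
set sg := if i.1 then sin (om i.2 * t) else - cos (om i.2 * t).
have sg1 : `|sg| <= 1 by rewrite /sg; case: ifP => _; rewrite ?normrN; [exact: sin_max|exact: cos_max].
have -> : rotField t x i - rotField t y i =
  (truncK t x * (lam m i.2 * (unrotA t x i.2 - unrotA t y i.2)) +
   (truncK t x - truncK t y) * (lam m i.2 * unrotA t y i.2)) * sg.
  by rewrite /rotField -/sg; ring.
rewrite normrM.
have h1 : `|truncK t x * (lam m i.2 * (unrotA t x i.2 - unrotA t y i.2))| <= M0 * (c * (2 * (d * W i))).
  rewrite normrM (ger0_norm k0); apply: ler_pM => //.
  rewrite normrM (ger0_norm l0); apply: ler_pM => //.
  by rewrite unrotA_sub; exact: unrotA_bound.
have h2 : `|(truncK t x - truncK t y) * (lam m i.2 * unrotA t y i.2)| <= (2 * C * Z * d) * (c * (2 * (C * W i))).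
  rewrite normrM; apply: ler_pM => //; first exact: full_lip.
  rewrite normrM (ger0_norm l0); apply: ler_pM => //.
  exact: unrotA_bound.
apply: le_trans (ler_pM _ _ (le_trans (ler_normD _ _) (lerD h1 h2)) sg1) _ => //.
apply: (@le_trans _ _ ((4 * c * C ^+ 2 * Z + 2 * c * M0) * (d * W i))).
  by apply: le_of_eq; ring.
by apply: ler_wpM2r; [exact: mulr_ge0|rewrite lerDl].
Qed.

Let cosc (k : R) : continuous (fun z : R => cos (k * z)).
Proof. by move=> x; exact: is_derive_continuous (drv_cos k x). Qed.

Let sinc (k : R) : continuous (fun z : R => sin (k * z)).
Proof. by move=> x; exact: is_derive_continuous (drv_sin k x). Qed.

Let unrotA_continuous (x : R -> bool * nat -> R) j : (forall i, continuous (x^~ i)) ->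
  continuous (fun t => unrotA t (x t) j).
Proof.
move=> xc t; apply: cvgD; apply: cvgM; try exact: xc; [exact: cosc|exact: sinc].
Qed.

Let field_continuous (x : R -> bool * nat -> R) :
  (forall i, continuous (x^~ i)) ->
  (forall T : R, exists C : R, 0 <= C /\ forall t i, `|t| <= T -> `|x t i| <= C * W i) ->
  forall i, continuous (fun t => rotField t (x t) i).
Proof.
move=> xc xb i t.
have kc : (fun t => truncK t (x t)) @ t --> truncK t (x t).
  have [C [C0 hC]] := xb (`|t| + 1).
  have fc : (fun t => (2 * pi)^-1 * tsum (fun j => unrotA t (x t) j ^+ 2)) @ t -->
      (2 * pi)^-1 * tsum (fun j => unrotA t (x t) j ^+ 2).
    apply: cvgMr.
    apply: (@tannery R R (nbhs t) _ (fun t j => unrotA t (x t) j ^+ 2) (fun j => unrotA t (x t) j ^+ 2)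
       (fun j => 4 * C ^+ 2 * w j ^+ 2)).
    - exact: abs_summableZ.
    - near=> t' => j _; rewrite ger0_norm ?sqr_ge0//.
      have t'T : `|t'| <= `|t| + 1 by near: t'; exact: near_norm_le.
      have := unrotA_bound t' (fun i => hC t' i t'T) j.
      rewrite -(ler_pXn2r (n := 2))// ?nnegrE ?mulr_ge0// real_normK ?num_real// => q.
      by apply: le_trans q _; apply: le_of_eq; ring.
    - move=> j _; have := @unrotA_continuous x j xc t => h.
      rewrite (_ : (fun t => unrotA t (x t) j ^+ 2) = fun t => unrotA t (x t) j * unrotA t (x t) j).
        by rewrite expr2; apply: cvgM.
      by apply: funext => z; rewrite expr2.
  apply/cvgrPdist_le => e e0; move/cvgrPdist_le: fc => /(_ e e0).
  by apply: filterS => t' h; apply: le_trans (min_lip _ _) h.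
apply: cvgM; first apply: cvgM => //.
  by apply: cvgMr; exact: unrotA_continuous.
by case: ifP => _; [exact: sinc|apply: cvgN; exact: cosc].
Unshelve. all: by end_near. Qed.

(** Undoing the rotation turns the solution of [picard] into a solution of the
    mode equations. *)
Lemma modes_exist : exists (a b : R -> nat -> R) (kap : R -> R) (M : R),
  [/\ 0 < M, forall j, a 0 j = a0 j /\ b 0 j = b0 j,
      forall t j, `|a t j| <= 2 * (expR (M * `|t|) * w j) /\
                  `|b t j| <= 2 * (expR (M * `|t|) * w j),
      forall t, mode_ode m a b kap t
    & forall t, kap t = Num.min ((2 * pi)^-1 * tsum (fun j => a t j ^+ 2)) M0].
Proof.
pose M := 2 * c * M0 + 1.
have M1 : 0 < M by rewrite ltr_wpDl// !mulr_ge0// ltW.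
have x0w (i : bool * nat) : `|if i.1 then a0 i.2 else b0 i.2| <= W i.
  by case: i => -[] j /=; rewrite /W /w /=; [rewrite lerDl|rewrite lerDr].
have growth t x C : (forall i, `|x i| <= C * W i) ->
    forall i, `|rotField t x i| <= M * (C * W i).
  move=> h i; have CW : 0 <= C * W i by exact: le_trans (normr_ge0 _) (h i).
  have [C0|C0] := leP 0 C.
    apply: le_trans (field_bound t C0 h i) _.
    have -> : M0 * (c * (2 * (C * W i))) = 2 * c * M0 * (C * W i) by ring.
    by apply: ler_wpM2r => //; rewrite /M lerDl.
  have x0 i' : x i' = 0.
    apply/eqP; rewrite -normr_le0; apply: le_trans (h i') _.
    by rewrite nmulr_rle0//; exact: w0.
  have uz : unrotA t x i.2 = 0 by rewrite /unrotA !x0 !mulr0 addr0.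
  rewrite /rotField uz mulr0 mulr0 mul0r normr0 mulr_ge0//; exact: ltW.
have [x [x_init x_bound x_ode]] := picard x0w M1 growth field_lip field_continuous.
exists (fun t => unrotA t (x t)), (fun t => unrotB t (x t)), (fun t => truncK t (x t)), M.
split => //.
- move=> j; rewrite /unrotA /unrotB mulr0 cos0 sin0 !mul1r !mul0r addr0 subr0.
  by rewrite !x_init.
- move=> t j; split; [exact: unrotA_bound|exact: unrotB_bound].
- move=> t j.
  have dp := x_ode t (true, j); have dq := x_ode t (false, j).
  have sc : sin (om j * t) ^+ 2 = 1 - cos (om j * t) ^+ 2 by exact: sin2cos2.
  rewrite /rotField /= in dp dq.
  split.
    apply: drv_eq (drvD (drvM (drv_cos (om j) t) dp) (drvM (drv_sin (om j) t) dq)) _.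
    by rewrite /unrotB; ring.
  apply: drv_eq (drvB (drvM (drv_cos (om j) t) dq) (drvM (drv_sin (om j) t) dp)) _.
  move: (truncK t (x t)) (cos2Dsin2 (om j * t)) => k; rewrite /unrotA.
  move: (cos (om j * t)) (sin (om j * t)) (x t (true, j)) (x t (false, j)) => p q y z pq.
  transitivity (- (om j * (p * y + q * z)) - k * (lam m j * (p * y + q * z)) * (p ^+ 2 + q ^+ 2)).
    by ring.
  by rewrite pq; ring.
Qed.

End ModesExist.

(** * Weak solutions from modes *)

Section DominatedPaths.
Context {R : realType}.
Variables (r : R) (wt : nat -> R).
Hypothesis wts : abs_summable wt.

(** Pointwise continuity or differentiability of the modes becomes continuity
    or differentiability in the weighted space under such a bound. *)
Definition locally_dominated (X : R -> nat -> R) : Prop :=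
  forall T : R, exists C, forall t j, `|t| <= T -> (0 < j)%N ->
    wH r j * X t j ^+ 2 <= C * wt j.

Let dom_diff (C : R) j (x y : R) : (0 < j)%N ->
  wH r j * x ^+ 2 <= C * wt j -> wH r j * y ^+ 2 <= C * wt j ->
  wH r j * (x - y) ^+ 2 <= 4 * C * wt j.
Proof.
move=> j0 hx hy.
have h : wH r j * (x - y) ^+ 2 <= 2 * (wH r j * x ^+ 2) + 2 * (wH r j * y ^+ 2).
  have -> : 2 * (wH r j * x ^+ 2) + 2 * (wH r j * y ^+ 2) =
    wH r j * (x - y) ^+ 2 + wH r j * (x + y) ^+ 2 by ring.
  by rewrite lerDl mulr_ge0 ?sqr_ge0// powR_ge0.
have -> : 4 * C * wt j = 4 * (C * wt j) by ring.
move: h hx hy; move: (wH r j * (x - y) ^+ 2) (wH r j * x ^+ 2) (wH r j * y ^+ 2) (C * wt j) => p q z k; lra.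
Qed.

Lemma dominated_fin X t : locally_dominated X -> (wsq (wH r) (X t) < +oo)%E.
Proof.
move=> dom; have [C hC] := dom `|t|.
apply: wsq_fin => [j _|]; first exact: powR_ge0.
apply: abs_summable_le (abs_summableZ C wts) => j j0.
rewrite ger0_norm; last by rewrite mulr_ge0 ?sqr_ge0// powR_ge0.
by apply: le_trans (ler_norm _); exact: hC.
Qed.

Lemma path_continuous_dominated (I : set R) X : locally_dominated X ->
  (forall j, (0 < j)%N -> continuous (X^~ j)) -> path_continuous r I X.
Proof.
move=> dom cX t _; split; first exact: dominated_fin.
have [C hC] := dom (`|t| + 1).
apply: (@cvg_wsq0 R R (nbhs t) _ (fun t' j => X t' j - X t j) (wH r) (fun j => 4 * C * wt j)).
- by move=> j _; exact: powR_ge0.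
- exact: abs_summableZ.
- apply: filterS (near_norm_le t) => t' h j j0; apply: dom_diff => //.
    exact: hC.
  by apply: hC => //; rewrite lerDl.
- move=> j j0; have c : (fun t' => X t' j) @ t --> X t j := cX j j0 t.
  have c2 : (fun t' => X t' j - X t j) @ t --> X t j - X t j.
    by apply: cvgB; [exact: c|exact: cvg_cst].
  by rewrite subrr in c2; exact: c2.
Qed.

(** The difference quotients are values of the derivative at nearby times, so
    they obey the same domination. *)
Lemma path_derivative_dominated (I : set R) X Y : locally_dominated Y ->
  (forall (t : R) j, (0 < j)%N -> is_derive t 1 (X^~ j) (Y t j)) ->
  path_derivative r I X Y.
Proof.
move=> dom dX t _; have [C hC] := dom (`|t| + 1).
apply: (@cvg_wsq0 R R _ _ (fun h j => (X (t + h) j - X t j) / h - Y t j) (wH r) (fun j => 4 * C * wt j)).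
- by move=> j _; exact: powR_ge0.
- exact: abs_summableZ.
- have h1 : \forall h \near (0 : R)^', `|h - 0| < 1.
    exact: nbhs_dnbhs (near_dist_lt1 0).
  have h2 : \forall h \near (0 : R)^', h != 0 by exact: nbhs_dnbhs_neq.
  apply: filterS2 h1 h2 => h h1 h0 j j0.
  have [|z [zt ->]] := @mvt_ball R (X^~ j) (Y^~ j) t (t + h); first by move=> y _; exact: dX.
  have eh : t + h - t = h by rewrite addrC addKr.
  rewrite eh mulfK//; apply: dom_diff => //; apply: hC => //; last by rewrite lerDl.
  rewrite subr0 in h1; rewrite eh in zt.
  by apply: norm_le_shift; exact: le_trans zt (ltW h1).
- move=> j j0; have /is_deriveP c := dX t j j0.
  have c2 : (fun h => (X (t + h) j - X t j) / h - Y t j) @ (0 : R)^' --> Y t j - Y t j.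
    by apply: cvgB; [exact: c|exact: cvg_cst].
  by rewrite subrr in c2; exact: c2.
Qed.

End DominatedPaths.

Section WeakSolutionOfModes.
Context {R : realType}.
Variables (m s : R) (u0 v0 : R -> R).
Hypotheses (hm1 : - (1 / 2) <= m) (hm2 : m <= 1) (hs : 1 / 2 < s).
Hypotheses (hu0 : Hstar (s + 2) u0) (hv0 : Hstar s v0).
Local Notation om := (omega m).

Definition init_modeA (j : nat) : R := j%:R * coef u0 j.
Definition init_modeB (j : nat) : R := j%:R * coef v0 j / om j.
Let w j := `|init_modeA j| + `|init_modeB j|.
Let wt j := wH (s + 1) j * w j ^+ 2.

Lemma wH_shift (p : R) (k : nat) j : (0 < j)%N -> wH (p + k%:R) j = wH p j * (j%:R ^+ k) ^+ 2 :> R.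
Proof.
move=> j0; rewrite /wH mulrDr powRD; last by rewrite pnatr_eq0 -lt0n j0 implybT.
by congr (_ * _); rewrite -exprM muln2 -mul2n -natrM powR_mulrn// ler0n.
Qed.

Let wHm2_shift j : (0 < j)%N -> wH (s + 1) j = wH (s - 2) j * (j%:R ^+ 3) ^+ 2 :> R.
Proof. by move=> j0; rewrite -wH_shift//; congr (wH _ _); ring. Qed.

Lemma omega_sqr_le j : om j ^+ 2 <= 2 * (j%:R ^+ 2) ^+ 2.
Proof.
rewrite omega_sqr//; case: j => [|j]; first by rewrite expr0n/= !mul0r expr0n mulr0.
have := @natr_sqr_ge1 R j.+1 (ltn0Sn j); have h := hm2; move: (j.+1%:R ^+ 2) => z z1; nra.
Qed.

Lemma wHm1_le j : (0 < j)%N -> wHm1 m j <= 2 * j%:R ^- 2.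
Proof.
move=> j0; have o0 := omega_gt0 hm1 hm2 j0.
rewrite /wHm1 ler_pdivrMr ?exprn_gt0// omega_sqr// mulrA -(mulrA 2) mulVf; last first.
  by rewrite expf_neq0// pnatr_eq0 -lt0n.
have := @natr_sqr_ge1 R j j0; have h := hm1; move: (j%:R ^+ 2) => z z1; lra.
Qed.

Lemma initB_sqr j : init_modeB j ^+ 2 = wHm1 m j * coef v0 j ^+ 2.
Proof. by rewrite /init_modeB /wHm1 !exprMn exprVn mulrAC. Qed.

Let dataA_s : abs_summable (fun j => wH (s + 2) j * coef u0 j ^+ 2).
Proof. by have [h _] := hu0; exact: wsq_lty (@wH_ge0 _ _) h. Qed.

Let dataB_s : abs_summable (fun j => wH s j * coef v0 j ^+ 2).
Proof. by have [h _] := hv0; exact: wsq_lty (@wH_ge0 _ _) h. Qed.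

Lemma wH_initA j : (0 < j)%N -> wH (s + 1) j * init_modeA j ^+ 2 = wH (s + 2) j * coef u0 j ^+ 2.
Proof.
move=> j0; have -> : s + 2 = s + 1 + 1%:R by ring.
by rewrite wH_shift// /init_modeA expr1 exprMn mulrA.
Qed.

Lemma wH_initB j : (0 < j)%N -> wH (s + 1) j * init_modeB j ^+ 2 <= 2 * (wH s j * coef v0 j ^+ 2).
Proof.
move=> j0; rewrite initB_sqr -[s + 1]/(s + 1%:R) wH_shift// expr1.
apply: (@le_trans _ _ (wH s j * j%:R ^+ 2 * (2 * j%:R ^- 2 * coef v0 j ^+ 2))).
  apply: ler_wpM2l; first by rewrite mulr_ge0 ?sqr_ge0 ?wH_ge0.
  by apply: ler_wpM2r; [exact: sqr_ge0|exact: wHm1_le].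
have jn : j%:R != 0 :> R by rewrite pnatr_eq0 -lt0n.
by apply: le_of_eq; field.
Qed.

Lemma initA_summable : abs_summable (fun j => wH (s + 1) j * init_modeA j ^+ 2).
Proof. by apply: abs_summable_ext dataA_s => j j0; rewrite wH_initA. Qed.

Lemma initB_summable : abs_summable (fun j => wH (s + 1) j * init_modeB j ^+ 2).
Proof.
apply: abs_summable_le (abs_summableZ 2 dataB_s) => j j0.
rewrite ger0_norm; last by rewrite mulr_ge0 ?sqr_ge0 ?wH_ge0.
by apply: le_trans (ler_norm _); exact: wH_initB.
Qed.

Let wt0 j : (0 < j)%N -> 0 <= wt j.
Proof. by move=> j0; rewrite mulr_ge0 ?sqr_ge0 ?wH_ge0. Qed.

Let wts : abs_summable wt.
Proof.
apply: abs_summable_le (abs_summableD (abs_summableZ 2 initA_summable) (abs_summableZ 2 initB_summable)) => j j0.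
rewrite ger0_norm; last exact: wt0.
apply: le_trans (ler_norm _).
have -> : 2 * (wH (s + 1) j * init_modeA j ^+ 2) + 2 * (wH (s + 1) j * init_modeB j ^+ 2) =
   wH (s + 1) j * (2 * init_modeA j ^+ 2 + 2 * init_modeB j ^+ 2) by ring.
apply: ler_wpM2l; first exact: wH_ge0.
rewrite -(real_normK (num_real (init_modeA j))) -(real_normK (num_real (init_modeB j))) /w.
by have := sqr_ge0 (`|init_modeA j| - `|init_modeB j|); move: `|init_modeA j| `|init_modeB j| => p q h; nra.
Qed.

Lemma init_summable : abs_summable (fun j => (`|init_modeA j| + `|init_modeB j|) ^+ 2).
Proof.
apply: abs_summable_le wts => j j0; rewrite /wt -/(w j).
rewrite ger0_norm ?sqr_ge0//; apply: le_trans (ler_norm _).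
rewrite ler_peMl ?sqr_ge0// /wH -[leLHS](powRr0 j%:R); apply: ler_powR; first by rewrite ler1n.
by have h := hs; lra.
Qed.

Lemma initial_energy_le k :
  psum (fun j => init_modeA j ^+ 2 + init_modeB j ^+ 2) k <= Hnorm 1 u0 ^+ 2 + Hm1norm m v0 ^+ 2.
Proof.
have sqr_dom (x y : R) : `|x| <= y -> `|x ^+ 2| <= `|y ^+ 2|.
  move=> xy; rewrite !normrX ler_pXn2r// ?nnegrE//.
  exact: le_trans xy (ler_norm _).
have sA : abs_summable (fun j => init_modeA j ^+ 2).
  by apply: abs_summable_le init_summable => j _; apply: sqr_dom; rewrite lerDl.
have sB : abs_summable (fun j => init_modeB j ^+ 2).
  by apply: abs_summable_le init_summable => j _; apply: sqr_dom; rewrite lerDr.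
have AE j : (0 < j)%N -> init_modeA j ^+ 2 = wH 1 j * coef u0 j ^+ 2.
  by move=> j0; rewrite /wH mulr1 powR_mulrn ?ler0n// /init_modeA exprMn.
have nA : tsum (fun j => init_modeA j ^+ 2) = Hnorm 1 u0 ^+ 2.
  rewrite /Hnorm wnorm_sqr; [exact: eq_tsum|by move=> j; exact: wH_ge0|].
  exact: abs_summable_ext sA.
have nB : tsum (fun j => init_modeB j ^+ 2) = Hm1norm m v0 ^+ 2.
  rewrite /Hm1norm wnorm_sqr.
  - by apply: eq_tsum => j _; exact: initB_sqr.
  - by move=> j _; rewrite divr_ge0 ?sqr_ge0.
  - by apply: abs_summable_ext sB => j _; exact: initB_sqr.
rewrite -nA -nB /psum big_split /= -!/(psum _ _); apply: lerD.
- by apply: psum_le_tsum => // j _; exact: sqr_ge0.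
- by apply: psum_le_tsum => // j _; exact: sqr_ge0.
Qed.

Let jw_s : abs_summable (fun j => j%:R * w j).
Proof.
have h1 : 1 / 2 < s + 1 - 1 by have h := hs; lra.
by apply: abs_summable_ext (abs_summable_sqr h1 wts) => j _; rewrite powRr1 ?ler0n.
Qed.

Section Family.
Variables (a b : R -> nat -> R) (kap : R -> R) (M M0 : R) (I : set R).
Hypotheses (a_init : forall j, a 0 j = init_modeA j) (b_init : forall j, b 0 j = init_modeB j).
Hypothesis ab_bound : forall t j, `|a t j| <= 2 * (expR (M * `|t|) * w j) /\
                                  `|b t j| <= 2 * (expR (M * `|t|) * w j).
Hypotheses (M_gt0 : 0 < M) (M0_ge0 : 0 <= M0).
Hypothesis ab_ode : forall t, mode_ode m a b kap t.
Let full t := (2 * pi)^-1 * tsum (fun j => a t j ^+ 2).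
Hypothesis kapE : forall t, kap t = Num.min (full t) M0.
Hypotheses (oI : open I) (iI : is_interval I) (I0 : I 0)
  (I_full : forall t, I t -> full t <= M0).

Let X t j : R := a t j / j%:R.
Let Y t j : R := om j * b t j / j%:R.
Let Z t j : R := om j * (- (om j * a t j) - kap t * lam m j * a t j) / j%:R.

(** Division by [j = 0] gives [0], so the mode of index [0] is absent. *)
Definition displacement (t x : R) : R := sser (X t) x.

Let dX (t : R) j : is_derive t 1 (X^~ j) (Y t j).
Proof.
have [da _] := ab_ode t j; rewrite (_ : X^~ j = fun t => j%:R^-1 * a t j); last first.
  by apply: funext => z; rewrite /X mulrC.
by apply: drv_eq (drvZ _ da) _; rewrite mulrC.
Qed.

Let dY (t : R) j : is_derive t 1 (Y^~ j) (Z t j).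
Proof.
have [_ db] := ab_ode t j; rewrite (_ : Y^~ j = fun t => om j / j%:R * b t j); last first.
  by apply: funext => z; rewrite /Y mulrAC.
by apply: drv_eq (drvZ _ db) _; rewrite /Z; ring.
Qed.

Let E T := 2 * expR (M * T).

Let a_le T t j : `|t| <= T -> `|a t j| <= E T * w j /\ `|b t j| <= E T * w j.
Proof.
move=> tT; have w0 : 0 <= w j by rewrite addr_ge0.
have h : 2 * (expR (M * `|t|) * w j) <= E T * w j.
  rewrite /E -mulrA ler_pM2l//; apply: ler_wpM2r => //.
  by rewrite ler_expR ler_pM2l.
by have [h1 h2] := ab_bound t j; split; apply: le_trans h.
Qed.

Let kap_bound t : 0 <= kap t <= M0.
Proof.
rewrite kapE le_min ge_min M0_ge0 lexx orbT !andbT mulr_ge0//.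
  by rewrite invr_ge0 mulr_ge0// pi_ge0.
apply: tsum_ge0 => [|j _]; last exact: sqr_ge0.
apply: abs_summable_le (abs_summableZ (E `|t| ^+ 2) init_summable) => j _.
rewrite ger0_norm ?sqr_ge0//; apply: le_trans (ler_norm _).
rewrite -/(w j) -exprMn; apply: ler_sqr_norm.
by have [] := @a_le `|t| t j (lexx _).
Qed.

Let full_continuous : continuous full.
Proof.
move=> t; rewrite /full; apply: cvgMr.
apply: (@tannery R R (nbhs t) _ (fun t j => a t j ^+ 2) (fun j => a t j ^+ 2)
  (fun j => E (`|t| + 1) ^+ 2 * w j ^+ 2)).
- exact: abs_summableZ init_summable.
- apply: filterS (near_norm_le t) => t' tT j _.
  rewrite ger0_norm ?sqr_ge0// -exprMn; apply: ler_sqr_norm.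
  by have [] := a_le j tT.
- move=> j _; have [da _] := ab_ode t j.
  have c : (fun t' => a t' j) @ t --> a t j := is_derive_continuous da.
  rewrite (_ : (fun t => a t j ^+ 2) = fun t => a t j * a t j).
    by rewrite expr2; apply: cvgM.
  by apply: funext => z; rewrite expr2.
Qed.

Let kap_continuous : continuous kap.
Proof.
move=> t; rewrite (_ : kap = fun t => (full t + M0 - `|full t - M0|) / 2); last first.
  by apply: funext => z; rewrite kapE minr_absE.
have c := @full_continuous t.
apply: cvgMl; apply: cvgB; first by apply: cvgD; [exact: c|exact: cvg_cst].
by apply: cvg_norm; apply: cvgB; [exact: c|exact: cvg_cst].
Qed.

Let Z_continuous j : continuous (Z^~ j).
Proof.
move=> t; have [da _] := ab_ode t j.
have c : (fun t' => a t' j) @ t --> a t j := is_derive_continuous da.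
have k := @kap_continuous t.
rewrite /Z; apply: cvgMl; apply: cvgMr; apply: cvgB; first by apply: cvgN; apply: cvgMr.
by apply: cvgM => //; apply: cvgMl.
Qed.

Let domX : locally_dominated (s + 2) wt X.
Proof.
move=> T; exists (E T ^+ 2) => t j tT j0.
have -> : s + 2 = s + 1 + 1%:R by ring.
rewrite wH_shift// expr1 /X exprMn exprVn.
have jn : j%:R != 0 :> R by rewrite pnatr_eq0 -lt0n.
have -> : wH (s + 1) j * j%:R ^+ 2 * (a t j ^+ 2 * j%:R ^- 2) = wH (s + 1) j * a t j ^+ 2.
  by field.
have -> : E T ^+ 2 * wt j = wH (s + 1) j * (E T * w j) ^+ 2 by rewrite /wt; ring.
apply: ler_wpM2l; first exact: wH_ge0.
by apply: ler_sqr_norm; have [] := a_le j tT.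
Qed.

Let domY : locally_dominated s wt Y.
Proof.
move=> T; exists (2 * E T ^+ 2) => t j tT j0.
have jn : j%:R != 0 :> R by rewrite pnatr_eq0 -lt0n.
rewrite /wt -[s + 1]/(s + 1%:R) wH_shift// expr1 /Y.
have -> : (om j * b t j / j%:R) ^+ 2 = om j ^+ 2 * b t j ^+ 2 * j%:R ^- 2 by rewrite !exprMn exprVn.
have h1 := omega_sqr_le j.
have h2 : b t j ^+ 2 <= E T ^+ 2 * w j ^+ 2.
  by rewrite -exprMn; apply: ler_sqr_norm; have [] := a_le j tT.
apply: (@le_trans _ _ (wH s j * (2 * (j%:R ^+ 2) ^+ 2 * (E T ^+ 2 * w j ^+ 2) * j%:R ^- 2))).
  apply: ler_wpM2l; first exact: wH_ge0.
  apply: ler_wpM2r; first by rewrite invr_ge0 sqr_ge0.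
  by apply: ler_pM => //; exact: sqr_ge0.
by apply: le_of_eq; field.
Qed.

Let ZE t j : (0 < j)%N -> Z t j = - ((j%:R ^+ 4 + (m + kap t) * j%:R ^+ 2) * X t j).
Proof.
move=> j0; have o0 := omega_gt0 hm1 hm2 j0; have o2 := omega_sqr hm1 hm2 j.
have jn : j%:R != 0 :> R by rewrite pnatr_eq0 -lt0n.
have -> : j%:R ^+ 4 + (m + kap t) * j%:R ^+ 2 = om j ^+ 2 + kap t * j%:R ^+ 2 by rewrite o2; ring.
rewrite /Z /X /lam; move: (om j) o0 => o o0; field.
by rewrite jn gt_eqF.
Qed.

Let domZ : locally_dominated (s - 2) wt Z.
Proof.
move=> T; exists ((2 + M0) ^+ 2 * E T ^+ 2) => t j tT j0.
have jn : j%:R != 0 :> R by rewrite pnatr_eq0 -lt0n.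
rewrite ZE// sqrrN /wt wHm2_shift// /X.
have -> : ((j%:R ^+ 4 + (m + kap t) * j%:R ^+ 2) * (a t j / j%:R)) ^+ 2 =
  (j%:R ^+ 4 + (m + kap t) * j%:R ^+ 2) ^+ 2 * (a t j ^+ 2 * j%:R ^- 2) by rewrite !exprMn exprVn.
have j1 := @natr_sqr_ge1 R j j0.
have /andP[k0 k1] := kap_bound t.
have h1 : (j%:R ^+ 4 + (m + kap t) * j%:R ^+ 2) ^+ 2 <= ((2 + M0) * (j%:R ^+ 2) ^+ 2) ^+ 2.
  apply: ler_sqr_norm; rewrite (_ : j%:R ^+ 4 = (j%:R ^+ 2) ^+ 2 :> R); last by rewrite -exprM.
  have h3 := hm1; have h4 := hm2.
  move: (j%:R ^+ 2 : R) j1 (kap t) k0 k1 => z z1 k k0 k1.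
  have kz : 0 <= k * z by rewrite mulr_ge0//; lra.
  have kz2 : k * z <= M0 * z ^+ 2.
    by rewrite expr2 mulrA; apply: le_trans (ler_peMr _ z1); [apply: ler_wpM2r => //; lra|rewrite mulr_ge0//; lra].
  have mz : m * z <= z ^+ 2 by nra.
  have mz2 : - z ^+ 2 <= m * z by nra.
  by rewrite ger0_norm; nra.
have h2 : a t j ^+ 2 <= E T ^+ 2 * w j ^+ 2.
  by rewrite -exprMn; apply: ler_sqr_norm; have [] := a_le j tT.
apply: (@le_trans _ _ (wH (s - 2) j * (((2 + M0) * (j%:R ^+ 2) ^+ 2) ^+ 2 * (E T ^+ 2 * w j ^+ 2 * j%:R ^- 2)))).
  apply: ler_wpM2l; first exact: wH_ge0.
  apply: ler_pM => //; first exact: sqr_ge0.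
    by rewrite mulr_ge0 ?sqr_ge0// invr_ge0 sqr_ge0.
  by apply: ler_wpM2r => //; rewrite invr_ge0 sqr_ge0.
by apply: le_of_eq; field.
Qed.

Let X_s t : abs_summable (X t).
Proof.
have s2 : 1 / 2 < s + 2 - 0 by have h := hs; lra.
have h := wsq_lty (@wH_ge0 _ _) (dominated_fin wts t domX).
by apply: abs_summable_ext (abs_summable_sqr s2 h) => j _; rewrite powRr0 mul1r.
Qed.

Let coefE : coef_path displacement = X.
Proof.
apply: funext => t; apply: funext => -[|j]; last exact: coef_sser (X_s t) (ltn0Sn j) (fun _ _ => erefl).
rewrite /coef_path (coef_rint _ (sser_continuous (X_s t)) (fun _ _ => erefl)) /X invr0 mulr0.
rewrite (@eq_rint _ _ (fun=> 0)).
  by rewrite (@rint_ftc _ (fun=> 0) _ _ _ (fun x => cvg_cst _) (fun x => drvC 0 x)) subrr.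
by move=> x; rewrite phiE mul0r sin0 mulr0 mul0r.
Qed.

Let dXE : dpath X = Y.
Proof. by apply: funext => t; apply: funext => j; exact: drv_derive1 (dX t j). Qed.

Let dYE : dpath Y = Z.
Proof. by apply: funext => t; apply: funext => j; exact: drv_derive1 (dY t j). Qed.

Let displacement_H t : Hstar (s + 2) (displacement t).
Proof.
have cE : coef (displacement t) = X t by rewrite -coefE.
split; rewrite cE.
  exact (dominated_fin wts t domX).
by move=> x hx; exact: abs_summable_cvg (sser_summable x (X_s t)).
Qed.

Let init_disp x : x \in `[0, pi] -> displacement 0 x = u0 x.
Proof.
move=> hx; have us : abs_summable (coef u0) by apply: Hstar_abs_summable hu0; have h := hs; lra.
rewrite (Hstar_sser hu0 us hx); apply: eq_tsum => j j0; congr (_ * _).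
by rewrite /X a_init /init_modeA mulrC mulKf// pnatr_eq0 -lt0n.
Qed.

Let init_vel (x : R) : x \in `[0, pi] -> is_derive (0 : R) 1 (fun t => displacement t x) (v0 x).
Proof.
move=> hx; have vs := Hstar_abs_summable hs hv0.
rewrite (Hstar_sser hv0 vs hx).
have -> : sser (coef v0) x = tsum (fun j => Y 0 j * phi j x).
  apply: eq_tsum => j j0; congr (_ * _); rewrite /Y b_init /init_modeB.
  have jn : j%:R != 0 :> R by rewrite pnatr_eq0 -lt0n.
  have o0 := omega_gt0 hm1 hm2 j0; move: (om j) o0 => o o0; field.
  by rewrite jn gt_eqF.
apply: (@is_derive_tsum R (fun t j => X t j * phi j x) (fun t j => Y t j * phi j x)
  (fun j => 2 * E 1 * phi_max * (j%:R * w j)) 0 1) => //.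
- exact: abs_summableZ.
- move=> t j t1 j0; split.
    rewrite (_ : (fun t => X t j * phi j x) = fun t => phi j x * X t j); last by apply: funext => z; rewrite mulrC.
    by apply: drv_eq (drvZ _ (dX t j)) _; rewrite mulrC.
  rewrite subr0 in t1; have [_ hb] := a_le j (ltW t1).
  have jn : j%:R != 0 :> R by rewrite pnatr_eq0 -lt0n.
  have oj : om j <= 2 * j%:R ^+ 2.
    rewrite -(ler_pXn2r (n := 2))// ?nnegrE ?omega_ge0 ?mulr_ge0 ?sqr_ge0//.
    by apply: le_trans (omega_sqr_le j) _; rewrite (_ : (2 * j%:R ^+ 2) ^+ 2 = 4 * (j%:R ^+ 2) ^+ 2 :> R); last (by ring); apply: ler_wpM2r; [exact: sqr_ge0|lra].
  rewrite normrM (_ : 2 * E 1 * phi_max * (j%:R * w j) = (2 * j%:R ^+ 2 * (E 1 * w j) / j%:R) * phi_max); last by field.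
  apply: ler_pM => //; last exact: phi_bound.
  rewrite /Y !normrM normfV (ger0_norm (ler0n _ _)) (ger0_norm (omega_ge0 _ _)).
  apply: ler_wpM2r; first by rewrite invr_ge0 ler0n.
  by apply: ler_pM => //; exact: omega_ge0.
- by move=> t _; exact: sser_summable.
Qed.

(** One and the same weight dominates the modes of [u], [u_t] and [u_tt] in
    [H^(s + 2)], [H^s] and [H^(s - 2)], because the frequencies are of order
    [j ^ 2].  As long as the truncation is inactive the modes solve the
    equations of the beam, and [weak_form_modes] gives the weak form. *)
Lemma displacement_weak_solution : weak_solution m s u0 v0 I displacement.
Proof.
split => //.
- rewrite /C2_path coefE dXE dYE; split.
  + by move=> t _; exact: displacement_H.
  + apply: (path_continuous_dominated wts) => //.
    by move=> j _ z; exact: is_derive_continuous (dX z j).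
  + split; first exact: (path_derivative_dominated wts).
    apply: (path_continuous_dominated wts) => //.
    by move=> j _ z; exact: is_derive_continuous (dY z j).
  + split; first exact: (path_derivative_dominated wts).
    by apply: (path_continuous_dominated wts).
- move=> eta he t It.
  have zf : (wsq (wH (s - 2)) (dpath (dpath (coef_path displacement)) t) < +oo)%E.
    rewrite coefE dXE dYE.
    exact (dominated_fin wts t domZ).
  apply: (weak_form_modes m hs (displacement_H t) zf).2 he => j j0.
  rewrite coefE dXE dYE ZE//; congr (- ((_ + (_ + _) * _) * _)).
  rewrite kapE; have h := I_full It.
  rewrite min_l//; congr (_ * _); apply: eq_tsum => i i0; congr (_ ^+ 2).
  by rewrite /X mulrCA mulfV ?mulr1// pnatr_eq0 -lt0n.
Qed.

End Family.
End WeakSolutionOfModes.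

(** * Long-time bounds *)

Section Constants.
Context {R : realType}.
Variables (m : R).
Hypotheses (hm1 : - (1 / 2) <= m) (hm2 : m <= 1).

(** The square of [lam m j] is [j ^ 2 / (j ^ 2 + m)], which is below [1] for
    [0 <= m] and largest at [j = 1] for negative [m]. *)
Definition lamBound : R := if 0 <= m then 1 else (1 + m) `^ (- (1 / 2)).

Lemma lamBoundE : 0 < lamBound /\ forall z, 1 <= z -> z <= lamBound ^+ 2 * (z + m).
Proof.
have h := hm1; rewrite /lamBound; case: ifPn => m0.
  by split => // z z1; rewrite expr1n mul1r lerDl.
rewrite -ltNge in m0; have q0 : 0 < 1 + m by lra.
split => [|z z1]; first exact: powR_gt0.
have -> : ((1 + m) `^ (- (1 / 2))) ^+ 2 = (1 + m)^-1.
  rewrite -powR_mulrn ?powR_ge0// -powRrM (_ : - (1 / 2) * 2%:R = -1); last by field.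
  by rewrite powR_inv1// ltW.
rewrite mulrC ler_pdivlMr//; nra.
Qed.

Lemma lamBound_le2 : lamBound <= 2.
Proof.
have h := hm1; rewrite /lamBound; case: ifPn => m0; first by lra.
rewrite -ltNge in m0; have q0 : 0 < 1 + m by lra.
rewrite -(ler_pXn2r (n := 2))// ?nnegrE ?powR_ge0//.
rewrite -powR_mulrn ?powR_ge0// -powRrM (_ : - (1 / 2) * 2%:R = -1); last by field.
rewrite powR_inv1; last exact: ltW.
by rewrite -[leLHS]mul1r ler_pdivrMr//; lra.
Qed.

Lemma lam_le_lamBound j : 0 <= lam m j <= lamBound.
Proof.
have [c0 hc] := lamBoundE; rewrite /lam; case: j => [|j].
  by rewrite expr0n mul0r lexx ltW.
have o0 := omega_gt0 hm1 hm2 (ltn0Sn j).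
rewrite divr_ge0 ?sqr_ge0 ?(ltW o0)//= ler_pdivrMr//.
rewrite -(ler_pXn2r (n := 2))// ?nnegrE ?sqr_ge0 ?mulr_ge0 ?(ltW o0) ?(ltW c0)//.
have z1 := @natr_sqr_ge1 R j.+1 (ltn0Sn j).
have := hc _ z1; have -> : (lamBound * omega m j.+1) ^+ 2 = j.+1%:R ^+ 2 * (lamBound ^+ 2 * (j.+1%:R ^+ 2 + m)).
  by rewrite exprMn omega_sqr//; ring.
by move=> h; rewrite [leLHS]expr2; apply: ler_wpM2l h; exact: sqr_ge0.
Qed.

Lemma phi_max_le1 : phi_max <= 1 :> R.
Proof.
rewrite -(ler_pXn2r (n := 2))// ?nnegrE ?phi_max_ge0// phi_max_sqr expr1n.
have := @pi_ge2 R; move: (pi : R) => q h; rewrite ler_pdivrMr; lra.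
Qed.

Lemma sqr_le_of_le_sqrt (x k q : R) : 0 <= x -> 0 <= q -> x <= k * Num.sqrt q -> x ^+ 2 <= k ^+ 2 * q.
Proof.
move=> x0 q0 h; rewrite -(sqr_sqrtr q0) -exprMn ler_pXn2r// nnegrE//.
exact: le_trans h.
Qed.

Lemma max_ge0 (x y : R) : 0 <= x -> 0 <= Num.max x y.
Proof. by move=> x0; rewrite le_max x0. Qed.

Lemma sqrD_le_max (x y : R) : 0 <= x -> 0 <= y ->
  x ^+ 2 + y ^+ 2 <= 2 * Num.max x y ^+ 2.
Proof.
move=> x0 y0; have m0 := max_ge0 y x0.
rewrite mulr2n mulrDl mul1r.
by apply: lerD; rewrite ler_pXn2r// le_max lexx ?orbT.
Qed.

Lemma ler_div_mul (p k d : R) : 0 <= p -> 0 < k -> 1 <= d -> p / (k * d) <= p / k.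
Proof.
move=> p0 k0 d1; have d0 : 0 < d by exact: lt_le_trans d1.
apply: ler_wpM2l => //; rewrite lef_pV2 ?posrE ?mulr_gt0//.
by rewrite ler_peMr// ltW.
Qed.

Lemma quartic_le_of_le_powR (x q : R) : 0 <= x -> 0 <= q -> x <= q `^ (1 / 4) -> (x ^+ 2) ^+ 2 <= q.
Proof.
move=> x0 q0 h; rewrite -exprM.
have -> : q = (q `^ (1 / 4)) ^+ 4.
  rewrite -powR_mulrn ?powR_ge0// -powRrM (_ : 1 / 4 * 4%:R = 1); last by field.
  by rewrite powRr1.
by rewrite ler_pXn2r// nnegrE ?powR_ge0.
Qed.

End Constants.

Section Estimates.
Context {R : realType}.
Variables (m s : R) (u0 v0 : R -> R) (I : set R) (u : R -> R -> R) (eps : R) (N : nat) (t : R).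
Hypotheses (hm1 : - (1 / 2) <= m) (hm2 : m <= 1) (hs : 1 / 2 < s).
Hypotheses (hu : Hstar (s + 2) (u t)) (eps0 : 0 <= eps).
Let a := modeA u.
Let b := modeB m u.
Hypothesis energy_le : forall n, mode_energy a b n t <= 11 / 5 * eps ^+ 2.
Hypothesis tail_le : forall n,
  \sum_(N.+1 <= j < n) (wH (s + 1) j * (a t j ^+ 2 + b t j ^+ 2)) <= 9 / 5 * eps ^+ 2.

Let A := coef (u t).

Let a_energy n : psum (fun j => a t j ^+ 2) n <= 11 / 5 * eps ^+ 2.
Proof.
apply: le_trans (energy_le n); rewrite /mode_energy /psum; apply: ler_sum => j _.
by rewrite lerDl sqr_ge0.
Qed.

(** The weight is [j ^ 2] up to [N], where the energy bound applies, and the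
    rest is the tail; [11 / 5 + 9 / 5 = 4] gives the factor [2]. *)
Lemma HNnorm_le : HNnorm (s + 2) N (u t) <= 2 * eps.
Proof.
have w0 j : (0 < j)%N -> 0 <= wHN (s + 2) N j :> R.
  by move=> j0; rewrite /wHN; case: ifP => _; [exact: sqr_ge0|exact: powR_ge0].
have wle j : (0 < j)%N -> wHN (s + 2) N j * A j ^+ 2 <= wH (s + 2) j * A j ^+ 2.
  move=> j0; apply: ler_wpM2r; first exact: sqr_ge0.
  rewrite /wHN /wH; case: ifP => // _; rewrite -powR_mulrn ?ler0n//; apply: ler_powR; first by rewrite ler1n.
  by have h := hs; lra.
have As : abs_summable (fun j => wHN (s + 2) N j * A j ^+ 2).
  have [h _] := hu; apply: abs_summable_le (wsq_lty (@wH_ge0 _ _) h) => j j0.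
  rewrite ger0_norm; last by rewrite mulr_ge0 ?sqr_ge0 ?w0.
  by apply: le_trans (ler_norm _); exact: wle.
rewrite -(ler_pXn2r (n := 2))// ?nnegrE ?sqrtr_ge0 ?mulr_ge0//.
rewrite wnorm_sqr//; apply: tsum_le_bound => // n.
have head : psum (fun j => wHN (s + 2) N j * A j ^+ 2) N.+1 <= 11 / 5 * eps ^+ 2.
  apply: le_trans (a_energy N.+1); rewrite /psum !big_nat; apply: ler_sum => j /andP[j0 jN].
  by rewrite /wHN -ltnS jN /a /modeA exprMn.
have tl : \sum_(N.+1 <= j < n) (wHN (s + 2) N j * A j ^+ 2) <= 9 / 5 * eps ^+ 2.
  apply: le_trans (tail_le n); rewrite !big_nat; apply: ler_sum => j /andP[jN _].
  have j0 : (0 < j)%N by exact: leq_trans jN.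
  apply: le_trans (wle j j0) _.
  have -> : s + 2 = s + 1 + 1%:R by ring.
  rewrite wH_shift// expr1 -mulrA; apply: ler_wpM2l; first exact: wH_ge0.
  by rewrite /a /modeA exprMn lerDl sqr_ge0.
have -> : (2 * eps) ^+ 2 = 11 / 5 * eps ^+ 2 + 9 / 5 * eps ^+ 2 by field.
have [nN|Nn] := leqP n N.+1; last first.
  by rewrite (psum_tail _ (ltn0Sn N) (ltnW Nn)); exact: lerD.
apply: (@le_trans _ _ (psum (fun j => wHN (s + 2) N j * A j ^+ 2) N.+1)); last first.
  by rewrite -[leLHS]addr0; apply: lerD => //; rewrite mulr_ge0 ?sqr_ge0//; lra.
have [n0|n0] := posnP n.
  rewrite n0 /psum big_geq// big_nat sumr_ge0// => j /andP[j0 _].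
  by rewrite mulr_ge0 ?sqr_ge0 ?w0.
rewrite [leRHS](psum_tail _ n0 nN) lerDl big_nat sumr_ge0// => j /andP[jn _].
by rewrite mulr_ge0 ?sqr_ge0 ?w0//; exact: leq_trans jn.
Qed.

(** Young's inequality with parameter [eps]: half of [11 / 5 * eps] comes from
    the energy and [eps] from the sum of [j ^- 2]. *)
Lemma supnorm_le : (supnorm (u t) <= (21 / 10 * eps)%:E)%E.
Proof.
have s2 : 1 / 2 < s + 2 by have h := hs; lra.
have As : abs_summable A := Hstar_abs_summable s2 hu.
have An : abs_summable (fun j => `|A j|) by apply: abs_summable_le As => j _; rewrite normr_id.
apply: ge_ereal_sup => _ [x /= hx <-]; rewrite lee_fin (Hstar_sser hu As hx).
apply: le_trans (sser_bound x As) _.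
suff h : tsum (fun j => `|A j|) <= 21 / 10 * eps.
  apply: le_trans (ler_wpM2l (@phi_max_ge0 R) h) _.
  by rewrite ler_piMl ?phi_max_le1// mulr_ge0//; lra.
apply: tsum_le_bound => // n.
have := eps0; rewrite le_eqVlt => /orP[/eqP e|e0].
  rewrite -e mulr0 /psum big_nat big1// => j /andP[j0 _].
  have : psum (fun j => a t j ^+ 2) j.+1 <= 0 by apply: le_trans (a_energy _) _; rewrite -e expr0n mulr0.
  rewrite /psum big_nat_recr//= => h.
  have h1 : 0 <= \sum_(1 <= i < j) a t i ^+ 2 by apply: sumr_ge0 => i _; exact: sqr_ge0.
  have : a t j ^+ 2 = 0 by apply/eqP; rewrite eq_le sqr_ge0 andbT; lra.
  move=> /eqP; rewrite sqrf_eq0 mulf_eq0 pnatr_eq0 => /orP[/eqP j00|/eqP Aj0].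
    by rewrite j00 in j0.
  by rewrite -[A j]/(coef_path u t j) Aj0 normr0.
have y j : (0 < j)%N -> `|A j| <= (2 * eps)^-1 * a t j ^+ 2 + eps / 2 * j%:R ^- 2.
  move=> j0; have q0 : 0 < j%:R ^+ 2 :> R by rewrite exprn_gt0// ltr0n.
  have := young_scaled `|A j| q0 e0.
  by rewrite real_normK ?num_real// /a /modeA exprMn.
apply: (@le_trans _ _ (psum (fun j => (2 * eps)^-1 * a t j ^+ 2 + eps / 2 * j%:R ^- 2) n)).
  by rewrite /psum !big_nat; apply: ler_sum => j /andP[j0 _]; exact: y.
rewrite /psum big_split /= -!mulr_sumr -!/(psum _ _).
have i0 : 0 <= (2 * eps)^-1 by rewrite invr_ge0 mulr_ge0.
have i1 : 0 <= eps / 2 by rewrite divr_ge0.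
apply: le_trans (lerD (ler_wpM2l i0 (a_energy n)) (ler_wpM2l i1 (@psum_inv_sqr R n))) _.
by apply: le_of_eq; field; rewrite gt_eqF.
Qed.

End Estimates.

Section Solutions.
Context {R : realType}.
Variables (m s mu eps : R) (u0 v0 : R -> R).
Hypotheses (hm1 : - (1 / 2) <= m) (hm2 : m <= 1) (hm0 : m != 0) (hs : 1 / 2 < s).
Hypotheses (hu0 : Hstar (s + 2) u0) (hv0 : Hstar s v0).
Hypotheses (mu0 : 0 < mu) (hmu : mu <= 2 * Num.sqrt (1 + m)).
Let c := lamBound m.
Hypotheses (eps_ge0 : 0 <= eps) (small1 : eps ^+ 2 <= 64 / 10000 * mu)
  (small2 : (eps ^+ 2) ^+ 2 <= `|m| * mu / (3222 * c ^+ 2)).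
Hypothesis data : forall k,
  psum (fun j => init_modeA u0 j ^+ 2 + init_modeB m v0 j ^+ 2) k <= 2 * eps ^+ 2.

(** The value of the time bound, in units of [eps ^- 6], without the last
    factor of its denominator.  The energy bound holds up to twice this time;
    the margin leaves room for an open interval of existence. *)
Definition lifespan : R := `|m| * mu / (6595 * c ^+ 3).

Let c0 : 0 < c. Proof. by have [] := lamBoundE hm1. Qed.
Let hc := lam_le_lamBound hm1 hm2.

Lemma lifespan_gt0 : 0 < lifespan.
Proof.
by rewrite divr_gt0 ?mulr_gt0 ?normr_gt0 ?exprn_gt0 ?ltr0n.
Qed.

Let init_zero : eps = 0 -> forall j, (0 < j)%N -> init_modeA u0 j = 0 /\ init_modeB m v0 j = 0.
Proof.
move=> e j j0; have := data j.+1; rewrite e expr0n mulr0 /psum big_nat_recr//= => h.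
have h1 : 0 <= \sum_(1 <= i < j) (init_modeA u0 i ^+ 2 + init_modeB m v0 i ^+ 2).
  by apply: sumr_ge0 => i _; rewrite addr_ge0 ?sqr_ge0.
have hA := sqr_ge0 (init_modeA u0 j); have hB := sqr_ge0 (init_modeB m v0 j).
by split; apply/eqP; rewrite -sqrf_eq0; apply/eqP; lra.
Qed.

Let full_le (a b : R -> nat -> R) t : abs_summable (fun j => a t j ^+ 2) ->
  (forall n, mode_energy a b n t <= 11 / 5 * eps ^+ 2) ->
  (2 * pi)^-1 * tsum (fun j => a t j ^+ 2) <= eps ^+ 2.
Proof.
move=> sa hE; have h : tsum (fun j => a t j ^+ 2) <= 11 / 5 * eps ^+ 2.
  apply: tsum_le_bound => // n; apply: le_trans (hE n); rewrite /mode_energy /psum; apply: ler_sum => j _.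
  by rewrite lerDl sqr_ge0.
have t0 : 0 <= tsum (fun j => a t j ^+ 2) by apply: tsum_ge0 => // j _; exact: sqr_ge0.
have p0 : 0 <= (2 * pi)^-1 :> R by rewrite invr_ge0 mulr_ge0// pi_ge0.
apply: le_trans (ler_pM p0 t0 (@inv2pi_le R) h) _.
by have := sqr_ge0 eps; lra.
Qed.

Section Evolution.
Variables (I : set R) (u : R -> R -> R).
Hypothesis sol : weak_solution m s u0 v0 I u.
Let a := modeA u.
Let b := modeB m u.

Let a_init j : a 0 j = init_modeA u0 j.
Proof. by rewrite /a /modeA (coef_initial sol). Qed.

Let b_init j : b 0 j = init_modeB m v0 j.
Proof.
case: j => [|j]; first by rewrite /b /modeB /init_modeB !mul0r.
by rewrite /b /modeB (coef_initial_velocity hs sol).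
Qed.

Let ode : forall t, I t -> mode_ode m a b (modeK u) t := modes_ode hm1 hm2 hs sol.

Lemma energy_bound T n : 0 < eps -> I T -> `|T| * (eps ^+ 2) ^+ 3 <= 2 * lifespan ->
  mode_energy a b n T <= 11 / 5 * eps ^+ 2.
Proof.
move=> e0 IT hT; have [M hM] := modeK_bounded hs sol IT.
have e2 : 0 < eps ^+ 2 by rewrite exprn_gt0.
apply: (stability hm1 hm2 hm0 mu0 hmu c0 (lamBound_le2 hm1) hc e2 small1 small2 n hT _ hM) => //.
- by move=> t bt; exact: ode (between_I sol IT bt).
- move=> k; apply: le_trans (data k); rewrite /mode_energy /psum; apply: le_of_eq.
  by apply: eq_bigr => j _; rewrite a_init b_init.
Qed.

(** Since the energy bound keeps the Kirchhoff term below [eps ^+ 2], the growth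
    factor depends on [eps] and the constants alone, which makes it possible to
    choose [N] before the solution. *)
Lemma mode_bound T j : I T -> `|T| * (eps ^+ 2) ^+ 3 <= lifespan ->
  a T j ^+ 2 + b T j ^+ 2 <=
  (init_modeA u0 j ^+ 2 + init_modeB m v0 j ^+ 2) * expR (c * (lifespan / (eps ^+ 2) ^+ 2)).
Proof.
move=> IT hT.
have := eps_ge0; rewrite le_eqVlt => /orP[/eqP/esym e|e0].
  have [M hM] := modeK_bounded hs sol IT.
  have := mode_growth_abs j hc (fun t bt => ode (between_I sol IT bt)) hM.
  rewrite a_init b_init; case: j => [|j].
    by rewrite /init_modeA /init_modeB !mul0r expr0n add0r !mul0r.
  by have [-> ->] := init_zero e (ltn0Sn j); rewrite expr0n add0r !mul0r.
have e2 : 0 < eps ^+ 2 by rewrite exprn_gt0.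
have lp := lifespan_gt0.
have hK t : between0 T t -> 0 <= modeK u t <= eps ^+ 2.
  move=> bt; have It := between_I sol IT bt; rewrite (modeK_ge0 hs sol It)/=.
  apply: (@full_le a b); first exact: modeA_summable hs sol _ It.
  move=> n; apply: energy_bound => //.
  apply: le_trans (_ : lifespan <= _); last by lra.
  apply: le_trans hT; apply: ler_wpM2r; first by rewrite exprn_ge0// ltW.
  case: bt => /andP[h1 h2]; first by rewrite !ger0_norm//; exact: le_trans h2.
  by rewrite !ler0_norm//; [rewrite lerN2|exact: le_trans h2].
have := mode_growth_abs j hc (fun t bt => ode (between_I sol IT bt)) hK.
rewrite a_init b_init => h; apply: le_trans h _; apply: ler_wpM2l.
  by rewrite addr_ge0 ?sqr_ge0.
rewrite ler_expR -mulrA; apply: ler_wpM2l; first exact: ltW.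
rewrite ler_pdivlMr ?exprn_gt0//.
by apply: le_trans hT; apply: le_of_eq; ring.
Qed.

End Evolution.

Lemma tail_exists : 0 < eps -> exists N, (0 < N)%N /\ forall n,
  \sum_(N.+1 <= j < n) (wH (s + 1) j * ((init_modeA u0 j ^+ 2 + init_modeB m v0 j ^+ 2) *
     expR (c * (lifespan / (eps ^+ 2) ^+ 2)))) <= 9 / 5 * eps ^+ 2.
Proof.
move=> e0; set E := expR _.
have e2 : 0 < 9 / 5 * eps ^+ 2 by rewrite mulr_gt0 ?exprn_gt0 ?divr_gt0.
pose f j := wH (s + 1) j * ((init_modeA u0 j ^+ 2 + init_modeB m v0 j ^+ 2) * E).
have fs : abs_summable f.
  apply: abs_summable_ext (abs_summableZ E (abs_summableD (initA_summable hu0) (initB_summable hm1 hm2 hv0))) => j _.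
  by rewrite /f; ring.
have [N [N0 hN]] := abs_summable_tail fs e2; exists N; split => // n.
have f0 j : (0 < j)%N -> 0 <= f j by move=> j0; rewrite !mulr_ge0 ?wH_ge0 ?expR_ge0 ?addr_ge0 ?sqr_ge0.
apply: le_trans (hN n); rewrite -/(f _).
have [nN|Nn] := leqP n N; first by rewrite !big_geq// (leq_trans nN).
rewrite [leRHS]big_ltn//; apply: ler_wpDl => //.
by rewrite !big_nat; apply: ler_sum => j _; exact: ler_norm.
Qed.

(** The energy bound keeps the Kirchhoff term below the truncation level
    [eps ^+ 2], so that the truncated equations are the true ones.  For
    [eps = 0] the zero solution is obtained, on the whole line. *)
Lemma solution_exists : exists (I : set R) (u : R -> R -> R), weak_solution m s u0 v0 I u /\
  forall t, `|t| * (eps ^+ 2) ^+ 3 <= lifespan -> I t.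
Proof.
have lp := lifespan_gt0; have e20 := sqr_ge0 eps.
have [a [b [kap [M [M0 init bound ode kapE]]]]] := modes_exist c0 hc e20 (init_summable hm1 hm2 hs hu0 hv0).
have a_s t : abs_summable (fun j => a t j ^+ 2).
  apply: abs_summable_le (abs_summableZ ((2 * expR (M * `|t|)) ^+ 2) (init_summable hm1 hm2 hs hu0 hv0)) => j _.
  rewrite ger0_norm ?sqr_ge0// -exprMn -mulrA; apply: le_trans (ler_norm _).
  have [h _] := bound t j; rewrite -(real_normK (num_real (a t j))) ler_pXn2r// nnegrE//.
have full0 t : 0 <= (2 * pi)^-1 * tsum (fun j => a t j ^+ 2).
  rewrite mulr_ge0 ?invr_ge0 ?mulr_ge0 ?pi_ge0//.
  by apply: tsum_ge0 => // j _; exact: sqr_ge0.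
have weak (I : set R) : open I -> is_interval I -> I 0 ->
    (forall t, I t -> (2 * pi)^-1 * tsum (fun j => a t j ^+ 2) <= eps ^+ 2) ->
    weak_solution m s u0 v0 I (displacement a).
  move=> oI iI I0 hI.
  exact: (displacement_weak_solution hm1 hm2 hs hu0 hv0 (fun j => (init j).1) (fun j => (init j).2)
    bound M0 e20 ode kapE oI iI I0 hI).
have := eps_ge0; rewrite le_eqVlt => /orP[/eqP/esym e|e0].
  exists setT, (displacement a); split => //; apply: weak => //; first exact: openT.
  move=> t _; rewrite (@eq_tsum _ _ (fun=> 0)) ?tsum0 ?mulr0// => j j0.
  have [h _] := bound t j; have [hA hB] := init_zero e j0.
  rewrite hA hB normr0 addr0 mulr0 mulr0 normr_le0 in h.
  by rewrite (eqP h) expr0n.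
have e2 : 0 < eps ^+ 2 by rewrite exprn_gt0.
have e6 : 0 < (eps ^+ 2) ^+ 3 by rewrite exprn_gt0.
pose r := 2 * lifespan / (eps ^+ 2) ^+ 3.
have r0 : 0 < r by rewrite divr_gt0// mulr_gt0.
exists [set t | `|t| < r], (displacement a); split; last first.
  move=> t ht /=; rewrite /r ltr_pdivlMr//; apply: le_lt_trans ht _.
  by rewrite ltr_pMl// ltr1n.
apply: weak.
- rewrite (_ : [set t | `|t| < r] = ball (0 : R) r); first exact: ball_open.
  by apply/seteqP; split => t; rewrite /ball/= sub0r normrN.
- move=> x y /= hx hy z /andP[xz zy]; move: hx hy; rewrite !ltr_norml => /andP[h1 h2] /andP[h3 h4].
  by apply/andP; split; lra.
- by rewrite /= normr0.
- move=> t /=; rewrite /r ltr_pdivlMr// => /ltW ht; apply: (@full_le a b) => // n.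
  apply: (stability hm1 hm2 hm0 mu0 hmu c0 (lamBound_le2 hm1) hc e2 small1 small2 n ht (fun t _ => ode t) (kap := kap) (M := eps ^+ 2)) => //.
  + by move=> t' _; rewrite kapE le_min ge_min full0 e20 lexx orbT.
  + by move=> t' _ h; rewrite kapE min_l.
  + move=> k; apply: le_trans (data k); rewrite /mode_energy /psum; apply: le_of_eq.
    by apply: eq_bigr => j _; have [-> ->] := init j.
Qed.

Lemma long_time_bounds : exists N : nat, (1 <= N)%N /\
  forall (I : set R) (u : R -> R -> R), weak_solution m s u0 v0 I u ->
    forall t, I t -> `|t| * (eps ^+ 2) ^+ 3 <= lifespan ->
    [/\ Hstar (s + 2) (u t), HNnorm (s + 2) N (u t) <= 2 * eps
      & (supnorm (u t) <= (21 / 10 * eps)%:E)%E].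
Proof.
have lp := lifespan_gt0; have e20 := sqr_ge0 eps.
suff [N [N0 hN]] : exists N, (0 < N)%N /\ forall n,
  \sum_(N.+1 <= j < n) (wH (s + 1) j * ((init_modeA u0 j ^+ 2 + init_modeB m v0 j ^+ 2) *
     expR (c * (lifespan / (eps ^+ 2) ^+ 2)))) <= 9 / 5 * eps ^+ 2.
  exists N; split => // I u sol t It ht.
  have hu : Hstar (s + 2) (u t) by case: sol => _ [h _ _ _] _ _ _; exact: h.
  have hE n : mode_energy (modeA u) (modeB m u) n t <= 11 / 5 * eps ^+ 2.
    have := eps_ge0; rewrite le_eqVlt => /orP[/eqP/esym e|e0].
      rewrite /mode_energy /psum big_nat big1 ?mulr_ge0// => j /andP[j0 _]; apply/eqP.
      have := mode_bound sol j It ht; have [-> ->] := init_zero e j0.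
      rewrite expr0n add0r mul0r => h.
      by rewrite eq_le h addr_ge0 ?sqr_ge0.
    by apply: (energy_bound sol) => //; lra.
  have hT n : \sum_(N.+1 <= j < n) (wH (s + 1) j * (modeA u t j ^+ 2 + modeB m u t j ^+ 2)) <= 9 / 5 * eps ^+ 2.
    apply: le_trans (hN n); rewrite !big_nat; apply: ler_sum => j /andP[jN _].
    by apply: ler_wpM2l; [apply: wH_ge0; exact: leq_trans jN|exact (mode_bound sol j It ht)].
  split => //; first exact: (HNnorm_le hs hu eps_ge0 hE hT).
  exact: (supnorm_le hs hu eps_ge0 hE).
have := eps_ge0; rewrite le_eqVlt => /orP[/eqP/esym e|e0]; last exact: tail_exists.
exists 1; split => // n; rewrite big_nat big1 ?mulr_ge0// => j /andP[j1 _].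
have [-> ->] := init_zero e (ltnW j1).
by rewrite expr0n add0r mul0r mulr0.
Qed.

End Solutions.

Unset Implicit Arguments.

(* MathComp-Analysis.  The time bound |t| <= T1 * eps^-6 is written
   |t| * eps^6 <= T1, so that eps = 0 gives all times. *)
Theorem theorem4 (R : realType) (m s : R) (u0 v0 : R -> R)
    (hm1 : - (1 / 2) <= m) (hm2 : m <= 1) (hm0 : m != 0) (hs : 1 / 2 < s)
    (hu0 : Hstar (s + 2) u0) (hv0 : Hstar s v0) :
  let mu : R := Num.min (2 * Num.sqrt (1 + m)) (3 / 2 * Num.sqrt (4 + m)) in
  let eps0 : R := 8 / 100 * Num.sqrt mu in
  let c : R := if 0 <= m then 1 else (1 + m) `^ (- (1 / 2)) in
  let eps : R := Num.max (Hnorm 1 u0) (Hm1norm m v0) in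
  let eps1 : R := Num.min eps0 ((`|m| * mu / (3222 * c ^+ 2)) `^ (1 / 4)) in
  let T1 : R := `|m| * mu /
    (6595 * c ^+ 3 *
      (1 + 30 * (c / (`|m| * mu)) * eps ^+ 2 + 90 * (c / mu) * eps ^+ 2)) in
  eps <= eps1 ->
  exists N : nat, (1 <= N)%N /\
    (exists (I : set R) (u : R -> R -> R), weak_solution m s u0 v0 I u /\
       forall t, `|t| * eps ^+ 6 <= T1 -> I t) /\
    (forall (I : set R) (u : R -> R -> R), weak_solution m s u0 v0 I u ->
       forall t, I t -> `|t| * eps ^+ 6 <= T1 ->
         [/\ Hstar (s + 2) (u t),
             HNnorm (s + 2) N (u t) <= 2 * eps
           & (supnorm (u t) <= (21 / 10 * eps)%:E)%E]).
Proof.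
move=> mu eps0 c eps eps1 T1; rewrite le_min => /andP[le0 le1].
have [c0 _] := lamBoundE hm1; rewrite -[lamBound m]/c in c0.
have q1 : 0 < 1 + m by clear -hm1; lra.
have q4 : 0 < 4 + m by clear -hm1; lra.
have mu0 : 0 < mu by rewrite lt_min !mulr_gt0 ?sqrtr_gt0 ?divr_gt0.
have hmu : mu <= 2 * Num.sqrt (1 + m) by rewrite ge_min lexx.
have n0 : 0 <= Hnorm 1 u0 by exact: sqrtr_ge0.
have eps_ge0 : 0 <= eps by exact: max_ge0 n0.
have small1 : eps ^+ 2 <= 64 / 10000 * mu.
  have -> : 64 / 10000 = (8 / 100) ^+ 2 :> R by field.
  exact: sqr_le_of_le_sqrt eps_ge0 (ltW mu0) le0.
have m0 : 0 < `|m| by rewrite normr_gt0.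
have small2 : (eps ^+ 2) ^+ 2 <= `|m| * mu / (3222 * c ^+ 2).
  refine (quartic_le_of_le_powR eps_ge0 _ le1).
  have n2 : 0 <= 3222 :> R by exact: ler0n.
  exact: divr_ge0 (mulr_ge0 (ltW m0) (ltW mu0)) (mulr_ge0 n2 (sqr_ge0 c)).
have data k : psum (fun j => init_modeA u0 j ^+ 2 + init_modeB m v0 j ^+ 2) k <= 2 * eps ^+ 2.
  apply: le_trans (initial_energy_le hm1 hm2 hs hu0 hv0 k) _.
  exact: sqrD_le_max n0 (sqrtr_ge0 _).
have T1_le : T1 <= lifespan m mu.
  have k0 : 0 < 6595 * c ^+ 3 by rewrite mulr_gt0 ?exprn_gt0 ?ltr0n.
  have d1 : 1 <= 1 + 30 * (c / (`|m| * mu)) * eps ^+ 2 + 90 * (c / mu) * eps ^+ 2.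
    have r1 : 0 <= c / (`|m| * mu) by exact: divr_ge0 (ltW c0) (mulr_ge0 (ltW m0) (ltW mu0)).
    have r2 : 0 <= c / mu by exact: divr_ge0 (ltW c0) (ltW mu0).
    rewrite -addrA lerDl; apply: addr_ge0.
      exact: mulr_ge0 (mulr_ge0 (ler0n _ 30) r1) (sqr_ge0 _).
    exact: mulr_ge0 (mulr_ge0 (ler0n _ 90) r2) (sqr_ge0 _).
  exact: ler_div_mul (mulr_ge0 (ltW m0) (ltW mu0)) k0 d1.
have eps6 : eps ^+ 6 = (eps ^+ 2) ^+ 3 by rewrite -exprM.
have [N [N1 bounds]] := long_time_bounds hm1 hm2 hm0 hs hu0 hv0 mu0 hmu eps_ge0 small1 small2 data.
exists N; split => //; split.
  have [I [u [sol hI]]] := solution_exists hm1 hm2 hm0 hs hu0 hv0 mu0 hmu eps_ge0 small1 small2 data.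
  exists I, u; split => // t ht; apply: hI; rewrite -eps6; exact: le_trans ht T1_le.
move=> I u sol t It ht; apply: (bounds I u sol t It); rewrite -eps6; exact: le_trans ht T1_le.
Qed.
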